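(* Let $n\ge 1$. Then the following statements hold true: (i) if $m\ge 3$ is odd, then for any solution $u$ of the radial initial value problem $$(\ast)\qquad (-\Delta)^m u(r)=e^{u(r)},\quad u(0)=\alpha_0,\ u'(0)=0,\quad \Delta^k u(0)=\alpha_k,\ (\Delta^k u)'(0)=0\ \ (k=1,\dots,m-1)$$ (with $\alpha_0,\dots,\alpha_{m-1}\in\mathbb{R}$) satisfying $\mathrm{sign}\,\alpha_k\ne(-1)^k$ for at least one value of $k\in\{1,\dots,m-1\}$, we have $$u(r)<-Cr^4\qquad\text{for any } r>\overline r$$ for some $C,\overline r>0$; (ii) if $m\ge 3$ is odd and $1\le n\le 2m-1$, then any solution $u$ of $(\ast)$ (for any $\alpha_0,\dots,\alpha_{m-1}\in\mathbb{R}$) satisfies $u(r)<-Cr^K$ for any $r>\overline r$, for some $C,\overline r>0$ and some positive integer $K$; (iii) if $n=1$ and $m\ge 1$ is odd, then any solution $u$ of $(-\Delta)^m u=e^u$ in $\mathbb{R}$ (also nonsymmetric) satisfies $u(x)<-C|x|^K$ for any $|x|>\overline r$, for some $C,\overline r>0$ and some positive integer $K$; (iv) if $m\ge 2$ is even, $\alpha\in\mathbb{R}$ and $\beta$ belongs to the interior of $\mathcal A_\alpha$, then there exists $C>0$ such that $$u_{\alpha,\beta}(r)\sim -Cr^{2m-2}\qquad\text{as } r\to+\infty;$$ (v) if $m\ge 2$ is even, $\alpha\in\mathbb{R}$ and $\beta\in\partial\mathcal A_\alpha$, then $$u_{\alpha,\beta}(r)=o(r^{2m-2})\qquad\text{as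 } r\to+\infty$$ and there exist $C,\overline r>0$ such that $$u_{\alpha,\beta}(r)<-2m\log r+C\qquad\text{for any } r>\overline r.$$
   Context: A function $u=u(r)$ of $r\ge 0$ is identified with the radial function $x\mapsto u(|x|)$ on $\mathbb{R}^n$ (for $n=1$: an even function), and $\Delta u(r)=u''(r)+\frac{n-1}{r}u'(r)$ for $r>0$. Solutions are classical ($C^{2m}$, including at the origin) and taken on their maximal interval of continuation; for $m$ odd all solutions of $(\ast)$ are defined on $[0,+\infty)$. For $\alpha\in\mathbb{R}$ and $\beta=(\beta_1,\dots,\beta_{m-1})\in\mathbb{R}^{m-1}$, $u_{\alpha,\beta}$ denotes the unique solution of $(\ast)$ with $\alpha_0=\alpha$ and $\alpha_k=\beta_k$ for $k=1,\dots,m-1$, and $$\mathcal A_\alpha:=\{\beta\in\mathbb{R}^{m-1}: u_{\alpha,\beta}\text{ is defined on all of }[0,+\infty)\};$$ $\partial\mathcal A_\alpha$ is its boundary in $\mathbb{R}^{m-1}$. $f\sim g$ means $f/g\to 1$. *)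

(* Defs.v *)
From HB Require Import structures.
From mathcomp Require Export all_boot all_order all_algebra.
From mathcomp Require Export all_classical all_reals all_analysis.
Export Order.TTheory GRing.Theory Num.Theory.
Export numFieldNormedType.Exports.

Set Implicit Arguments.
Unset Strict Implicit.
Unset Printing Implicit Defensive.

Local Open Scope classical_set_scope.
Local Open Scope ring_scope.

(* The library norm of 'rV[R]_n is the max norm. *)
Definition enorm (R : realType) (n : nat) (x : 'rV[R]_n) : R :=
  Num.sqrt (\sum_(i < n) x 0 i ^+ 2).

Definition eball0 (R : realType) (n : nat) (T : \bar R) : set 'rV[R]_n :=
  [set x | ((enorm x)%:E < T)%E].
Arguments eball0 {R} n T.

(* C^k on an open subset D of a finite-dimensional space: the iterated
   directional derivatives of order <= k exist and are continuous on D. *)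
Fixpoint class_C (R : realType) (V : normedModType R) (k : nat) (D : set V)
    (f : V -> R) : Prop :=
  (forall x, D x -> {for x, continuous f}) /\
  match k with
  | 0%N => True
  | j.+1 => forall v : V,
      (forall x, D x -> derivable f x v) /\ class_C j D ('D_v f)
  end.

(* Meaningful for r > 0 only. *)
Definition rlap (R : realType) (n : nat) (f : R -> R) : R -> R :=
  fun r => (f^`()^`())%classic r + (n%:R - 1) / r * (f^`())%classic r.

(* f, considered on ]0, +oo[ and extended to r = 0 by continuity, satisfies
   f(0) = c and f'(0) = 0. *)
Definition value_flat_at0 (R : realType) (f : R -> R) (c : R) : Prop :=
  f r @[r --> 0^'+] --> c /\ (f r - c) / r @[r --> 0^'+] --> 0.

(* Classical solution on [0, T[ of the initial value problem with data
   alpha_0 = alpha and alpha_(k.+1) = beta 0 k for k < m.-1.  The values of u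
   outside [0, T[ are irrelevant. *)
Definition radial_solution (R : realType) (n m : nat) (alpha : R)
    (beta : 'rV[R]_m.-1) (T : \bar R) (u : R -> R) : Prop :=
  [/\ (0 < T)%E,
      class_C (2 * m) (eball0 n T) (fun x => u (enorm x)),
      forall r : R, 0 < r -> (r%:E < T)%E ->
        iter m (fun f s => - rlap n f s) u r = expR (u r),
      u 0 = alpha /\ value_flat_at0 u alpha
    & forall k : 'I_m.-1, value_flat_at0 (iter k.+1 (rlap n) u) (beta 0 k)].
Arguments radial_solution {R} n m alpha beta T u.

Definition maximal_solution (R : realType) (n m : nat) (alpha : R)
    (beta : 'rV[R]_m.-1) (T : \bar R) (u : R -> R) : Prop :=
  radial_solution n m alpha beta T u /\
  forall (T' : \bar R) (v : R -> R),
    radial_solution n m alpha beta T' v ->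
    (forall r : R, 0 <= r -> (r%:E < T)%E -> v r = u r) ->
    (T' <= T)%E.
Arguments maximal_solution {R} n m alpha beta T u.

Definition global_data (R : realType) (n m : nat) (alpha : R) :
    set 'rV[R]_m.-1 :=
  [set beta | exists u : R -> R, maximal_solution n m alpha beta +oo%E u].
Arguments global_data {R} n m alpha.

Definition boundary (X : topologicalType) (A : set X) : set X :=
  closure A `\` interior A.

(* Main.v *)
Require Import Defs.
From mathcomp Require Import ring lra zify.

Set Implicit Arguments.
Unset Strict Implicit.
Unset Printing Implicit Defensive.

Local Open Scope classical_set_scope.
Local Open Scope ring_scope.

(** Put [w k] for the [k]-th iterated Laplacian of [u], a function of [r = |x|].
    Then [w 0 = u], the Laplacian of [w k] is [w (k + 1)], and
    [w m = (-1)^m exp u], so everything rests on the comparison principle for one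
    radial Laplacian: the flux [r^(n-1) f'] of [f] has derivative
    [r^(n-1) (Delta f)], hence the sign of [Delta f] passes to [f'] and to [f]
    ([lap_ge0], [lap_le], [chain_le]).

    Signs. Put [s k = (-1)^k w k]; then [- Delta (s k) = s (k + 1)] and
    [s m = exp u > 0]. Going down from [k = m], either all [s k] with [1 <= k] are
    positive, or the first one that is not positive decreases below a negative
    constant, and iterated integration puts [u] below [- c r^(2 k)] for even [k] and
    above [c r^(2 k)] for odd [k]. In the odd case [exp u] is large: below the top
    index this destroys the positivity of [s (m - 1)], and at the top index, where
    [m] is even, the solution of [Delta^m u = exp u] blows up at a finite radius
    ([blowup]). So only even [k >= 2] survives ([dichotomy]).
    - A wrong sign in the data excludes the positive alternative, so [u] is below
      [- C r^4] ([odd_wrong_sign]).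
    - In the positive alternative the functions [s (m - j)] are bounded below by
      [c r^(2 j - n)] one after the other, which is only possible if
      [2 (m - 1) < n]. When [n <= 2 m - 1] this leaves [n = 2 m - 1], and then [u]
      decreases at least linearly ([low_dim], [odd_low_dim]).
    - On the line the same descent applies to the plain derivatives of [u], at each
      end separately ([half_line], [line_decay]).

    Existence. Averaging inverts the radial Laplacian; Picard iteration in a
    Gaussian-weighted norm solves the equation globally when the nonlinearity is
    Lipschitz ([chain_exists]), and the radial function so obtained is smooth at
    the origin because the averages intertwine with [(1 / r) d/dr]
    ([chain_tower], [class_C_tower]). The exponential is truncated at a function
    [M], and an a priori bound by [M] then shows that the truncation is
    inactive. For odd [m] the polyharmonic polynomial with the same data is such an
    [M], so every maximal solution is global ([odd_global], [odd_maximal]).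

    Even order. A global solution has [w (m - 1) < 0] by the blow-up argument, and
    [w (m - 1)] increases to a limit [l <= 0], so that [u] behaves like
    [l * coef (m - 1) * r^(2 m - 2)] ([chain_asymp]).
    - If the data are interior, raising them slightly keeps the solution global; the
      raised solution has a negative last Laplacian, larger than that of [u] by a
      fixed amount, so [l < 0] ([even_interior]).
    - The set of global data is closed, by truncation at a common polynomial bound
      ([even_closed]); and if [l < 0], then [exp u] decays so fast that nearby data
      still give global solutions ([strict_interior]). So [l = 0] on the boundary.
      The logarithmic bound holds for all global solutions: in the positive
      alternative [u] decreases, and comparing [u] at [r] and [r / 2^m] gives
      [c exp (u r) r^(2 m) <= u (r / 2^m) - u r], which bounds [u r + 2 m ln r]
      ([positive_drop], [log_bound]). *)

(** * One-variable calculus *)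

Notation isd f x d := (is_derive (x : _) 1 f d).

Section Calculus.
Variable R : realType.
Implicit Types (f g : R -> R) (x a b : R).

Lemma isd_eq f x a b : isd f x a -> a = b -> isd f x b.
Proof. by move=> h <-. Qed.

Lemma isd_cst x (c : R) : isd (fun=> c) x 0.
Proof. exact: is_derive_cst. Qed.

Lemma isd_id x : isd (fun t => t) x 1.
Proof. exact: is_derive_id. Qed.

Lemma isdD f g x a b : isd f x a -> isd g x b ->
  isd (fun t => f t + g t) x (a + b).
Proof. by move=> hf hg; exact: is_deriveD. Qed.

Lemma isdB f g x a b : isd f x a -> isd g x b ->
  isd (fun t => f t - g t) x (a - b).
Proof. by move=> hf hg; exact: is_deriveB. Qed.

Lemma isdN f x a : isd f x a -> isd (fun t => - f t) x (- a).
Proof. by move=> hf; exact: is_deriveN. Qed.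

Lemma isdM f g x a b : isd f x a -> isd g x b ->
  isd (fun t => f t * g t) x (a * g x + f x * b).
Proof.
move=> hf hg; apply: is_derive_eq (is_deriveM hf hg) _.
by rewrite /GRing.scale /= addrC (mulrC (g x)).
Qed.

Lemma isdZ f x (c : R) a : isd f x a -> isd (fun t => c * f t) x (c * a).
Proof. by move=> hf; apply: isd_eq (isdM (isd_cst x c) hf) _; rewrite mul0r add0r. Qed.

Lemma isdX f x k a : isd f x a ->
  isd (fun t => f t ^+ k) x (k%:R * f x ^+ k.-1 * a).
Proof.
move=> hf; elim: k => [|k IH].
  by under eq_fun do rewrite expr0; rewrite !mul0r; exact: isd_cst.
under eq_fun do rewrite exprS; apply: isd_eq (isdM hf IH) _ => /=.
by case: k {IH} => [|k] /=; rewrite ?exprS -?natr1; ring.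
Qed.

Lemma isd_pow x k : isd (fun t => t ^+ k) x (k%:R * x ^+ k.-1).
Proof. by apply: isd_eq (isdX k (isd_id x)) _; rewrite mulr1. Qed.

Lemma isd_comp f g x a b : isd f (g x) a -> isd g x b ->
  isd (fun t => f (g t)) x (a * b).
Proof. by move=> hf hg; exact: is_derive1_comp. Qed.

Lemma isdV f x a : f x != 0 -> isd f x a ->
  isd (fun t => (f t)^-1) x (- a / f x ^+ 2).
Proof.
move=> f0 hf; apply: is_derive_eq (is_deriveV f0 hf) _.
by rewrite /GRing.scale /= mulNr mulrC mulNr.
Qed.

Lemma isd_exp f x a : isd f x a ->
  isd (fun t => expR (f t)) x (expR (f x) * a).
Proof. by move=> hf; apply: isd_comp hf; exact: is_derive_expR. Qed.

Lemma isd_cont f x a : isd f x a -> {for x, continuous f}.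
Proof. by case=> hf _; apply/differentiable_continuous/derivable1_diffP. Qed.

Lemma isd_derive1 f x a : isd f x a -> (f^`())%classic x = a.
Proof. by case=> _; rewrite derive1E. Qed.

Lemma near_oo x a b : a < x < b -> \near x, a < x < b.
Proof. by move=> xab; near=> y; have : y \in `]a, b[; [near: y; apply: near_in_itvoo; rewrite in_itv /=|rewrite in_itv /=].
Unshelve. all: by end_near. Qed.

(** Derivatives are total operators on functions, so identities between them can only be
    used where the functions agree on a neighbourhood. *)
Lemma isd_local f g a b x d : a < x < b -> (forall y, a < y < b -> f y = g y) ->
  isd f x d -> isd g x d.
Proof.
move=> xab fg; apply: near_eq_is_derive.
by near=> y; apply: fg; near: y; exact: near_oo.
Unshelve. all: by end_near. Qed.

Lemma MVT_isd f (f' : R -> R) a b : a < b ->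
  (forall x, a <= x <= b -> isd f x (f' x)) ->
  exists2 c, a < c < b & f b - f a = f' c * (b - a).
Proof.
move=> ab h.
have [||c] := @MVT R f f' a b ab.
- by move=> x; rewrite in_itv /= => /andP[ax xb]; apply: h; rewrite !ltW.
- apply: continuous_in_subspaceT => x; rewrite inE /= in_itv /= => xab.
  by apply: isd_cont; exact: h.
- by rewrite in_itv /=; exists c.
Qed.

Lemma rlimP f a (l : R) : f r @[r --> a^'+] --> l <->
  forall e, 0 < e -> exists2 d : R, 0 < d & forall r, a < r < a + d -> `|f r - l| < e.
Proof.
split.
- move=> /cvgrPdist_lt h e e0; have := h e e0.
  rewrite near_withinE near_simpl => /nbhs_ballP[d /= d0 hd].
  exists d => // r /andP[ar rd]; rewrite distrC; apply: hd => //.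
  by rewrite /ball /= ltr0_norm; lra.
- move=> h; apply/cvgrPdist_lt => e /h[d d0 hd].
  rewrite near_withinE near_simpl; apply/nbhs_ballP; exists d => // r.
  rewrite /ball /= => rd ar; rewrite distrC; apply: hd.
  by rewrite ar /=; move: rd; rewrite ltr0_norm; lra.
Qed.

Lemma cont_rlim f a : {for a, continuous f} -> f r @[r --> a^'+] --> f a.
Proof. by move=> h; apply: cvg_at_right_filter. Qed.

Lemma rlim_cst a (c : R) : (fun=> c) r @[r --> a^'+] --> c.
Proof. exact: cvg_cst. Qed.

Lemma rlimD f g a (l k : R) : f r @[r --> a^'+] --> l ->
  g r @[r --> a^'+] --> k -> (f r + g r) @[r --> a^'+] --> l + k.
Proof. by move=> hf hg; exact: cvgD hf hg. Qed.

Lemma rlimN f a (l : R) : f r @[r --> a^'+] --> l ->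
  (- f r) @[r --> a^'+] --> - l.
Proof. by move=> hf; exact: cvgN hf. Qed.

Lemma rlimB f g a (l k : R) : f r @[r --> a^'+] --> l ->
  g r @[r --> a^'+] --> k -> (f r - g r) @[r --> a^'+] --> l - k.
Proof. by move=> hf hg; apply: rlimD hf _; exact: rlimN. Qed.

Lemma rlimM f g a (l k : R) : f r @[r --> a^'+] --> l ->
  g r @[r --> a^'+] --> k -> (f r * g r) @[r --> a^'+] --> l * k.
Proof. by move=> hf hg; exact: cvgM hf hg. Qed.

Lemma rlim_comp f g a (l : R) : {for l, continuous g} ->
  f r @[r --> a^'+] --> l -> g (f r) @[r --> a^'+] --> g l.
Proof. by move=> hg hf; exact: (cvg_comp _ _ hf hg). Qed.

Lemma rlim_ge f a b (l c : R) : a < b -> f r @[r --> a^'+] --> l ->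
  (forall r, a < r < b -> c <= f r) -> c <= l.
Proof.
move=> ab /rlimP h hc; rewrite leNgt; apply/negP => lc.
have [|d d0 hd] := h (c - l); first by lra.
pose r := a + Num.min d (b - a) / 2.
have m0 : 0 < Num.min d (b - a) by rewrite lt_min d0 subr_gt0.
have m1 : Num.min d (b - a) <= d by rewrite ge_min lexx.
have m2 : Num.min d (b - a) <= b - a by rewrite ge_min lexx orbT.
have /hc h1 : a < r < b by rewrite /r; lra.
have /hd : a < r < a + d by rewrite /r; lra.
by rewrite ltr_norml; lra.
Qed.

Lemma rlim_le f a b (l c : R) : a < b -> f r @[r --> a^'+] --> l ->
  (forall r, a < r < b -> f r <= c) -> l <= c.
Proof.
move=> ab /cvgN h hc; rewrite -lerN2; apply: rlim_ge ab h _ => r /hc.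
by rewrite lerN2.
Qed.

Lemma rlim_eq f g a b (l : R) : a < b -> (forall r, a < r < b -> f r = g r) ->
  f r @[r --> a^'+] --> l -> g r @[r --> a^'+] --> l.
Proof.
move=> ab fg /rlimP h; apply/rlimP => e /h[d d0 hd].
exists (Num.min d (b - a)); first by rewrite lt_min d0 subr_gt0.
have m1 : Num.min d (b - a) <= d by rewrite ge_min lexx.
have m2 : Num.min d (b - a) <= b - a by rewrite ge_min lexx orbT.
move=> r rm; rewrite -fg; last by lra.
by apply: hd; lra.
Qed.

Lemma incr_from f (f' : R -> R) a b (l : R) :
  (forall x, a < x < b -> isd f x (f' x) /\ 0 <= f' x) ->
  f r @[r --> a^'+] --> l -> forall r, a < r < b -> l <= f r.
Proof.
move=> h hl r /andP[ar rb].
apply: (@rlim_le f a r l (f r) ar hl) => s /andP[as' sr].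
have [|c /andP[c1 c2] hc] := @MVT_isd f f' s r sr.
  by move=> x /andP[x1 x2]; have [|//] := h x; lra.
have [_ c0] := h c ltac:(lra).
by rewrite -subr_ge0 hc mulr_ge0 // subr_ge0 ltW.
Qed.

Lemma incr_oo f (f' : R -> R) a b :
  (forall x, a < x < b -> isd f x (f' x) /\ 0 <= f' x) ->
  forall r s, a < r -> r <= s -> s < b -> f r <= f s.
Proof.
move=> h r s ar; rewrite le_eqVlt => /predU1P[->//|rs] sb.
have [|c /andP[c1 c2] hc] := @MVT_isd f f' r s rs.
  by move=> x /andP[x1 x2]; have [|//] := h x; lra.
have [_ c0] := h c ltac:(lra).
by rewrite -subr_ge0 hc mulr_ge0 // subr_ge0 ltW.
Qed.

Lemma sincr_oo f (f' : R -> R) a b :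
  (forall x, a < x < b -> isd f x (f' x) /\ 0 < f' x) ->
  forall r s, a < r -> r < s -> s < b -> f r < f s.
Proof.
move=> h r s ar rs sb.
have [|c /andP[c1 c2] hc] := @MVT_isd f f' r s rs.
  by move=> x /andP[x1 x2]; have [|//] := h x; lra.
have [_ c0] := h c ltac:(lra).
by rewrite -subr_gt0 hc mulr_gt0 // subr_gt0.
Qed.

End Calculus.


(** * Comparison for the radial Laplacian *)

Lemma down_ind (m : nat) (P : nat -> Prop) : P m ->
  (forall k, (k < m)%N -> P k.+1 -> P k) -> forall k, (k <= m)%N -> P k.
Proof.
move=> Pm step k km; rewrite -(subKn km); move: (leq_subr k m).
elim: (m - k)%N => [|j IH] jm; first by rewrite subn0.
have e : (m - j.+1).+1 = (m - j)%N by rewrite -subSn.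
apply: step; first by rewrite e leq_subr.
by rewrite e; apply: IH; exact: ltnW.
Qed.

Section Radial.
Variable R : realType.
Variable n : nat.
Hypothesis n1 : (1 <= n)%N.
Implicit Types (f g : R -> R) (a b r : R).

Lemma bounded_rlim f b (l : R) : f r @[r --> 0^'+] --> l ->
  (forall r, 0 < r <= b -> {for r, continuous f}) ->
  exists2 N : R, 0 <= N & forall r, 0 < r <= b -> `|f r| <= N.
Proof.
move=> /rlimP /(_ 1 ltr01)[d d0 hd] hc.
have [bd|db] := ltP b d.
  exists (`|l| + 1) => [|r /andP[r0 rb]]; first by rewrite addr_ge0.
  have /hd : 0 < r < 0 + d by lra.
  by have := ler_normD (f r - l) l; rewrite subrK => h1 h2; lra.
have [||c _ hcm] := @EVT_max R (fun r => `|f r|) (d / 2) b; first by lra.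
  apply: continuous_in_subspaceT => x; rewrite inE /= in_itv /= => xab.
  apply: (@continuous_comp _ _ _ f (fun y : R => `|y|)).
    by apply: hc; lra.
  exact: norm_continuous.
exists (`|l| + 1 + `|f c|) => [|r /andP[r0 rb]].
  by rewrite !addr_ge0.
have [rd|rd] := ltP r d.
  have /hd : 0 < r < 0 + d by lra.
  have := ler_normD (f r - l) l; rewrite subrK => h1 h2.
  by have := normr_ge0 (f c); lra.
have := hcm r; rewrite in_itv /= => /(_ ltac:(lra)) h.
by have := normr_ge0 l; lra.
Qed.

(** A bound that can always be replaced by half of it plus [eps] improves to
    [2 * eps], up to an arbitrarily small error; this avoids attained suprema in the
    Gronwall arguments. *)
Lemma contract_bound (P : R -> Prop) (eps N0 : R) :
  0 <= eps -> 0 <= N0 -> P N0 ->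
  (forall x y, x <= y -> P x -> P y) ->
  (forall N, 0 <= N -> P N -> P (N / 2 + eps)) ->
  forall d, 0 < d -> P (2 * eps + d).
Proof.
move=> e0 N00 PN0 mono step d d0.
have h j : P (2 * eps + N0 / 2 ^+ j).
  elim: j => [|j IH]; first by apply: mono PN0; rewrite expr0; lra.
  have p0 : 0 <= N0 / 2 ^+ j by rewrite divr_ge0 // exprn_ge0.
  have := step _ _ IH; move=> /(_ ltac:(lra)); apply: mono.
  rewrite exprS invfM; lra.
have [j hj] : exists j : nat, N0 / 2 ^+ j <= d.
  exists (Num.truncn (N0 / d)).+1.
  rewrite ler_pdivrMr ?exprn_gt0 // mulrC -ler_pdivrMr //.
  have h1 := truncnS_gt (N0 / d).
  apply: (le_trans (ltW h1)).
  by rewrite -natrX ler_nat ltnW // ltn_expl.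
by apply: mono (h j); lra.
Qed.

(** [q] stands for [f'], so that the second equation is
    [f'' + (n - 1) / r * f' = g]. *)
Definition lap (a b : R) (f q g : R -> R) := forall r, a < r < b ->
  isd f r (q r) /\ isd q r (g r - (n%:R - 1) / r * q r).

Lemma lapD a b f q g f' q' g' : lap a b f q g -> lap a b f' q' g' ->
  lap a b (fun r => f r + f' r) (fun r => q r + q' r) (fun r => g r + g' r).
Proof.
move=> h h' r rab; have [h1 h2] := h r rab; have [h1' h2'] := h' r rab.
split; first exact: isdD.
by apply: isd_eq (isdD h2 h2') _; ring.
Qed.

Lemma lapZ a b (c : R) f q g : lap a b f q g ->
  lap a b (fun r => c * f r) (fun r => c * q r) (fun r => c * g r).
Proof.
move=> h r rab; have [h1 h2] := h r rab.
split; first exact: isdZ.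
by apply: isd_eq (isdZ c h2) _; ring.
Qed.

Lemma lapN a b f q g : lap a b f q g ->
  lap a b (fun r => - f r) (fun r => - q r) (fun r => - g r).
Proof.
move=> h r rab; have [h1 h2] := h r rab.
split; first exact: isdN.
by apply: isd_eq (isdN h2) _; ring.
Qed.

Lemma lapB a b f q g f' q' g' : lap a b f q g -> lap a b f' q' g' ->
  lap a b (fun r => f r - f' r) (fun r => q r - q' r) (fun r => g r - g' r).
Proof. by move=> h /lapN h'; exact: lapD. Qed.

Lemma lap_sub a b a' b' f q g : a <= a' -> b' <= b ->
  lap a b f q g -> lap a' b' f q g.
Proof. by move=> aa bb h r rab; apply: h; lra. Qed.

Lemma lap_eq a b f q g g' : (forall r, a < r < b -> g r = g' r) ->
  lap a b f q g -> lap a b f q g'.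
Proof. by move=> e h r rab; rewrite -e //; exact: h. Qed.

Lemma lap_flux a b f q g : 0 <= a -> lap a b f q g ->
  forall r, a < r < b -> isd (fun s => s ^+ n.-1 * q s) r (r ^+ n.-1 * g r).
Proof.
move=> a0 h r rab; have [_ h2] := h r rab.
apply: isd_eq (isdM (isd_pow r n.-1) h2) _.
have r0 : r != 0 by apply/eqP; lra.
case: n n1 => // -[|k] _ /=; first by rewrite !expr0; ring.
by rewrite -(natr1 k.+1) exprS; field.
Qed.

Lemma rlim_flux a q (q0 : R) : q r @[r --> a^'+] --> q0 ->
  (r ^+ n.-1 * q r) @[r --> a^'+] --> a ^+ n.-1 * q0.
Proof.
move=> h; apply: cvgM h; apply: (@cont_rlim _ (fun r : R => r ^+ n.-1)).
exact: isd_cont (isd_pow a n.-1).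
Qed.

(** The flux [r^(n-1) f'] has derivative [r^(n-1) g], so the sign of [g]
    passes to [f'] and then to [f]. *)
Lemma lap_ge0 a b f q g (f0 q0 : R) : 0 <= a -> lap a b f q g ->
  f r @[r --> a^'+] --> f0 -> q r @[r --> a^'+] --> q0 -> 0 <= q0 ->
  (forall r, a < r < b -> 0 <= g r) ->
  forall r, a < r < b -> 0 <= q r /\ f0 <= f r.
Proof.
move=> a0 h hf hq q00 g0.
have qp r : a < r < b -> 0 <= q r.
  move=> rab; have r0 : 0 < r by lra.
  rewrite -(pmulr_rge0 _ (exprn_gt0 n.-1 r0)).
  apply: le_trans (@incr_from _ _ _ a b _ _ (rlim_flux hq) r rab).
    by rewrite mulr_ge0 // exprn_ge0.
  move=> x xab; split; first exact: (lap_flux a0 h).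
  by rewrite mulr_ge0 ?exprn_ge0 ?g0 //; lra.
move=> r rab; split; first exact: qp.
apply: (@incr_from _ f q a b _ _ hf r rab) => x xab; split; last exact: qp.
by have [] := h x xab.
Qed.

Lemma lap_gt0 a b f q g (f0 q0 : R) : 0 <= a -> lap a b f q g ->
  f r @[r --> a^'+] --> f0 -> q r @[r --> a^'+] --> q0 -> 0 <= q0 ->
  (forall r, a < r < b -> 0 < g r) ->
  forall r, a < r < b -> 0 < q r /\ f0 < f r.
Proof.
move=> a0 h hf hq q00 g0.
have H := lap_ge0 a0 h hf hq q00 (fun r rab => ltW (g0 r rab)).
have qp r : a < r < b -> 0 < q r.
  move=> rab; have r0 : 0 < r by lra.
  rewrite -(pmulr_rgt0 _ (exprn_gt0 n.-1 r0)).
  have mab : a < (a + r) / 2 < b by lra.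
  have [qm _] := H _ mab.
  have : ((a + r) / 2) ^+ n.-1 * q ((a + r) / 2) < r ^+ n.-1 * q r.
    apply: (@sincr_oo _ (fun s => s ^+ n.-1 * q s)
       (fun s => s ^+ n.-1 * g s) a b); try lra.
    move=> x xab; split; first exact: (lap_flux a0 h).
    by rewrite mulr_gt0 ?exprn_gt0 ?g0 //; lra.
  apply: le_lt_trans; rewrite mulr_ge0 // exprn_ge0 //; lra.
move=> r rab; split; first exact: qp.
have mab : a < (a + r) / 2 < b by lra.
have [_ fm] := H _ mab.
apply: le_lt_trans fm _.
apply: (@sincr_oo _ f q a b); try lra.
by move=> x xab; split; [have [] := h x xab|exact: qp].
Qed.

Lemma lap_le a b f q g F Q G (f0 q0 F0 Q0 : R) : 0 <= a ->
  lap a b f q g -> lap a b F Q G ->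
  f r @[r --> a^'+] --> f0 -> q r @[r --> a^'+] --> q0 ->
  F r @[r --> a^'+] --> F0 -> Q r @[r --> a^'+] --> Q0 ->
  f0 <= F0 -> q0 <= Q0 -> (forall r, a < r < b -> g r <= G r) ->
  forall r, a < r < b -> q r <= Q r /\ f r <= F r.
Proof.
move=> a0 h H hf hq hF hQ fF qQ gG r rab.
have [] := @lap_ge0 a b _ _ _ (F0 - f0) (Q0 - q0) a0 (lapB H h)
  (rlimB hF hf) (rlimB hQ hq) _ _ r rab; try lra.
by move=> x xab; have := gG x xab; lra.
Qed.

(** The iterated radial Laplacians of [w 0] on [(0, b)]. The limits at [0] carry all that
    is needed of the regularity at the origin: with [q k -> 0] the flux starts from
    [0], and [al k] is the value of [w k] there. *)
Definition chain (m : nat) (b : R) (w q : nat -> R -> R) (al : nat -> R) :=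
  forall k, (k < m)%N ->
    [/\ lap 0 b (w k) (q k) (w k.+1), w k r @[r --> 0^'+] --> al k
      & q k r @[r --> 0^'+] --> 0].

Lemma chainB m b w q al w' q' al' : chain m b w q al -> chain m b w' q' al' ->
  chain m b (fun k r => w k r - w' k r) (fun k r => q k r - q' k r)
    (fun k => al k - al' k).
Proof.
move=> h h' k km; have [h1 h2 h3] := h k km; have [h1' h2' h3'] := h' k km.
split; [exact: lapB h1 h1'|exact: rlimB h2 h2'|].
by have := rlimB h3 h3'; rewrite subr0.
Qed.

Lemma chainN m b w q al : chain m b w q al ->
  chain m b (fun k r => - w k r) (fun k r => - q k r) (fun k => - al k).
Proof.
move=> h k km; have [h1 h2 h3] := h k km.
split; [exact: lapN h1|exact: rlimN h2|].
by have := rlimN h3; rewrite oppr0.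
Qed.

Lemma chain_sub m m' b b' w q al : (m' <= m)%N -> b' <= b ->
  chain m b w q al -> chain m' b' w q al.
Proof.
move=> mm bb h k km; have [h1 h2 h3] := h k (leq_trans km mm).
by split => //; apply: lap_sub h1.
Qed.

Lemma chain_isd m b w q al k r : chain m b w q al -> (k < m)%N -> 0 < r < b ->
  isd (w k) r (q k r).
Proof. by move=> h km rb; have [/(_ r rb)[]] := h k km. Qed.

Lemma chain_ge0 m b w q al : chain m b w q al ->
  (forall k, (k < m)%N -> 0 <= al k) -> (forall r, 0 < r < b -> 0 <= w m r) ->
  forall k r, (k < m)%N -> 0 < r < b -> 0 <= w k r /\ al k <= w k r.
Proof.
move=> h al0 wm0.
have step k r : (k < m)%N -> (forall r, 0 < r < b -> 0 <= w k.+1 r) ->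
    0 < r < b -> al k <= w k r.
  move=> km wk rb; have [h1 h2 h3] := h k km.
  by have [] := lap_ge0 (lexx 0) h1 h2 h3 (lexx 0) wk rb.
have H : forall k, (k <= m)%N -> forall r, 0 < r < b -> 0 <= w k r.
  apply: down_ind => // k km wk r rb.
  exact: le_trans (al0 k km) (step k r km wk rb).
by move=> k r km rb; split; [exact: H (ltnW km) r rb|apply: step => //; exact: H].
Qed.

Lemma chain_le m b w q al w' q' al' :
  chain m b w q al -> chain m b w' q' al' ->
  (forall k, (k < m)%N -> al k <= al' k) ->
  (forall r, 0 < r < b -> w m r <= w' m r) ->
  forall k r, (k < m)%N -> 0 < r < b -> w k r <= w' k r.
Proof.
move=> h h' hal hm k r km rb.
have [||+ _] := @chain_ge0 m b _ _ _ (chainB h' h) _ _ k r km rb.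
- by move=> i im; rewrite subr_ge0 hal.
- by move=> s sb; rewrite subr_ge0 hm.
- by rewrite subr_ge0.
Qed.

(** For [lam >= 0] this weight lies between [1] and a constant on every bounded
    interval. *)
Definition gauss (lam : R) (r : R) := expR (lam * r ^+ 2).

Lemma gauss_lap lam b : lap 0 b (gauss lam) (fun r => 2 * lam * r * gauss lam r)
  (fun r => (2 * n%:R * lam + 4 * lam ^+ 2 * r ^+ 2) * gauss lam r).
Proof.
have h r : isd (gauss lam) r (2 * lam * r * gauss lam r).
  apply: isd_eq (isd_exp (isdZ lam (isd_pow r 2))) _.
  by rewrite expr1 /gauss; ring.
move=> r /andP[r0 rb]; split => //.
apply: isd_eq (isdM (isdZ (2 * lam) (isd_id r)) (h r)) _.
by field; apply/eqP; lra.
Qed.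

Lemma gauss_rlim lam : gauss lam r @[r --> 0^'+] --> (1 : R).
Proof.
have -> : 1 = gauss lam 0 by rewrite /gauss expr0n mulr0 expR0.
apply: cont_rlim.
exact: isd_cont (isd_exp (isdZ lam (isd_pow 0 2))).
Qed.

Lemma gauss_q_rlim lam : (2 * lam * r * gauss lam r) @[r --> 0^'+] --> (0 : R).
Proof.
have {2}-> : 0 = 2 * lam * 0 * gauss lam 0 by rewrite mulr0 mul0r.
apply: (@cont_rlim _ (fun r => 2 * lam * r * gauss lam r)).
exact: isd_cont (isdM (isdZ _ (isd_id 0)) (isd_exp (isdZ lam (isd_pow 0 2)))).
Qed.

Lemma gauss_gt0 lam r : 0 < gauss lam r.
Proof. exact: expR_gt0. Qed.

(** The weight satisfies [Delta (gauss lam) >= 2 n lam * gauss lam]: inverting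
    the Laplacian gains a factor [1 / (2 n lam)] in the weighted norm. For the
    levels [k < m - 1] a factor [1] is enough. *)
Lemma weight_step m b d q al lam (B : R) : 1 <= 2 * lam -> 0 <= B ->
  chain m b d q al -> (forall k, (k < m)%N -> `|al k| <= B) ->
  (forall r, 0 < r < b -> `|d m r| <= 2 * lam * B * gauss lam r) ->
  forall k r, (k < m)%N -> 0 < r < b -> `|d k r| <= B * gauss lam r.
Proof.
move=> lam1 B0 h hal hm.
have nlam : 2 * lam <= 2 * n%:R * lam.
  have : (1 : R) <= n%:R by rewrite ler1n.
  nra.
have step k : (k < m)%N ->
    (forall r, 0 < r < b -> `|d k.+1 r| <= 2 * lam * B * gauss lam r) ->
    forall r, 0 < r < b -> `|d k r| <= B * gauss lam r.
  move=> km hk r rb; have [h1 h2 h3] := h k km.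
  have G := lapZ B (@gauss_lap lam b).
  have G1 : B * gauss lam r @[r --> 0^'+] --> B * (1 : R).
    exact: rlimM (cvg_cst _) (gauss_rlim _).
  have G2 : B * (2 * lam * r * gauss lam r) @[r --> 0^'+] --> (0 : R).
    by have := rlimM (cvg_cst B) (@gauss_q_rlim lam); rewrite mulr0; exact.
  have cmp s : 0 < s < b -> 2 * lam * B * gauss lam s <=
      B * ((2 * n%:R * lam + 4 * lam ^+ 2 * s ^+ 2) * gauss lam s).
    move=> sb; rewrite (mulrC _ B) -!mulrA ler_wpM2l // !mulrA ler_pM2r ?gauss_gt0 //.
    have : 0 <= 4 * (lam * s) ^+ 2 by rewrite mulr_ge0 // sqr_ge0.
    rewrite exprMn; lra.
  have hal' := hal k km; rewrite ler_norml in hal'.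
  rewrite ler_norml; apply/andP; split.
    have [|||_] := lap_le (lexx 0) (lapN h1) G (rlimN h2) (rlimN h3) G1 G2 _ _ _ rb.
    - by move=> *; lra.
    - by rewrite oppr0.
    - move=> s sb; apply: le_trans (cmp s sb); have := hk s sb.
      by rewrite ler_norml; lra.
    - by move=> *; lra.
  have [|||_ //] := lap_le (lexx 0) h1 G h2 h3 G1 G2 _ _ _ rb.
  - by lra.
  - by [].
  - move=> s sb; apply: le_trans (cmp s sb); have := hk s sb.
    by rewrite ler_norml; lra.
have H : forall k, (k <= m)%N -> forall r, 0 < r < b ->
    `|d k r| <= 2 * lam * B * gauss lam r.
  apply: down_ind => // k km hk r rb; apply: le_trans (step k km hk r rb) _.
  rewrite ler_pM2r ?gauss_gt0 //; nra.
by move=> k r km; apply: step => //; exact: H.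
Qed.

(** With [lam = 1 + K] one passage from [d 0] to [d m] and back down halves the
    weighted norm of [d 0], up to the contribution [eps] of the data. *)
Lemma chain_gronwall m b c d q al (K eps : R) : (0 < m)%N -> c < b ->
  0 <= K -> 0 <= eps -> chain m b d q al ->
  (forall k, (k < m)%N -> `|al k| <= eps) ->
  (forall r, 0 < r < c -> `|d m r| <= K * `|d 0%N r|) ->
  forall r, 0 < r < c -> `|d 0%N r| <= 2 * eps * gauss (1 + K) r.
Proof.
move=> m0 cb K0 e0 h hal hm r0 r0c.
set lam := 1 + K.
have [h1 h2 h3] := h 0%N m0.
have hc : chain m c d q al by apply: chain_sub h => //; lra.
have [|N0 N00 hN0] := bounded_rlim h2 (b := c).
  move=> r rc; apply: isd_cont (chain_isd h m0 _); lra.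
pose P N := forall r, 0 < r < c -> `|d 0%N r| <= N * gauss lam r.
suff H e : 0 < e -> `|d 0%N r0| <= (2 * eps + e) * gauss lam r0.
  rewrite leNgt; apply/negP => lt.
  have g0 := gauss_gt0 lam r0.
  set x := `|_| in lt H; set g := gauss lam r0 in lt H g0.
  have := H ((x / g - 2 * eps) / 2); rewrite divr_gt0 //; last first.
    by rewrite subr_gt0 ltr_pdivlMr.
  move=> /(_ isT) h'.
  have e1 : x / g * g = x by rewrite divfK // gt_eqF.
  nra.
move=> e_gt0.
apply: (@contract_bound P eps N0 e0 N00 _ _ _ e e_gt0 r0 r0c).
- move=> r rc; apply: le_trans (hN0 r _) _; first by lra.
  rewrite ler_peMr // -expR0 ler_expR mulr_ge0 ?sqr_ge0 // /lam; lra.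
- move=> x y xy Px r rc; apply: le_trans (Px r rc) _.
  by rewrite ler_pM2r ?gauss_gt0.
- move=> N N_ge0 PN r rc.
  apply: (@weight_step m c d q al lam (N / 2 + eps) _ _ hc) => //.
  + by rewrite /lam; lra.
  + by lra.
  + by move=> k km; apply: le_trans (hal k km) _; lra.
  + move=> s sc; apply: le_trans (hm s sc) _.
    have g0 := gauss_gt0 lam s.
    have := PN s sc; move=> /(ler_wpM2l K0) /le_trans; apply.
    rewrite mulrA ler_pM2r // /lam; nra.
Qed.

Lemma chain_unique m b d q al : (0 < m)%N -> chain m b d q al ->
  (forall k, (k < m)%N -> al k = 0) ->
  (forall c, c < b -> exists2 K : R, 0 <= K &
     forall r, 0 < r < c -> `|d m r| <= K * `|d 0%N r|) ->
  forall r, 0 < r < b -> d 0%N r = 0.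
Proof.
move=> m0 h hal hK r /andP[r0 rb].
have [|K' K0 hm] := hK ((r + b) / 2); first by lra.
have := @chain_gronwall m b ((r + b) / 2) d q al K' 0 m0 _ K0 (lexx _) h _ hm r.
rewrite mulr0 mul0r normr_le0 => H; apply/eqP; apply: H; try lra.
by move=> k km; rewrite hal // normr0.
Qed.

End Radial.


(** * From classical radial solutions to chains *)

Section Extract.
Variable R : realType.
Variable n : nat.
Hypothesis n1 : (1 <= n)%N.
Implicit Types (f g : R -> R) (a b r : R).

Fixpoint smooth_on (b : R) (k : nat) (f : R -> R) : Prop :=
  if k is j.+1 then exists2 g : R -> R,
    (forall r, 0 < r < b -> isd f r (g r)) & smooth_on b j g
  else True.

Lemma smooth_on_eq b k f g : (forall r, 0 < r < b -> f r = g r) ->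
  smooth_on b k f -> smooth_on b k g.
Proof.
case: k => //= k e [f' hf' sf']; exists f' => // r rb.
exact: isd_local rb e (hf' r rb).
Qed.

Lemma smooth_onW b k f : smooth_on b k.+1 f -> smooth_on b k f.
Proof.
elim: k f => // k IH f [f' h1 /IH h2]; by exists f'.
Qed.

Lemma smooth_onD b k f g : smooth_on b k f -> smooth_on b k g ->
  smooth_on b k (fun r => f r + g r).
Proof.
elim: k f g => // k IH f g [f' hf sf] [g' hg sg].
exists (fun r => f' r + g' r) => [r rb|]; last exact: IH.
by apply: isdD; [exact: hf|exact: hg].
Qed.

Lemma smooth_onM b k f g : smooth_on b k f -> smooth_on b k g ->
  smooth_on b k (fun r => f r * g r).
Proof.
elim: k f g => // k IH f g sf sg.
have sf' := smooth_onW sf; have sg' := smooth_onW sg.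
case: sf => f' hf sf; case: sg => g' hg sg.
exists (fun r => f' r * g r + f r * g' r) => [r rb|].
  by apply: isdM; [exact: hf|exact: hg].
by apply: smooth_onD; apply: IH.
Qed.

Lemma smooth_on_cst b k (c : R) : smooth_on b k (fun=> c).
Proof.
elim: k c => // k IH c; exists (fun=> 0) => [r rb|]; last exact: IH.
exact: isd_cst.
Qed.

Lemma smooth_on_inv b k : smooth_on b k (fun r => r^-1).
Proof.
elim: k => // k IH; exists (fun r => -1 * (r^-1 * r^-1)) => [r /andP[r0 rb]|].
  apply: isd_eq (isdV _ (isd_id r)) _; first by apply/eqP; lra.
  by rewrite expr2 invfM !mulN1r.
exact: (smooth_onM (smooth_on_cst _ _ _) (smooth_onM IH IH)).
Qed.

Lemma isd_line (V : normedModType R) (F : V -> R) (e : V) t :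
  derivable F (t *: e) e -> isd (fun s => F (s *: e)) t ('D_e F (t *: e)).
Proof.
have E : (fun h : R => h^-1 *: (((fun s => F (s *: e)) \o shift t) (h *: 1) - F (t *: e)))
    = (fun h : R => h^-1 *: ((F \o shift (t *: e)) (h *: e) - F (t *: e))).
  apply/funext => h /=; congr (_ *: (F _ - _)).
  by rewrite scalerDl /GRing.scale /= mulr1.
by move=> h; split; rewrite /derivable /derive E.
Qed.

(** Restriction to a ray turns the iterated directional derivatives into iterated
    derivatives in [r]. *)
Lemma class_C_line (V : normedModType R) (e : V) (D : set V) b k (F : V -> R) f :
  (forall t, 0 < t < b -> D (t *: e)) -> (forall t, 0 < t < b -> f t = F (t *: e)) ->
  class_C k D F -> smooth_on b k f.
Proof.
move=> hD; elim: k F f => // k IH F f fF [_ hF].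
have [dF cF] := hF e.
exists (fun t => 'D_e F (t *: e)); last by apply: IH cF.
move=> t tb; apply: isd_local tb _ (isd_line (dF _ (hD t tb))).
by move=> s sb; rewrite fF.
Qed.

Definition e0 : 'rV[R]_n := delta_mx 0 (Ordinal n1).

Lemma enorm_e0 t : enorm (t *: e0) = `|t|.
Proof.
rewrite /enorm (bigD1 (Ordinal n1)) //= !mxE !eqxx mulr1 big1 ?addr0 ?sqrtr_sqr //.
by move=> i ne; rewrite !mxE eqxx /= (negbTE ne) mulr0 expr0n.
Qed.

Lemma rlap_lap b f q g : lap n 0 b f q g -> forall r, 0 < r < b ->
  (f^`())%classic r = q r /\ rlap n f r = g r.
Proof.
move=> h.
have e r : 0 < r < b -> (f^`())%classic r = q r.
  by move=> rb; have [h1 _] := h r rb; exact: isd_derive1 h1.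
move=> r rb; split; first exact: e.
have [h1 h2] := h r rb.
rewrite /rlap e //; rewrite (isd_derive1 (isd_local rb _ h2)); first by ring.
by move=> s sb; rewrite e.
Qed.

Lemma lap_eqf b f f' q g : (forall r, 0 < r < b -> f r = f' r) ->
  lap n 0 b f q g -> lap n 0 b f' q g.
Proof.
move=> e h r rb; have [h1 h2] := h r rb; split => //.
exact: isd_local rb e h1.
Qed.

Lemma smooth_on_rlap b k f : smooth_on b k.+2 f ->
  lap n 0 b f (f^`())%classic (rlap n f) /\ smooth_on b k (rlap n f).
Proof.
case=> f1 h1 [f2 h2 s2].
have s1 : smooth_on b k f1 by apply: smooth_onW; exists f2.
have e1 r : 0 < r < b -> f1 r = (f^`())%classic r.
  by move=> rb; rewrite (isd_derive1 (h1 r rb)).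
have e2 r : 0 < r < b -> isd (f^`())%classic r (f2 r).
  move=> rb; apply: isd_local rb e1 (h2 r rb).
have e3 r : 0 < r < b -> rlap n f r = f2 r + (n%:R - 1) * r^-1 * f1 r.
  by move=> rb; rewrite /rlap (isd_derive1 (e2 r rb)) -e1.
split.
  move=> r rb; split; first by rewrite -e1 //; exact: h1.
  by apply: isd_eq (e2 r rb) _; rewrite e3 // -e1 //; ring.
apply: (@smooth_on_eq b k (fun r => f2 r + (n%:R - 1) * r^-1 * f1 r)).
  by move=> r rb; rewrite e3.
apply: smooth_onD => //; apply: smooth_onM => //.
by apply: smooth_onM; [exact: smooth_on_cst|exact: smooth_on_inv].
Qed.

(** By the mean value theorem [q] is small at some point of [(r, 2r)], and the
    flux varies little between that point and [r]. *)
Lemma flat_q_rlim b f q g (c G : R) : 0 < b -> 0 <= G -> lap n 0 b f q g ->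
  (forall r, 0 < r < b -> `|g r| <= G) ->
  ((f r - c) / r) @[r --> 0^'+] --> (0 : R) -> q r @[r --> 0^'+] --> (0 : R).
Proof.
move=> b0 G0 h hg /rlimP hf; apply/rlimP => e e_gt0.
pose C : R := 2 ^+ n.-1; have C0 : 0 < C by rewrite exprn_gt0.
pose e' := e / (8 * C).
have e'0 : 0 < e' by rewrite divr_gt0 // mulr_gt0.
have [d d0 hd] := hf e' e'0.
pose d' := Num.min (Num.min d b / 2) (e' / (G + 1)).
have G1 : 0 < G + 1 by lra.
have m1 : d' <= Num.min d b / 2 by rewrite ge_min lexx.
have m2 : d' <= e' / (G + 1) by rewrite ge_min lexx orbT.
have m3 : Num.min d b <= d by rewrite ge_min lexx.
have m4 : Num.min d b <= b by rewrite ge_min lexx orbT.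
have m5 : 0 < Num.min d b by rewrite lt_min d0.
exists d'; first by rewrite /d' lt_min; apply/andP; split; apply: divr_gt0.
move=> r /andP[r0 rd]; rewrite subr0.
have small s : 0 < s -> s <= 2 * r -> `|f s - c| <= e' * s.
  move=> s0 sr; have := hd s ltac:(lra); rewrite subr0 normrM normfV.
  by rewrite (gtr0_norm s0) ltr_pdivrMr // => /ltW.
have [|x xr|xi /andP[x1 x2] hxi] := @MVT_isd _ f q r (2 * r); first by lra.
  by have [] := h x ltac:(lra).
have qxi : `|q xi| <= 3 * e'.
  have : `|q xi * r| <= 3 * e' * r.
    have -> : q xi * r = (f (2 * r) - c) - (f r - c) by lra.
    apply: le_trans (ler_normB _ _) _.
    have := small (2 * r) ltac:(lra) ltac:(lra).
    by have := small r ltac:(lra) ltac:(lra); lra.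
  by rewrite normrM (gtr0_norm r0) ler_pM2r.
have [x xr|ze /andP[z1 z2] hze] := @MVT_isd _ (fun s => s ^+ n.-1 * q s)
    (fun s => s ^+ n.-1 * g s) r xi x1.
  by apply: (lap_flux n1 (lexx 0) h); lra.
have pw s : 0 <= s -> s <= 2 * r -> s ^+ n.-1 <= C * r ^+ n.-1.
  by move=> s0 sr; rewrite /C -exprMn lerXn2r // nnegrE; lra.
have rp : 0 < r ^+ n.-1 by rewrite exprn_gt0.
have : `|r ^+ n.-1 * q r| <= C * r ^+ n.-1 * (3 * e' + G * r).
  have -> : r ^+ n.-1 * q r = xi ^+ n.-1 * q xi - ze ^+ n.-1 * g ze * (xi - r).
    by rewrite -hze; ring.
  apply: le_trans (ler_normB _ _) _; rewrite [leRHS]mulrDr.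
  have n1' s : 0 < s -> `|s ^+ n.-1| = s ^+ n.-1.
    by move=> s0; rewrite ger0_norm // exprn_ge0 // ltW.
  apply: lerD.
    rewrite normrM n1'; last by lra.
    apply: ler_pM => //; first by rewrite exprn_ge0 //; lra.
    by apply: pw; lra.
  rewrite -mulrA normrM n1'; last by lra.
  apply: ler_pM => //; first by rewrite exprn_ge0 //; lra.
    by apply: pw; lra.
  rewrite normrM; apply: ler_pM => //; first by apply: hg; lra.
  by rewrite gtr0_norm; lra.
rewrite normrM (gtr0_norm rp) (mulrC C) -mulrA ler_pM2l // => H.
apply: le_lt_trans H _.
have Gr : G * r <= e'.
  have : (G + 1) * r <= e'.
    by rewrite mulrC -ler_pdivlMr //; lra.
  by nra.
have eC : e = 8 * C * e' by rewrite /e'; field; rewrite gt_eqF.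
by rewrite eC; nra.
Qed.

Lemma iter_rlap m b (w q : nat -> R -> R) :
  (forall k, (k < m)%N -> lap n 0 b (w k) (q k) (w k.+1)) ->
  forall k, (k <= m)%N -> forall r, 0 < r < b -> iter k (rlap n) (w 0%N) r = w k r.
Proof.
move=> h; elim=> [//|k IH] km r rb /=.
have := h k km; move=> /(lap_eqf (fun s sb => esym (IH (ltnW km) s sb))).
by move=> /rlap_lap /(_ r rb)[].
Qed.

(** The sign can be pulled out of each [rlap] only where the functions are
    differentiable, whence the detour through [lap]. *)
Lemma iter_Nrlap m b (w q : nat -> R -> R) :
  (forall k, (k < m)%N -> lap n 0 b (w k) (q k) (w k.+1)) ->
  forall k, (k <= m)%N -> forall r, 0 < r < b ->
    iter k (fun f s => - rlap n f s) (w 0%N) r = (-1) ^+ k * w k r.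
Proof.
move=> h; elim=> [|k IH] km r rb; first by rewrite expr0 mul1r.
have := lapZ ((-1) ^+ k) (h k km).
move=> /(lap_eqf (fun s sb => esym (IH (ltnW km) s sb))) /rlap_lap /(_ r rb)[_ /=].
by move=> ->; rewrite exprS mulN1r mulNr.
Qed.

(** The data as a sequence; the value [0] at indices [k >= m] is a default. *)
Definition data (m : nat) (alpha : R) (beta : 'rV[R]_m.-1) (k : nat) : R :=
  if k is j.+1 then (if insub j is Some i then beta 0 i else 0) else alpha.

Lemma data_ord m alpha (beta : 'rV[R]_m.-1) (i : 'I_m.-1) :
  data alpha beta i.+1 = beta 0 i.
Proof. by rewrite /data valK. Qed.

(** Differentiability on a ray gives the equations, and the flatness of each [w k]
    at the origin gives [q k -> 0] by [flat_q_rlim], since [w k.+1] is bounded near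
    the origin. *)
Lemma radial_chain m alpha (beta : 'rV[R]_m.-1) T u b :
  radial_solution n m alpha beta T u -> 0 < b -> (b%:E <= T)%E ->
  chain n m b (fun k => iter k (rlap n) u)
    (fun k => ((iter k (rlap n) u)^`())%classic) (data alpha beta) /\
  forall r, 0 < r < b -> iter m (rlap n) u r = (-1) ^+ m * expR (u r).
Proof.
move=> [T0 cC hu [u0 hal] hbe] b0 bT.
have su : smooth_on b (2 * m) u.
  apply: (@class_C_line _ e0 (eball0 n T) b (2 * m) (fun x => u (enorm x))) cC.
    move=> t /andP[t0 tb]; rewrite /eball0 /= enorm_e0 gtr0_norm //.
    by apply: lt_le_trans bT; rewrite lte_fin.
  by move=> t /andP[t0 tb]; rewrite enorm_e0 gtr0_norm.
have sk k : (k <= m)%N -> smooth_on b (2 * (m - k)) (iter k (rlap n) u).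
  elim: k => [|k IH] km; first by rewrite subn0.
  have := IH (ltnW km); rewrite -(subnSK km) mulnS /=.
  by case/smooth_on_rlap.
have lk k : (k < m)%N -> lap n 0 b (iter k (rlap n) u)
   ((iter k (rlap n) u)^`())%classic (iter k.+1 (rlap n) u).
  move=> km; have := sk k (ltnW km); rewrite -(subnSK km) mulnS /=.
  by case/smooth_on_rlap.
have ek := iter_Nrlap lk.
have em r : 0 < r < b -> iter m (rlap n) u r = (-1) ^+ m * expR (u r).
  move=> rb; rewrite -hu; last 2 first.
  - by case/andP: rb.
  - by apply: lt_le_trans bT; rewrite lte_fin; case/andP: rb.
  by rewrite ek // mulrA -exprMn mulrNN mulr1 expr1n mul1r.
split => // k km.
have vf j : (j < m)%N -> value_flat_at0 (iter j (rlap n) u) (data alpha beta j).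
  case: j => [//|j] jm.
  have jm' : (j < m.-1)%N by rewrite -ltnS prednK // (leq_trans _ jm).
  by have := hbe (Ordinal jm'); rewrite -(data_ord alpha).
have [v1 v2] := vf k km.
split => //; first exact: lk.
have [l hl] : exists l : R, iter k.+1 (rlap n) u r @[r --> 0^'+] --> l.
  have [km1|] := ltnP k.+1 m; first by exists (data alpha beta k.+1); case: (vf _ km1).
  move=> mk; have ->: k.+1 = m by apply/eqP; rewrite eqn_leq km.
  exists ((-1) ^+ m * expR alpha).
  apply: (@rlim_eq _ (fun r => (-1) ^+ m * expR (u r)) _ 0 b) => //.
    by move=> r rb; rewrite em.
  apply: rlimM; first exact: cvg_cst.
  by apply: (@rlim_comp _ _ expR); [exact: continuous_expR|case: hal].
have [d d0 hd] := (rlimP _ _ _).1 hl 1 ltr01.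
apply: (@flat_q_rlim (Num.min d b) _ _ _ _ (`|l| + 1) _ _ _ _ v2).
- by rewrite lt_min d0.
- by rewrite addr_ge0.
- by apply: lap_sub (lk k km); rewrite // ge_min lexx orbT.
- move=> r; rewrite lt_min => /andP[r0 /andP[rd rb]].
  have := hd r; rewrite add0r r0 rd => /(_ isT) h.
  by have := ler_normD (iter k.+1 (rlap n) u r - l) l; rewrite subrK; lra.
Qed.

End Extract.


(** * Global existence for Lipschitz nonlinearities *)

Section Inverse.
Variable R : realType.
Implicit Types (f g u : R -> R) (a b r : R).

(** Continuity on [[0, +oo[], one-sided at the origin. *)
Definition cont0 g := continuous (fun r : R => g `|r|).

Lemma cont0_at g r : cont0 g -> 0 < r -> {for r, continuous g}.
Proof.
move=> h r0; have := h r; rewrite /continuous_at gtr0_norm // => /cvgrPdist_lt hg.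
apply/cvgrPdist_lt => e /hg H; near=> y.
have y0 : 0 < y by near: y; exact: (lt_nbhsr r0).
by rewrite -(gtr0_norm y0); near: y.
Unshelve. all: by end_near. Qed.

Lemma cont0_rlim g : cont0 g -> g r @[r --> 0^'+] --> g 0.
Proof.
move=> h; have := @cont_rlim _ (fun r : R => g `|r|) 0 (h 0); rewrite normr0.
by apply: (@rlim_eq _ _ _ 0 1) => // r /andP[r0 _]; rewrite gtr0_norm.
Qed.

Lemma cont0_intro g : g r @[r --> 0^'+] --> g 0 ->
  (forall r, 0 < r -> {for r, continuous g}) -> cont0 g.
Proof.
move=> h0 h r; have [->|r0] := eqVneq r 0.
  apply/cvgrPdist_lt => e e0; have [d d0 hd] := (rlimP _ _ _).1 h0 e e0.
  apply/nbhs_ballP; exists d => // y; rewrite /ball /= sub0r normrN normr0 => yd.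
  have [->|y0] := eqVneq y 0; first by rewrite normr0 subrr normr0.
  by rewrite distrC; apply: hd; rewrite add0r normr_gt0 y0.
apply: (@continuous_comp _ _ _ (fun y : R => `|y|) g).
  exact: norm_continuous.
by apply: h; rewrite normr_gt0.
Qed.

Lemma cont0_isd g (g' : R -> R) : g r @[r --> 0^'+] --> g 0 ->
  (forall r, 0 < r -> isd g r (g' r)) -> cont0 g.
Proof. by move=> h0 h; apply: cont0_intro => // r /h; exact: isd_cont. Qed.

Lemma cont0_cst (c : R) : cont0 (fun=> c).
Proof. by move=> r; exact: cvg_cst. Qed.

Lemma cont0_id : cont0 (fun r => r).
Proof. by move=> r; exact: norm_continuous. Qed.

Lemma cont0D f g : cont0 f -> cont0 g -> cont0 (fun r => f r + g r).
Proof. by move=> hf hg r; exact: cvgD (hf r) (hg r). Qed.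

Lemma cont0M f g : cont0 f -> cont0 g -> cont0 (fun r => f r * g r).
Proof. by move=> hf hg r; exact: cvgM (hf r) (hg r). Qed.

Lemma cont0X f k : cont0 f -> cont0 (fun r => f r ^+ k).
Proof.
move=> hf; elim: k => [|k IH]; first exact: cont0_cst.
by under eq_fun do rewrite exprS; exact: cont0M hf IH.
Qed.

Lemma cont0_comp f g : continuous g -> cont0 f -> cont0 (fun r => g (f r)).
Proof. by move=> hg hf r; apply: (cvg_comp _ _ (hf r)); exact: hg. Qed.

Lemma cont0_min f g : cont0 f -> cont0 g -> cont0 (fun r => Num.min (f r) (g r)).
Proof. by move=> hf hg r; apply: continuous_min; [exact: hf|exact: hg]. Qed.

Lemma cont0_bounded f b : cont0 f ->
  exists2 N : R, 0 <= N & forall r, 0 <= r <= b -> `|f r| <= N.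
Proof.
move=> hf; have [|N N0 hN] := bounded_rlim (cont0_rlim hf) (b := b).
  by move=> r /andP[r0 _]; exact: cont0_at.
exists (N + `|f 0|) => [|r /andP[r0 rb]]; first by rewrite addr_ge0.
move: r0; rewrite le_eqVlt => /predU1P[<-|r0]; first lra.
have := hN r; rewrite r0 rb => /(_ isT).
by have := normr_ge0 (f 0); lra.
Qed.

(** Integrating from [-1] makes the primitive derivable also at [0]. *)
Definition prim g r : R :=
  (\int[lebesgue_measure]_(t in `[-1, r]) g `|t|)%R -
  (\int[lebesgue_measure]_(t in `[-1, 0]) g `|t|)%R.

Lemma prim0 g : prim g 0 = 0.
Proof. exact: subrr. Qed.

Lemma prim_isd g r : cont0 g -> 0 <= r -> isd (prim g) r (g r).
Proof.
move=> hg r0.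
have [||d1 d2] := @continuous_FTC1_closed R (fun t => g `|t|) (-1) r (r + 1) ltac:(lra) _ _ (hg r).
- apply: continuous_compact_integrable; first exact: segment_compact.
  exact: continuous_subspaceT.
- by lra.
have e : g `|r| = g r by rewrite ger0_norm.
have h : isd (fun r => \int[lebesgue_measure]_(t in `[-1, r]) g `|t|)%R r (g r).
  by split; [exact: d1|rewrite -derive1E -e; exact: d2].
by apply: isd_eq (isdB h (isd_cst r _)) _; rewrite subr0.
Qed.

Lemma prim_rlim g : cont0 g -> prim g r @[r --> 0^'+] --> (0 : R).
Proof.
move=> hg; rewrite -{2}(prim0 g); apply: cont_rlim.
exact: isd_cont (prim_isd hg (lexx 0)).
Qed.

Lemma prim_cont0 g : cont0 g -> cont0 (prim g).
Proof.
move=> hg; apply: (@cont0_isd _ g); first by rewrite prim0; exact: prim_rlim.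
by move=> r /ltW r0; exact: prim_isd.
Qed.

Variable n : nat.
Hypothesis n1 : (1 <= n)%N.

Let n0 : n%:R != 0 :> R.
Proof. by rewrite pnatr_eq0 -lt0n. Qed.

(** [n] times this is the mean of [g] over the ball of radius [r] in dimension
    [n]. *)
Definition avg g r : R :=
  if r == 0 then g 0 / n%:R else prim (fun t => t ^+ n.-1 * g t) r / r ^+ n.

Lemma avg_isd g r : cont0 g -> 0 < r ->
  isd (avg g) r ((g r - n%:R * avg g r) / r).
Proof.
move=> hg r0.
have hc : cont0 (fun t => t ^+ n.-1 * g t).
  by apply: cont0M => //; apply: cont0X; exact: cont0_id.
have rn : r ^+ n != 0 by rewrite expf_neq0 // gt_eqF.
have rr : 0 < r < r + 1 by lra.
apply: (@isd_local _ (fun s => prim (fun t => t ^+ n.-1 * g t) s / s ^+ n) _ 0 (r + 1)) => //.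
  by move=> s /andP[s0 _]; rewrite /avg gt_eqF.
have hV := @isdV _ (fun s => s ^+ n) r _ rn (isd_pow r n).
have hP := prim_isd hc (ltW r0).
apply: isd_eq (isdM hP hV) _ => /=.
rewrite /avg gt_eqF //; set P := prim _ r; move: rn.
case: n n1 => // k _ /=; rewrite exprS => rn; field.
by rewrite gt_eqF // expf_neq0 // gt_eqF.
Qed.

Lemma avg_rlim g : cont0 g -> avg g r @[r --> 0^'+] --> avg g 0.
Proof.
move=> hg; apply/rlimP => e e0.
have [d d0 hd] := (rlimP _ _ _).1 (cont0_rlim hg) (e / 2) ltac:(lra).
exists d => // r; rewrite add0r => /andP[r0 rd].
have hc : cont0 (fun t => t ^+ n.-1 * g t).
  by apply: cont0M => //; apply: cont0X; exact: cont0_id.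
(* used with [s = 1] and [s = -1], for the lower and the upper bound *)
have H (s c : R) : (forall t, 0 < t < d -> 0 <= s * g t - c) ->
    c / n%:R * r ^+ n <= s * prim (fun t => t ^+ n.-1 * g t) r.
  move=> hs; rewrite -subr_ge0.
  pose F t := s * prim (fun t => t ^+ n.-1 * g t) t - c / n%:R * t ^+ n.
  apply: (@incr_from _ F (fun t => t ^+ n.-1 * (s * g t - c)) 0 d 0) => [t td||]; last by rewrite r0 rd.
    split; last by rewrite mulr_ge0 ?hs // exprn_ge0; lra.
    apply: isd_eq (isdB (isdZ s (prim_isd hc _)) (isdZ (c / n%:R) (isd_pow t n))) _.
      by lra.
    by field.
  have z : s * 0 - c / n%:R * 0 ^+ n = 0 :> R.
    by rewrite expr0n gtn_eqF // !mulr0 subrr.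
  have : F r @[r --> 0^'+] --> s * 0 - c / n%:R * 0 ^+ n.
    apply: rlimB; first exact: (rlimM (cvg_cst s) (prim_rlim hc)).
    by apply: cont_rlim; exact: isd_cont (isdZ _ (isd_pow 0 n)).
  by rewrite z.
have rn : 0 < r ^+ n by rewrite exprn_gt0.
have nr1 : 1 <= n%:R :> R by rewrite ler1n.
have en : e / 2 / n%:R <= e / 2 by rewrite ler_pdivrMr ?ltr0n // ler_peMr; lra.
have := H 1 (g 0 - e / 2); have := H (-1) (- g 0 - e / 2).
rewrite {1 2}/avg eqxx gt_eqF //; set P := prim _ r.
have hd' t : 0 < t < d -> - (e / 2) < g t - g 0 < e / 2.
  by move=> td; have := hd t; rewrite add0r ltr_norml; exact.
move=> h1 h2.
have {}h1 : (- g 0 - e / 2) / n%:R * r ^+ n <= -1 * P.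
  by apply: h1 => t td; have := hd' t td; lra.
have {}h2 : (g 0 - e / 2) / n%:R * r ^+ n <= 1 * P.
  by apply: h2 => t td; have := hd' t td; lra.
apply: le_lt_trans (_ : e / 2 / n%:R < e); last by lra.
rewrite ler_norml; apply/andP; split.
  have : (g 0 - e / 2) / n%:R <= P / r ^+ n by rewrite ler_pdivlMr // -(mul1r P).
  by lra.
have : P / r ^+ n <= (g 0 + e / 2) / n%:R by rewrite ler_pdivrMr //; lra.
by lra.
Qed.

Lemma avg_cont0 g : cont0 g -> cont0 (avg g).
Proof.
move=> hg; apply: (@cont0_isd _ (fun r => (g r - n%:R * avg g r) / r)).
  exact: avg_rlim.
by move=> r; exact: avg_isd.
Qed.

(** As [r * avg g r = r^(1-n) * int_0^r t^(n-1) g t dt], this is the usual formula for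
    the radial solution of [Delta f = g], [f 0 = a]. *)
Definition lapinv a g r : R := a + prim (fun t => t * avg g t) r.

Lemma tavg_cont0 g : cont0 g -> cont0 (fun t => t * avg g t).
Proof. by move=> hg; apply: cont0M; [exact: cont0_id|exact: avg_cont0]. Qed.

Lemma lapinv0 a g : lapinv a g 0 = a.
Proof. by rewrite /lapinv prim0 addr0. Qed.

Lemma lapinv_cont0 a g : cont0 g -> cont0 (lapinv a g).
Proof.
by move=> hg; apply: cont0D; [exact: cont0_cst|apply/prim_cont0/tavg_cont0].
Qed.

Lemma lapinv_lap a g b : cont0 g ->
  lap n 0 b (lapinv a g) (fun r => r * avg g r) g.
Proof.
move=> hg r /andP[r0 rb]; split.
  apply: isd_eq (isdD (isd_cst r a) (prim_isd (tavg_cont0 hg) (ltW r0))) _.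
  by rewrite add0r.
apply: isd_eq (isdM (isd_id r) (avg_isd hg r0)) _.
by field; rewrite gt_eqF.
Qed.


Fixpoint chaininv (m : nat) (al : nat -> R) (g : R -> R) (k : nat) : R -> R :=
  if m is j.+1 then
    (if k is i.+1 then chaininv j (fun i => al i.+1) g i
     else lapinv (al 0%N) (chaininv j (fun i => al i.+1) g 0))
  else g.

Lemma chaininv_top m al g : chaininv m al g m = g.
Proof. by elim: m al => //= m IH al; rewrite IH. Qed.

Lemma chaininv_cont0 m al g k : cont0 g -> cont0 (chaininv m al g k).
Proof.
move=> hg; elim: m al k => //= m IH al [|k]; last exact: IH.
exact/lapinv_cont0/IH.
Qed.

Lemma chaininvE m al g k : (k < m)%N ->
  chaininv m al g k = lapinv (al k) (chaininv m al g k.+1).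
Proof.
elim: m al k => //= m IH al [|k] km; last exact: IH.
by case: m IH km.
Qed.

Lemma chaininv_chain m al g b : cont0 g ->
  chain n m b (chaininv m al g)
    (fun k r => r * avg (chaininv m al g k.+1) r) al.
Proof.
move=> hg k km; rewrite (chaininvE _ _ km).
have hc : cont0 (chaininv m al g k.+1) by exact: chaininv_cont0.
split; first exact: lapinv_lap.
  by have := cont0_rlim (@lapinv_cont0 (al k) _ hc); rewrite lapinv0.
by have := cont0_rlim (tavg_cont0 hc); rewrite mul0r.
Qed.

Lemma le_geom (x y z : R) : (forall j, x <= y + z / 2 ^+ j) -> x <= y.
Proof.
move=> h; rewrite leNgt; apply/negP => yx.
have z0 : 0 < z by have := h 0%N; rewrite expr0 divr1; lra.
have := @contract_bound R (fun N => exists j, z / 2 ^+ j <= N) 0 z (lexx _) (ltW z0).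
move=> /(_ _ _ _ ((x - y) / 2))H.
have [||| |j hj] := H; last by have := h j; lra.
- by exists 0%N; rewrite expr0 divr1.
- by move=> a b ab [j hj]; exists j; apply: le_trans ab.
- move=> N N0 [j hj]; exists j.+1; rewrite exprS invfM; lra.
- by rewrite divr_gt0 // subr_gt0.
Qed.

(** The limit is one and the same for all admissible [C], so that one pointwise limit
    carries the uniform estimates on every bounded interval. *)
Lemma geom_limit (x : nat -> R) :
  (exists C, forall j, `|x j.+1 - x j| <= C / 2 ^+ j) ->
  exists l, forall C, (forall j, `|x j.+1 - x j| <= C / 2 ^+ j) ->
    forall j, `|x j - l| <= 2 * C / 2 ^+ j.
Proof.
have half (C : R) j : C / 2 ^+ j = 2 * (C / 2 ^+ j.+1).
  by rewrite exprS invfM; field; rewrite expf_neq0.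
have mono C : (forall j, `|x j.+1 - x j| <= C / 2 ^+ j) ->
    (forall i j, (i <= j)%N -> x i - 2 * C / 2 ^+ i <= x j - 2 * C / 2 ^+ j) /\
    (forall i j, (i <= j)%N -> x j + 2 * C / 2 ^+ j <= x i + 2 * C / 2 ^+ i).
  move=> h; split=> i j.
    elim: j => [|j IH]; first by rewrite leqn0 => /eqP->.
    rewrite leq_eqVlt => /predU1P[->//|/IH]; move/le_trans; apply.
    have := h j; rewrite ler_norml -!mulrA (half _ j); lra.
  elim: j => [|j IH]; first by rewrite leqn0 => /eqP->.
  rewrite leq_eqVlt => /predU1P[->//|/IH]; apply: le_trans.
  have := h j; rewrite ler_norml -!mulrA (half _ j); lra.
case=> C hC; have [m1 m2] := mono C hC.
have C0 j : 0 <= C / 2 ^+ j by apply: le_trans (hC j).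
have cross i j : x i - 2 * C / 2 ^+ i <= x j + 2 * C / 2 ^+ j.
  have := m1 i (maxn i j) (leq_maxl _ _); have := m2 j (maxn i j) (leq_maxr _ _).
  by have := C0 (maxn i j); rewrite -!mulrA; lra.
pose S := [set y | exists i, y = x i - 2 * C / 2 ^+ i].
have hl1 i : x i - 2 * C / 2 ^+ i <= sup S.
  apply: ub_le_sup; last by exists i.
  by exists (x 0%N + 2 * C / 2 ^+ 0) => _ [j ->].
have hl2 j : sup S <= x j + 2 * C / 2 ^+ j.
  by apply: ge_sup; [exists (x 0%N - 2 * C / 2 ^+ 0), 0%N|move=> _ [i ->]].
exists (sup S) => C' hC' j; have [n1' n2'] := mono C' hC'.
have C0' i : 0 <= C' / 2 ^+ i by apply: le_trans (hC' i).
rewrite ler_norml; apply/andP; split.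
  suff : sup S <= x j + 2 * C' / 2 ^+ j by lra.
  apply: (@le_geom _ _ (2 * C + 2 * C + 2 * C')) => i.
  have := n2' j (j + i)%N (leq_addr _ _); have := hl2 (j + i)%N.
  have h1 := C0' (j + i)%N; have h2 := C0 (j + i)%N.
  have p : 2 * C / 2 ^+ (j + i) <= 2 * C / 2 ^+ i.
    rewrite ler_wpM2l //.
      by have := C0 0%N; rewrite expr0 divr1; lra.
    by rewrite lef_pV2 ?posrE ?exprn_gt0 // ler_eXn2l ?leq_addl // ltr1n.
  have q : 0 <= 2 * C' / 2 ^+ i by rewrite -mulrA mulr_ge0.
  have q' : 0 <= 2 * C / 2 ^+ i by rewrite -mulrA mulr_ge0.
  by rewrite !mulrDl; move: p; rewrite -!mulrA in h1 h2 q q' *; lra.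
suff : x j - 2 * C' / 2 ^+ j <= sup S by lra.
apply: (@le_geom _ _ (2 * C + 2 * C + 2 * C')) => i.
have := n1' j (j + i)%N (leq_addr _ _); have := hl1 (j + i)%N.
have h1 := C0' (j + i)%N; have h2 := C0 (j + i)%N.
have p : 2 * C / 2 ^+ (j + i) <= 2 * C / 2 ^+ i.
  rewrite ler_wpM2l //.
    by have := C0 0%N; rewrite expr0 divr1; lra.
  by rewrite lef_pV2 ?posrE ?exprn_gt0 // ler_eXn2l ?leq_addl // ltr1n.
have q : 0 <= 2 * C' / 2 ^+ i by rewrite -mulrA mulr_ge0.
have q' : 0 <= 2 * C / 2 ^+ i by rewrite -mulrA mulr_ge0.
by rewrite !mulrDl; move: p; rewrite -!mulrA in h1 h2 q q' *; lra.
Qed.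

(** Picard iteration: by [weight_step] one step halves the distance of two iterates on
    each [(0, b)] in the weight [gauss (1 + K)], with [K] the Lipschitz constant on
    [(0, b)], so no smallness of [b] is needed. *)
Lemma chain_exists m (al : nat -> R) (G : R -> R -> R) : (0 < m)%N ->
  (forall u, cont0 u -> cont0 (fun r => G r (u r))) ->
  (forall b, exists2 K : R, 0 <= K &
     forall r x y, 0 < r < b -> `|G r x - G r y| <= K * `|x - y|) ->
  exists w : nat -> R -> R, let q := fun k r => r * avg (w k.+1) r in
    [/\ forall b, chain n m b w q al, forall k, cont0 (w k),
        w 0%N 0 = al 0%N & forall r, 0 <= r -> w m r = G r (w 0%N r)].
Proof.
move=> m0 hG hK.
pose W u := chaininv m al (fun r => G r (u r)).
pose v j := iter j (fun u => W u 0%N) (fun=> al 0%N).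
have Wc u k : cont0 u -> cont0 (W u k) by move=> cu; apply/chaininv_cont0/hG.
have vc j : cont0 (v j) by elim: j => [|j IH]; [exact: cont0_cst|exact: Wc].
have W0 u : W u 0%N 0 = al 0%N by rewrite /W chaininvE // lapinv0.
have step b : exists2 lam : R, 0 <= lam & forall (u u' : R -> R) (N : R), cont0 u -> cont0 u' -> 0 <= N ->
    (forall r, 0 < r < b -> `|u r - u' r| <= N * gauss lam r) ->
    forall r, 0 < r < b -> `|W u 0%N r - W u' 0%N r| <= N / 2 * gauss lam r.
  have [K K0 hKb] := hK b; exists (1 + K); first by lra.
  move=> u u' N cu cu' N0 huu r rb.
  have C1 := @chaininv_chain m al _ b (hG u cu).
  have C2 := @chaininv_chain m al _ b (hG u' cu').
  apply: (@weight_step R n n1 m b _ _ _ (1 + K) (N / 2) _ _ (chainB C1 C2)) => //.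
  - by lra.
  - by lra.
  - by move=> k km; rewrite subrr normr0; lra.
  move=> s sb; rewrite !chaininv_top; apply: le_trans (hKb _ _ _ sb) _.
  have g0 := gauss_gt0 (1 + K) s.
  apply: le_trans (ler_wpM2l K0 (huu s sb)) _.
  have : 0 <= N * gauss (1 + K) s by rewrite mulr_ge0 // ltW.
  by nra.
(* successive iterates differ by a geometric sequence *)
have geo b : 0 < b -> exists lam C : R, [/\ 0 <= lam, 0 <= C &
    forall j r, 0 < r < b -> `|v j.+1 r - v j r| <= C / 2 ^+ j * gauss lam r].
  move=> b0; have [lam lam0 hlam] := step b.
  have [N N0 hN] := @cont0_bounded _ b (cont0D (vc 1%N) (cont0M (@cont0_cst (-1)) (vc 0%N))).
  exists lam, N; split => //; elim => [|j IH] r rb.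
    have := hN r; rewrite expr0 divr1 mulN1r => /(_ _)h; apply: le_trans (h _) _.
      by rewrite !ltW //; case/andP: rb.
    rewrite ler_peMr // -expR0 ler_expR mulr_ge0 // sqr_ge0 //.
  have := hlam _ _ _ (vc j.+1) (vc j) _ IH r rb.
  rewrite divr_ge0 ?exprn_ge0 // => /(_ isT).
  by rewrite exprS invfM (mulrC 2^-1) mulrA.
have gle lam b r : 0 <= lam -> 0 <= r < b -> gauss lam r <= gauss lam b.
  move=> lam0 rb; rewrite ler_expR ler_wpM2l // lerXn2r ?nnegrE; lra.
have lim r : exists l, 0 <= r -> forall C, (forall j, `|v j.+1 r - v j r| <= C / 2 ^+ j) ->
    forall j, `|v j r - l| <= 2 * C / 2 ^+ j.
  have [r0|r0] := ltP 0 r; last first.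
    exists (al 0%N) => r1 C hC j; have -> : r = 0 by lra.
    have -> : v j 0 = al 0%N by case: j => //= j; exact: W0.
    rewrite subrr normr0 -mulrA mulr_ge0 //; exact: le_trans (hC j).
  have [|l hl] := @geom_limit (v ^~ r); last by exists l.
  have [|lam [C [lam0 C0 hC]]] := geo (r + 1); first lra.
  exists (C * gauss lam r) => j; rewrite mulrAC; apply: hC; lra.
have /choice[u hu] := lim.
have unif b : 0 < b -> exists2 C : R, 0 <= C & forall j r, 0 <= r < b ->
    `|v j r - u r| <= C / 2 ^+ j.
  move=> b0; have [lam [C [lam0 C0 hC]]] := geo b b0.
  have g0 := gauss_gt0 lam b.
  exists (2 * (C * gauss lam b)); first by rewrite !mulr_ge0 // ltW.
  move=> j r rb; apply: hu => [|i]; first by case/andP: rb.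
  have [r0|r0] := ltP 0 r; last first.
    have -> : r = 0 by lra.
    have -> : v i 0 = al 0%N by case: i => //= i; exact: W0.
    by rewrite /v /= W0 subrr normr0 !mulr_ge0 ?invr_ge0 ?exprn_ge0 // ltW.
  apply: le_trans (hC i r _) _; first lra.
  by rewrite mulrAC ler_wpM2r ?invr_ge0 ?exprn_ge0 // ler_wpM2l // gle.
have uc : cont0 u.
  move=> x; apply/cvgrPdist_lt => e e0.
  have [|C C0 hC] := unif (`|x| + 1); first by have := normr_ge0 x; lra.
  have [j hj] : exists j : nat, C / 2 ^+ j < e / 3.
    apply: contrapT => /forallNP h.
    suff : e / 3 <= 0 by lra.
    by apply: (@le_geom _ _ C) => j; have /negP := h j; rewrite -leNgt add0r.
  have /cvgrPdist_lt /(_ (e / 3)) := vc j x; move=> /(_ ltac:(lra)) near1.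
  near=> y.
  have h1 : `|v j `|x| - v j `|y| | < e / 3 by near: y.
  have h2 : `|x - y| < 1.
    by near: y; exact: (@cvgr_dist_lt _ _ _ _ _ id x).
  have yx : `|y| < `|x| + 1.
    have := ler_normB x (x - y); rewrite opprB addrCA subrr addr0; lra.
  have hx : `|v j `|x| - u `|x| | <= C / 2 ^+ j.
    by apply: hC; rewrite normr_ge0 /=; have := normr_ge0 x; lra.
  have hy : `|v j `|y| - u `|y| | <= C / 2 ^+ j.
    by apply: hC; rewrite normr_ge0 /=; have := normr_ge0 x; lra.
  move: h1 hx hy; rewrite ltr_norml !ler_norml ltr_norml; lra.
have fixu r : 0 <= r -> W u 0%N r = u r.
  rewrite le_eqVlt => /predU1P[<-|r0].
    have [C C0 hC] := unif 1 ltr01.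
    rewrite W0; apply/eqP; rewrite -subr_eq0 -normr_le0.
    apply: (@le_geom _ _ C) => j; rewrite add0r.
    have := hC j.+1 0; rewrite lexx ltr01 /= W0 => /(_ isT)/le_trans; apply.
    by rewrite ler_wpM2l // lef_pV2 ?posrE ?exprn_gt0 // ler_eXn2l // ltr1n.
  have rb : 0 < r < r + 1 by lra.
  have [lam lam0 hlam] := step (r + 1).
  have [|C C0 hC] := unif (r + 1); first lra.
  have g1 s : 1 <= gauss lam s.
    by rewrite -expR0 ler_expR mulr_ge0 // sqr_ge0.
  apply/eqP; rewrite -subr_eq0 -normr_le0.
  apply: (@le_geom _ _ (2 * C * gauss lam r)) => j; rewrite add0r.
  have -> : W u 0%N r - u r = (v j.+1 r - u r) - (v j.+1 r - W u 0%N r) by ring.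
  have H1 : `|v j.+1 r - u r| <= C / 2 ^+ j.
    apply: le_trans (hC j.+1 r _) _; first lra.
    by rewrite ler_wpM2l // lef_pV2 ?posrE ?exprn_gt0 // ler_eXn2l // ltr1n.
  have H2 : `|v j.+1 r - W u 0%N r| <= C / 2 ^+ j / 2 * gauss lam r.
    apply: (hlam _ _ _ (vc j) uc _ _ r rb); first by rewrite divr_ge0 // exprn_ge0.
    move=> s sb; apply: le_trans (hC j s _) _; first lra.
    by rewrite ler_peMr // divr_ge0 // exprn_ge0.
  apply: le_trans (ler_normB _ _) _.
  have p : 0 <= C / 2 ^+ j by rewrite divr_ge0 // exprn_ge0.
  have g := g1 r; rewrite -!mulrA (mulrC (gauss _ _)) mulrA -mulrA; nra.
exists (W u) => q; split.
- by move=> b; exact: chaininv_chain (hG u uc).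
- by move=> k; exact: Wc.
- exact: W0.
- by move=> r r0; rewrite fixu // /W chaininv_top.
Unshelve. all: by end_near. Qed.

End Inverse.


(** * Regularity at the origin *)

Section Tower.
Variable R : realType.
Implicit Types (f g : R -> R) (a b r : R).

Lemma zero_from f (f' : R -> R) : (forall r, 0 < r -> isd f r (f' r) /\ f' r = 0) ->
  f r @[r --> 0^'+] --> (0 : R) -> forall r, 0 < r -> f r = 0.
Proof.
move=> h h0 r r0; have rr : 0 < r < r + 1 by lra.
apply/eqP; rewrite eq_le -oppr_ge0; apply/andP; split.
  apply: (@incr_from _ (fun s => - f s) (fun s => - f' s) 0 (r + 1)) rr.
    by move=> x /andP[x0 _]; have [h1 h2] := h x x0; split; [exact: isdN|rewrite h2 oppr0].
  by have := rlimN h0; rewrite oppr0.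
apply: (@incr_from _ f f' 0 (r + 1)) rr => // x /andP[x0 _].
by have [h1 h2] := h x x0; split => //; rewrite h2.
Qed.

(** [k] applications of [D = (1 / r) d/dr] remain continuous up to the origin:
    in the variable [r ^ 2] this is smoothness of order [k]. *)
Fixpoint tower (k : nat) f : Prop :=
  cont0 f /\ if k is j.+1 then
    exists2 g : R -> R, (forall r, 0 < r -> isd f r (r * g r)) & tower j g
  else True.

Lemma tower_cont0 k f : tower k f -> cont0 f.
Proof. by case: k => [|k] []. Qed.

Lemma towerW k f : tower k.+1 f -> tower k f.
Proof.
elim: k f => [|k IH] f [cf [g hg tg]] //.
by split=> //; exists g => //; exact: IH.
Qed.

Lemma tower_eq k f g : cont0 g -> (forall r, 0 < r -> f r = g r) ->
  tower k f -> tower k g.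
Proof.
move=> cg e; case: k => [|k] //= [cf [f' hf tf]]; split => //; exists f' => // r r0.
apply: (@isd_local _ f _ 0 (r + 1)); [lra| |exact: hf].
by move=> y /andP[y0 _]; exact: e.
Qed.

Lemma towerD k f g : tower k f -> tower k g -> tower k (fun r => f r + g r).
Proof.
elim: k f g => [|k IH] f g [cf hf] [cg hg]; split=> //; try exact: cont0D.
case: hf => f' hf tf; case: hg => g' hg tg.
exists (fun r => f' r + g' r); last exact: IH.
by move=> r r0; rewrite mulrDr; apply: isdD; [exact: hf|exact: hg].
Qed.

Lemma tower_cst k (c : R) : tower k (fun=> c).
Proof.
elim: k c => [|k IH] c; split=> //; try exact: cont0_cst.
by exists (fun=> 0) => // r _; rewrite mulr0; exact: isd_cst.
Qed.

Lemma towerM k f g : tower k f -> tower k g -> tower k (fun r => f r * g r).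
Proof.
elim: k f g => [|k IH] f g tf tg.
  by split=> //; exact: cont0M (tower_cont0 tf) (tower_cont0 tg).
have tf1 := towerW tf; have tg1 := towerW tg.
split; first exact: cont0M (tower_cont0 tf) (tower_cont0 tg).
case: tf => _ [f' hf tf]; case: tg => _ [g' hg tg].
exists (fun r => f' r * g r + f r * g' r).
  by move=> r r0; apply: isd_eq (isdM (hf r r0) (hg r r0)) _; ring.
by apply: towerD; apply: IH.
Qed.

Lemma tower_exp k f : tower k f -> tower k (fun r => expR (f r)).
Proof.
elim: k f => [|k IH] f tf; split=> //;
  try exact: cont0_comp (@continuous_expR R) (tower_cont0 tf).
have tf1 := towerW tf; case: tf => _ [f' hf tf].
exists (fun r => expR (f r) * f' r).
  by move=> r r0; apply: isd_eq (isd_exp (hf r r0)) _; ring.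
by apply: towerM => //; exact: IH.
Qed.

(** Averaging in dimension [n] intertwines with [D] into averaging in dimension
    [n + 2]. *)
Lemma tower_avg k n g : (1 <= n)%N -> tower k g -> tower k (avg n g).
Proof.
elim: k n g => [|k IH] n g n1 tg.
  by split => //; exact: avg_cont0 (tower_cont0 tg).
split; first exact: avg_cont0 (tower_cont0 tg).
case: tg => cg [g1 hg1 tg1]; exists (avg n.+2 g1); last exact: IH.
have c1 := tower_cont0 tg1.
have cg' : cont0 (fun t => t ^+ n.-1 * g t).
  by apply: cont0M => //; apply: cont0X; exact: cont0_id.
have cg1' : cont0 (fun t => t ^+ n.+2.-1 * g1 t).
  by apply: cont0M => //; apply: cont0X; exact: cont0_id.
pose P := prim (fun t => t ^+ n.-1 * g t).
pose P1 := prim (fun t => t ^+ n.+2.-1 * g1 t).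
have E r : 0 < r -> P1 r - (r ^+ n * g r - n%:R * P r) = 0.
  apply: (@zero_from (fun r => P1 r - (r ^+ n * g r - n%:R * P r))
    (fun r => r ^+ n.+2.-1 * g1 r - ((n%:R * r ^+ n.-1 * g r + r ^+ n * (r * g1 r)) - n%:R * (r ^+ n.-1 * g r)))).
    move=> s s0; split; last by rewrite /= exprS; ring.
    apply: isdB; first exact: prim_isd (ltW s0).
    apply: isdB; first by apply: isdM; [exact: isd_pow|exact: hg1].
    by apply: isdZ; exact: prim_isd (ltW s0).
  have z : 0 - (0 ^+ n * g 0 - n%:R * 0) = 0 :> R.
    by rewrite expr0n gtn_eqF // mul0r mulr0 !subr0.
  have : (P1 r - (r ^+ n * g r - n%:R * P r)) @[r --> 0^'+] -->
      0 - (0 ^+ n * g 0 - n%:R * 0).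
    apply: rlimB; first exact: prim_rlim.
    apply: rlimB; last exact: (rlimM (cvg_cst (n%:R : R)) (prim_rlim cg')).
    apply: rlimM; last exact: cont0_rlim.
    by apply: cont_rlim; exact: isd_cont (isd_pow 0 n).
  by rewrite z.
move=> r r0; apply: isd_eq (avg_isd n1 cg r0) _.
have rn : r != 0 by rewrite gt_eqF.
have := E r r0; rewrite /avg gt_eqF // -/P -/P1 => /eqP; rewrite subr_eq0 => /eqP ->.
by rewrite !exprS; field; rewrite rn expf_neq0.
Qed.

(** Each inversion of the Laplacian gains one order in the tower, so the
    exponential nonlinearity bootstraps. *)
Lemma chain_tower n m (c : R) (w : nat -> R -> R) : (1 <= n)%N -> (0 < m)%N ->
  (forall k, cont0 (w k)) ->
  (forall k r, (k < m)%N -> 0 < r -> isd (w k) r (r * avg n (w k.+1) r)) ->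
  (forall r, 0 <= r -> w m r = c * expR (w 0%N r)) ->
  forall k, tower k (w 0%N).
Proof.
move=> n1 m0 cw hw hm; elim=> [|k IH]; first by split.
have tm : tower k (w m).
  apply: (@tower_eq _ (fun r => c * expR (w 0%N r))) => //.
    by move=> r /ltW /hm ->.
  by apply: towerM; [exact: tower_cst|exact: tower_exp].
have step i j : (i < m)%N -> tower j (w i.+1) -> tower j.+1 (w i).
  move=> im t; split => //; exists (avg n (w i.+1)); last exact: tower_avg.
  by move=> r r0; exact: hw.
have H : forall i, (i <= m)%N -> tower k (w i).
  by apply: down_ind => // i im t; apply: towerW; exact: step.
by apply: step => //; exact: H.
Qed.

Lemma class_C_intro (V : normedModType R) k (F : V -> R) : continuous F ->
  (forall v, exists2 G : V -> R, (forall x, is_derive x v F (G x)) & class_C k setT G) ->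
  class_C k.+1 setT F.
Proof.
move=> cF h; split=> [x _|v]; first exact: cF.
have [G hG cG] := h v.
split=> [x _|]; first by case: (hG x).
by rewrite (_ : 'D_v F = G) //; apply/funext => x; case: (hG x).
Qed.

Lemma class_CW (V : normedModType R) k (F : V -> R) :
  class_C k.+1 setT F -> class_C k setT F.
Proof.
elim: k F => [|k IH] F [cF h]; first by split.
by split => // v; have [h1 h2] := h v; split => //; exact: IH.
Qed.

Lemma class_C_cont (V : normedModType R) k (F : V -> R) :
  class_C k setT F -> continuous F.
Proof. by case: k => [|k] [h _] x; exact: h. Qed.

Lemma class_CD (V : normedModType R) k (F G : V -> R) :
  class_C k setT F -> class_C k setT G -> class_C k setT (fun x => F x + G x).
Proof.
elim: k F G => [|k IH] F G hF hG.
  by split => // x _; exact: cvgD (class_C_cont hF (x:=x)) (class_C_cont hG (x:=x)).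
apply: class_C_intro.
  by move=> x; exact: cvgD (class_C_cont hF (x:=x)) (class_C_cont hG (x:=x)).
move=> v; have [dF cF] := hF.2 v; have [dG cG] := hG.2 v.
exists (fun x => 'D_v F x + 'D_v G x); last exact: IH.
by move=> x; apply: is_deriveD; apply: derivableP; [exact: dF|exact: dG].
Qed.

Lemma class_CM (V : normedModType R) k (F G : V -> R) :
  class_C k setT F -> class_C k setT G -> class_C k setT (fun x => F x * G x).
Proof.
elim: k F G => [|k IH] F G hF hG.
  by split => // x _; exact: cvgM (class_C_cont hF (x:=x)) (class_C_cont hG (x:=x)).
apply: class_C_intro.
  by move=> x; exact: cvgM (class_C_cont hF (x:=x)) (class_C_cont hG (x:=x)).
move=> v; have [dF cF] := hF.2 v; have [dG cG] := hG.2 v.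
exists (fun x => F x * 'D_v G x + G x * 'D_v F x).
  by move=> x; apply: is_deriveM; apply: derivableP; [exact: dF|exact: dG].
by apply: class_CD; apply: IH => //; exact: class_CW.
Qed.

Lemma class_C_cst (V : normedModType R) k (c : R) :
  class_C k setT (fun _ : V => c).
Proof.
elim: k c => [|k IH] c; first by split => // x _; exact: cvg_cst.
apply: class_C_intro; first by move=> x; exact: cvg_cst.
by move=> v; exists (fun=> 0) => // x; exact: is_derive_cst.
Qed.

Lemma is_derive_line (V : normedModType R) (F : V -> R) (x v : V) (d : R) :
  is_derive (0 : R) (1 : R) (fun h : R => F (h *: v + x)) d -> is_derive x v F d.
Proof.
have E : (fun h : R => h^-1 *: (((fun s => F (s *: v + x)) \o shift 0) (h *: 1) - F (0 *: v + x)))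
    = (fun h : R => h^-1 *: ((F \o shift x) (h *: v) - F x)).
  apply/funext => h /=; congr (_ *: (F _ - F _)).
    by rewrite /GRing.scale /= mulr1 addr0.
  by rewrite scale0r add0r.
by case; rewrite /derivable /derive E => h1 h2; split.
Qed.

End Tower.

Section Enorm.
Variable R : realType.
Variable n : nat.
Implicit Types (x v : 'rV[R]_n) (f g : R -> R).

Definition dot x v : R := \sum_(i < n) x 0 i * v 0 i.

Lemma enorm_ge0 x : 0 <= enorm x.
Proof. exact: sqrtr_ge0. Qed.

Lemma enorm_sqr x : enorm x ^+ 2 = dot x x.
Proof.
by rewrite /enorm sqr_sqrtr //; apply: sumr_ge0 => i _; exact: sqr_ge0.
Qed.

Lemma enormE x : enorm x = Num.sqrt (dot x x).
Proof. by []. Qed.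

Lemma dot_line x v h : dot (h *: v + x) (h *: v + x) =
  dot x x + h * (2 * dot x v) + h ^+ 2 * dot v v.
Proof.
rewrite /dot !mulr_sumr -!big_split /=; apply: eq_bigr => i _.
by rewrite !mxE; ring.
Qed.

Lemma enorm0 : enorm (0 : 'rV[R]_n) = 0.
Proof.
by rewrite /enorm big1 ?sqrtr0 // => i _; rewrite mxE expr0n.
Qed.

Lemma enorm_eq0 x : enorm x = 0 -> x = 0.
Proof.
move=> e; have := enorm_sqr x; rewrite e expr0n /= => /esym /eqP.
rewrite /dot psumr_eq0 => [/allP h|i _]; last by rewrite -expr2 sqr_ge0.
apply/rowP => i; rewrite mxE; apply/eqP.
by have := h i (mem_index_enum _); rewrite -expr2 sqrf_eq0.
Qed.

Lemma enormZ h v : enorm (h *: v) = `|h| * enorm v.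
Proof.
rewrite !enormE (_ : dot (h *: v) (h *: v) = h ^+ 2 * dot v v).
  by rewrite sqrtrM ?sqr_ge0 // sqrtr_sqr.
by rewrite /dot mulr_sumr; apply: eq_bigr => i _; rewrite !mxE; ring.
Qed.

Lemma continuous_sum (V : normedModType R) (I : Type) (s : seq I)
    (F : I -> V -> R) : (forall i, continuous (F i)) ->
  continuous (fun y => \sum_(i <- s) F i y).
Proof.
move=> hF; elim: s => [|i s IH] y.
  by under eq_fun do rewrite big_nil; exact: cvg_cst.
under eq_fun do rewrite big_cons.
exact: cvgD (hF i y) (IH y).
Qed.

Lemma enorm_continuous : continuous (@enorm R n).
Proof.
move=> x; apply: (cvg_comp (fun x => \sum_(i < n) x 0 i ^+ 2) (@Num.sqrt R)); last first.
  exact: sqrt_continuous.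
move: x; apply: continuous_sum => i x.
apply: (cvg_comp (fun x : 'rV[R]_n => x 0 i) (fun y : R => y ^+ 2)).
  exact: coord_continuous.
exact: exprn_continuous.
Qed.

Lemma class_C_dot k v : class_C k setT (fun x => dot x v).
Proof.
have c : continuous (fun x => dot x v).
  apply: continuous_sum => i x.
  exact: cvgM (@coord_continuous _ _ _ 0 i x) (cvg_cst (v 0 i)).
case: k => [|k]; first by split => // x _; exact: c.
apply: class_C_intro => // w; exists (fun=> dot w v); last exact: class_C_cst.
move=> x; apply: is_derive_line.
have -> : (fun h : R => dot (h *: w + x) v) = (fun h => h * dot w v + dot x v).
  apply/funext => h; rewrite /dot mulr_sumr -big_split /=.
  by apply: eq_bigr => i _; rewrite !mxE; ring.
by apply: isd_eq (isdD (isdM (isd_id _) (isd_cst _ _)) (isd_cst _ _)) _; ring.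
Qed.

(** Away from [x = 0] this is the chain rule. At [x = 0] the norm is not
    differentiable, but [f r - f 0 = O(r^2)] because [f'] is [r] times a bounded
    function. *)
Lemma is_derive_enorm f g x v : cont0 f -> cont0 g ->
  (forall r : R, 0 < r -> isd f r (r * g r)) ->
  is_derive x v (fun y => f (enorm y)) (g (enorm x) * dot x v).
Proof.
move=> cf cg h; apply: is_derive_line.
have [x0|x0] := eqVneq (enorm x) 0; last first.
  have e0 : 0 < enorm x by rewrite lt_def x0 enorm_ge0.
  have d0 : 0 < dot x x by rewrite -enorm_sqr exprn_gt0.
  pose N (h : R) := dot x x + h * (2 * dot x v) + h ^+ 2 * dot v v.
  have -> : (fun h : R => f (enorm (h *: v + x))) = (fun h : R => f (Num.sqrt (N h))).
    by apply/funext => t; rewrite enormE dot_line.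
  have N0 : N 0 = dot x x by rewrite /N expr0n /= !mul0r !addr0.
  have dN : isd N (0 : R) (2 * dot x v).
    apply: isd_eq (isdD (isdD (isd_cst _ _) (isdM (isd_id _) (isd_cst _ _))) (isdM (isd_pow (0 : R) 2) (isd_cst _ _))) _.
    by rewrite /=; ring.
  have dS : isd (fun h : R => Num.sqrt (N h)) (0 : R) ((2 * enorm x)^-1 * (2 * dot x v)).
    by apply: isd_comp dN; rewrite N0; exact: is_derive1_sqrt.
  have df : isd f (Num.sqrt (N 0)) (enorm x * g (enorm x)).
    by rewrite N0 -enormE; exact: h.
  by apply: isd_eq (@isd_comp _ f (fun h : R => Num.sqrt (N h)) _ _ _ df dS) _; field; rewrite gt_eqF.
have -> : x = 0 by exact: enorm_eq0.
rewrite enorm0 (_ : dot 0 v = 0); last first.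
  by rewrite /dot big1 // => i _; rewrite mxE mul0r.
rewrite mulr0.
have -> : (fun t : R => f (enorm (t *: v + 0))) = (fun t : R => f (`|t| * enorm v)).
  by apply/funext => t; rewrite addr0 enormZ.
have [G G0 hG] := cont0_bounded 1 cg.
have quad (r : R) : 0 <= r < 1 -> `|f r - f 0| <= G * r ^+ 2.
  case/andP; rewrite le_eqVlt => /predU1P[<- _|r0 r1].
    by rewrite subrr normr0 expr0n mulr0.
  have H (s : R) : -1 <= s <= 1 -> s * f 0 <= s * f r + G * r ^+ 2.
    move=> s1; have := @incr_from _ (fun t : R => s * f t + G * t ^+ 2)
      (fun t : R => s * (t * g t) + G * (2 * t ^+ 1)) 0 1 (s * f 0 + G * 0 ^+ 2).
    rewrite expr0n mulr0 addr0; apply; last by rewrite r0.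
      move=> t /andP[t0 t1]; split.
        by apply: isdD; apply: isdZ; [exact: h|exact: isd_pow].
      have := hG t; rewrite (ltW t0) (ltW t1) ler_norml expr1 => /(_ isT) gb.
      have -> : s * (t * g t) + G * (2 * t) = t * (s * g t + 2 * G) by ring.
      by apply: mulr_ge0; [exact: ltW|nra].
    have := rlimD (rlimM (@rlim_cst R 0 s) (cont0_rlim cf))
      (rlimM (@rlim_cst R 0 G) (cont_rlim (isd_cont (isd_pow (0 : R) 2)))).
    by rewrite expr0n mulr0 addr0.
  rewrite ler_norml; have := H 1; have := H (-1); lra.
pose c := enorm v; have c0 : 0 <= c := enorm_ge0 v.
have lim : (t^-1 * (f (`|t| * c) - f 0)) @[t --> (0 : R)^'] --> (0 : R).
  apply/cvgrPdist_lt => e e0; rewrite near_withinE; near=> t => t0.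
  rewrite sub0r normrN normrM normfV.
  have tn : 0 < `|t| by rewrite normr_gt0.
  rewrite mulrC ltr_pdivrMr //.
  have td : `|t| < Num.min (1 / (c + 1)) (e / (G * c ^+ 2 + 1)).
    near: t; apply: (@cvgr0_norm_lt _ _ _ _ _ id); first exact: cvg_id.
    by rewrite lt_min !divr_gt0 // ?ltr_wpDl // ?mulr_ge0 // ?exprn_ge0.
  move: td; rewrite lt_min => /andP[t1 t2].
  have [p1 p2] : 0 < c + 1 /\ 0 < G * c ^+ 2 + 1.
    by split; rewrite ltr_wpDl // mulr_ge0 // exprn_ge0.
  rewrite ltr_pdivlMr // in t1; rewrite ltr_pdivlMr // in t2.
  apply: le_lt_trans (quad _ _) _; first by rewrite mulr_ge0 //=; nra.
  have -> : G * (`|t| * c) ^+ 2 = `|t| * (G * c ^+ 2) * `|t| by ring.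
  by rewrite ltr_pM2r //; apply: le_lt_trans t2; rewrite mulrDr mulr1; lra.
have E : (fun t : R => t^-1 *: (((fun t : R => f (`|t| * c)) \o shift 0) (t *: 1) - f (`|0 : R| * c)))
    = (fun t : R => t^-1 * (f (`|t| * c) - f 0)) :> (R -> R).
  apply: funext => t /=.
  by rewrite normr0 mul0r addr0 /GRing.scale /= mulr1.
split; first by rewrite /derivable E; apply/cvg_ex; exists 0; exact: lim.
by rewrite /derive E; exact/cvg_lim.
Unshelve. all: by end_near. Qed.

(** The directional derivative [g (|x|) <x, v>] is again a radial function with a
    tower, times a linear form. *)
Lemma class_C_tower k f : tower k f -> class_C k setT (fun x => f (enorm x)).
Proof.
have cc g : cont0 g -> continuous (fun x => g (enorm x)).
  move=> cg x.
  rewrite (_ : (fun x => g (enorm x)) = (fun x => g `|enorm x|)).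
    apply: (cvg_comp (@enorm R n) (fun r : R => g `|r|)); last exact: cg.
    exact: enorm_continuous.
  by apply/funext => y; rewrite ger0_norm ?enorm_ge0.
elim: k f => [|k IH] f tf; first by split => // x _; exact: cc (tower_cont0 tf) x.
apply: class_C_intro; first exact: cc (tower_cont0 tf).
case: tf => cf [g hg tg] v.
exists (fun x => g (enorm x) * dot x v).
  by move=> x; apply: is_derive_enorm => //; exact: tower_cont0 tg.
by apply: class_CM; [exact: IH|exact: class_C_dot].
Qed.

End Enorm.


(** * Existence, uniqueness and maximality *)

Section Global.
Variable R : realType.
Variable n : nat.
Hypothesis n1 : (1 <= n)%N.
Implicit Types (f g u : R -> R) (a b r : R).

Lemma lap_flat b f q g (c : R) : 0 < b -> lap n 0 b f q g ->
  f r @[r --> 0^'+] --> c -> q r @[r --> 0^'+] --> (0 : R) ->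
  ((f r - c) / r) @[r --> 0^'+] --> (0 : R).
Proof.
move=> b0 h hf /rlimP hq; apply/rlimP => e e0.
have [d d0 hd] := hq (e / 2) ltac:(lra).
have m1 : Num.min d b <= d by rewrite ge_min lexx.
have m2 : Num.min d b <= b by rewrite ge_min lexx orbT.
exists (Num.min d b); first by rewrite lt_min d0.
rewrite add0r => r r0d.
have r0 : 0 < r by case/andP: r0d.
have H s : -1 <= s <= 1 -> s * c + 0 <= s * f r + e / 2 * r.
  move=> s1; apply: (@incr_from _ (fun t => s * f t + e / 2 * t)
    (fun t => s * q t + e / 2 * 1) 0 (Num.min d b) (s * c + 0)) => //.
    move=> t td; split.
      have [|hf' _] := h t; first by lra.
      exact: isdD (isdZ s hf') (isdZ (e / 2) (isd_id t)).
    have := hd t ltac:(lra); rewrite subr0 ltr_norml; nra.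
  apply: rlimD; first exact: (rlimM (@rlim_cst R 0 s) hf).
  have := @cont_rlim _ (fun t => e / 2 * t) 0 (isd_cont (isdZ (e / 2) (isd_id 0))).
  by rewrite mulr0.
rewrite subr0 normrM normfV (gtr0_norm r0) ltr_pdivrMr //.
rewrite ltr_norml; have := H 1; have := H (-1); have : 0 < e * r by rewrite mulr_gt0.
lra.
Qed.

(** The exponential bootstraps the chain to infinitely many orders of the tower, so the
    solution is smooth across the origin. *)
Lemma chain_radial m alpha (beta : 'rV[R]_m.-1) (w : nat -> R -> R) : (0 < m)%N ->
  (forall b, chain n m b w (fun k r => r * avg n (w k.+1) r) (data alpha beta)) ->
  (forall k, cont0 (w k)) -> w 0%N 0 = alpha ->
  (forall r, 0 <= r -> w m r = (-1) ^+ m * expR (w 0%N r)) ->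
  radial_solution n m alpha beta +oo%E (w 0%N).
Proof.
move=> m0 hw cw w0 hm.
have lw b k (km : (k < m)%N) : lap n 0 b (w k) (fun r => r * avg n (w k.+1) r) (w k.+1).
  by have [] := hw b k km.
have flat k : (k < m)%N -> value_flat_at0 (iter k (rlap n) (w 0%N)) (data alpha beta k).
  move=> km; have [h1 h2 h3] := hw 1 k km.
  have e r : 0 < r < 1 -> w k r = iter k (rlap n) (w 0%N) r.
    by move=> rb; rewrite (iter_rlap (lw 1) (ltnW km) rb).
  split; first exact: rlim_eq e h2.
  apply: (@rlim_eq _ (fun r => (w k r - data alpha beta k) / r) _ 0 1) => //.
    by move=> r rb; rewrite e.
  exact: lap_flat h1 h2 h3.
split.
- by [].
- rewrite (_ : eball0 n +oo%E = setT); last first.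
    by apply/seteqP; split => // x _; exact: ltry.
  apply: class_C_tower; apply: (chain_tower n1 m0 cw _ hm) => k r km r0.
  by have [] := lw (r + 1) k km r; first lra.
- move=> r r0 _; have rb : 0 < r < r + 1 by lra.
  rewrite (iter_Nrlap (lw (r + 1)) (leqnn m) rb) hm; last exact: ltW.
  by rewrite mulrA -exprMn mulrNN mulr1 expr1n mul1r.
- by split => //; exact: (flat 0%N).
- move=> k; rewrite -(data_ord alpha beta); apply: flat.
  by have := ltn_ord k; rewrite -ltnS prednK.
Qed.

Lemma expR_lip (M x y : R) : x <= M -> y <= M ->
  `|expR x - expR y| <= expR M * `|x - y|.
Proof.
have H (s t : R) : s <= t -> t <= M -> 0 <= expR t - expR s <= expR M * (t - s).
  move=> st tM; have es : expR s <= expR t by rewrite ler_expR.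
  rewrite subr_ge0 es /=.
  have e1 : expR s = expR t * expR (s - t) by rewrite -expRD addrC subrK.
  have e2 := expR_ge1Dx (s - t); have e3 := expR_gt0 t.
  have e4 : expR t <= expR M by rewrite ler_expR.
  have : expR t - expR s <= expR t * (t - s) by rewrite e1; nra.
  by move/le_trans; apply; rewrite ler_wpM2r // subr_ge0.
move=> xM yM; have [xy|/ltW yx] := leP x y.
  have h := H _ _ xy yM; rewrite distrC (distrC x) !ger0_norm; lra.
by have h := H _ _ yx xM; rewrite !ger0_norm; lra.
Qed.

Lemma expR_lip_min (M x y : R) :
  `|expR (Num.min x M) - expR (Num.min y M)| <= expR M * `|x - y|.
Proof.
apply: le_trans (@expR_lip M _ _ _ _) _; try by rewrite ge_min lexx orbT.
rewrite ler_wpM2l ?expR_ge0 //.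
have h1 := ler_norm (x - y); have h2 := ler_norm (y - x); rewrite distrC in h2.
by rewrite ler_norml !minEle; case: (leP x M) => xM; case: (leP y M) => yM; lra.
Qed.

(** The difference of two solutions is a chain with zero data, and on bounded
    intervals the exponential is Lipschitz. *)
Lemma radial_unique m alpha (beta : 'rV[R]_m.-1) T1 T2 u1 u2 : (0 < m)%N ->
  radial_solution n m alpha beta T1 u1 -> radial_solution n m alpha beta T2 u2 ->
  forall r, 0 <= r -> (r%:E < T1)%E -> (r%:E < T2)%E -> u1 r = u2 r.
Proof.
move=> m0 s1 s2 r; rewrite le_eqVlt => /predU1P[<- _ _|r0 r1 r2].
  by case: s1 => _ _ _ [-> _] _; case: s2 => _ _ _ [-> _] _.
have [b [rb b1 b2]] : exists b : R, [/\ r < b, (b%:E <= T1)%E & (b%:E <= T2)%E].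
  case: T1 T2 r1 r2 {s1 s2} => [t1| |] // [t2| |] //; rewrite ?lte_fin => r1 r2.
  - by exists (Num.min t1 t2); rewrite lt_min r1 r2 !lee_fin !ge_min !lexx orbT.
  - by exists t1; rewrite r1 lexx leey.
  - by exists t2; rewrite r2 lexx leey.
  - by exists (r + 1); rewrite !leey; split => //; lra.
have b0 : 0 < b by lra.
have [c1 t1] := radial_chain n1 s1 b0 b1; have [c2 t2] := radial_chain n1 s2 b0 b2.
apply/eqP; rewrite -subr_eq0; apply/eqP.
apply: (@chain_unique R n n1 m b _ _ _ m0 (chainB c1 c2)) => //.
- by move=> k km; rewrite subrr.
- move=> c cb.
  have bd w q al : chain n m b w q al -> exists2 N : R, 0 <= N &
      forall s, 0 < s <= c -> `|w 0%N s| <= N.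
    move=> h; have [_ h2 _] := h 0%N m0; apply: bounded_rlim h2 _ => s sc.
    by apply: isd_cont (chain_isd h m0 _); lra.
  have [N1 N10 hN1] := bd _ _ _ c1; have [N2 N20 hN2] := bd _ _ _ c2.
  exists (expR (N1 + N2)); first exact: expR_ge0.
  move=> s sc; rewrite t1 ?t2; try lra.
  rewrite -mulrBr normrM normrX normrN1 expr1n mul1r.
  have q1 := le_trans (ler_norm _) (hN1 s ltac:(lra)).
  have q2 := le_trans (ler_norm _) (hN2 s ltac:(lra)).
  by rewrite /= in q1 q2; apply: expR_lip => /=; lra.
- by lra.
Qed.

(** By uniqueness a global solution extends every solution with the same data. *)
Lemma maximal_global m alpha (beta : 'rV[R]_m.-1) T u v : (0 < m)%N ->
  maximal_solution n m alpha beta T u ->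
  radial_solution n m alpha beta +oo%E v -> T = +oo%E.
Proof.
move=> m0 [su mu] sv; apply/eqP; rewrite -leye_eq; apply: (mu _ v sv) => r r0 rT.
have h := radial_unique m0 sv su r0 (ltry _) rT; exact: h.
Qed.

Lemma global_dataP m alpha (beta : 'rV[R]_m.-1) u :
  radial_solution n m alpha beta +oo%E u -> global_data n m alpha beta.
Proof. by move=> s; exists u; split => // T' v _ _; exact: leey. Qed.

Lemma trunc_exists m (al : nat -> R) (s : R) (M : R -> R) : (0 < m)%N -> cont0 M ->
  exists w : nat -> R -> R,
    [/\ forall b, chain n m b w (fun k r => r * avg n (w k.+1) r) al,
        forall k, cont0 (w k), w 0%N 0 = al 0%N
      & forall r, 0 <= r -> w m r = s * expR (Num.min (w 0%N r) (M r))].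
Proof.
move=> m0 cM.
have [||w hw] := @chain_exists R n n1 m al
    (fun r x => s * expR (Num.min x (M r))) m0; last by exists w.
- move=> u cu; apply: cont0M; first exact: cont0_cst.
  apply: (cont0_comp (@continuous_expR R)); exact: cont0_min.
- move=> b; have [N N0 hN] := @cont0_bounded _ _ b cM.
  exists (`|s| * expR N); first by rewrite mulr_ge0 // expR_ge0.
  move=> r x y rb; rewrite -mulrBr normrM -mulrA ler_wpM2l //.
  apply: le_trans (expR_lip_min _ _ _) _.
  rewrite ler_wpM2r // ler_expR; have := hN r ltac:(lra).
  by rewrite ler_norml; lra.
Qed.

(** For odd [m] a solution lies below the polyharmonic polynomial with the same
    data, so truncating the exponential there changes nothing. *)
Lemma odd_global m alpha (beta : 'rV[R]_m.-1) : odd m ->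
  exists u, radial_solution n m alpha beta +oo%E u.
Proof.
move=> om; have m0 : (0 < m)%N by case: m om {beta}.
pose M := chaininv n m (data alpha beta) (fun=> 0).
have cM k : cont0 (M k) by apply: chaininv_cont0 => //; exact: cont0_cst.
have hM b : chain n m b M (fun k r => r * avg n (M k.+1) r) (data alpha beta).
  by apply: chaininv_chain => //; exact: cont0_cst.
have [w [hw cw w0 hm]] := @trunc_exists m (data alpha beta) (-1) (M 0%N) m0 (cM 0%N).
exists (w 0%N); apply: chain_radial => // r r0; rewrite hm //.
rewrite -signr_odd om expr1; congr (_ * expR _); apply/min_idPl.
have /predU1P[<-|{}r0] : (0 == r) || (0 < r) by rewrite -le_eqVlt.
  by rewrite w0 /M chaininvE // lapinv0.
apply: (@chain_le R n n1 m (r + 1) _ _ _ _ _ _ (hw _) (hM _)) => //; last lra.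
move=> s s0; rewrite hm; last by lra.
by rewrite /M chaininv_top mulN1r oppr_le0 expR_ge0.
Qed.

End Global.


(** * Growth at infinity *)

Section Growth.
Variable R : realType.
Implicit Types (f g : R -> R) (a b r : R).

(** Validity for all large [r]. The threshold is positive so that [r > 0] comes for free. *)
Definition ev (P : R -> Prop) := exists2 r0 : R, 0 < r0 & forall r, r0 <= r -> P r.

Lemma ev_imp (P Q : R -> Prop) : (forall r, 0 < r -> P r -> Q r) -> ev P -> ev Q.
Proof. by move=> h [r0 r00 H]; exists r0 => // r rr; apply: h; [lra|exact: H]. Qed.

Lemma evI (P Q : R -> Prop) : ev P -> ev Q -> ev (fun r => P r /\ Q r).
Proof.
move=> [r0 r00 h0] [r1 r10 h1]; exists (Num.max r0 r1).
  by rewrite lt_max r00.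
by move=> r; rewrite ge_max => /andP[? ?]; split; [exact: h0|exact: h1].
Qed.

Lemma ev_all m (P : nat -> R -> Prop) : (forall k, (k < m)%N -> ev (P k)) ->
  ev (fun r => forall k, (k < m)%N -> P k r).
Proof.
elim: m => [|m IH] h; first by exists 1.
have h1 := IH (fun k km => h k (leqW km)).
apply: ev_imp (evI h1 (h m (leqnn _))) => r r0 [H1 H2] k.
by rewrite ltnS leq_eqVlt => /predU1P[->//|]; exact: H1.
Qed.

Lemma ev_ge (c : R) : ev (fun r => c <= r).
Proof. by exists (Num.max 1 c); [rewrite lt_max ltr01|move=> r; rewrite ge_max => /andP[]]. Qed.

Lemma ev_false (P : R -> Prop) : ev P -> (forall r, 0 < r -> ~ P r) -> False.
Proof. by move=> [r0 r00 h] /(_ _ r00); apply; exact: h. Qed.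

Lemma primitive_growth f (f' : R -> R) (A : R) k :
  (forall r, 0 < r -> isd f r (f' r)) -> ev (fun r => f' r <= A * r ^+ k) ->
  forall eta : R, 0 < eta -> ev (fun r => f r <= (A / k.+1%:R + eta) * r ^+ k.+1).
Proof.
move=> h [r0 r00 hr] eta eta0.
pose F t := A / k.+1%:R * t ^+ k.+1 - f t; pose C : R := `|F (2 * r0)|.
have C0 : 0 <= C by exact: normr_ge0.
apply: ev_imp (evI (ev_ge (2 * r0)) (evI (ev_ge 1) (ev_ge (C / eta)))) => r rp [rr0 [r1 rC]].
have H : F (2 * r0) <= F r.
  apply: (@incr_oo _ F (fun t => A * t ^+ k - f' t) r0 (r + 1)); try lra.
  move=> t ht; split; last by rewrite subr_ge0; apply: hr; lra.
  apply: isdB; last by apply: h; lra.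
  by apply: isd_eq (isdZ _ (isd_pow t k.+1)) _ => /=; field; rewrite nat1r pnatr_eq0.
have H2 : C <= eta * r ^+ k.+1.
  rewrite ler_pdivrMr // mulrC in rC; apply: le_trans rC _.
  by rewrite ler_wpM2l ?(ltW eta0) // ler_eXnr.
have := ler_norm (- F (2 * r0)); rewrite normrN -/C => H3.
have HF : F r = A / k.+1%:R * r ^+ k.+1 - f r by [].
rewrite mulrDl; move: (A / _ * _) HF => X HF; lra.
Qed.

Variable n : nat.
Hypothesis n1 : (1 <= n)%N.

(** Two integrations, the first one for the flux. *)
Lemma lap_growth f q g (A : R) k : (forall b, lap n 0 b f q g) ->
  ev (fun r => g r <= A * r ^+ k) -> forall eta : R, 0 < eta ->
  ev (fun r => q r <= (A / (k + n)%:R + eta) * r ^+ k.+1) /\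
  ev (fun r => f r <= (A / (k.+2 * (k + n))%:R + eta) * r ^+ k.+2).
Proof.
move=> h hg.
have Q (eta : R) : 0 < eta -> ev (fun r => q r <= (A / (k + n)%:R + eta) * r ^+ k.+1).
  move=> eta0.
  have [||//|r0 r00 H] := @primitive_growth (fun s => s ^+ n.-1 * q s)
      (fun s => s ^+ n.-1 * g s) A (k + n.-1)%N _ _ eta.
  - by move=> r r0; apply: (lap_flux n1 (lexx 0) (h (r + 1))); lra.
  - apply: ev_imp hg => r r0 gr.
    by rewrite addnC exprD mulrCA ler_pM2l ?exprn_gt0.
  exists r0 => // r rr; have := H r rr; have r_gt0 : 0 < r by lra.
  rewrite -addnS prednK // => {}H.
  rewrite -(ler_pM2l (exprn_gt0 n.-1 r_gt0)) mulrCA -exprD.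
  by rewrite addnS -addSn prednK // (addnC n).
move=> eta eta0; split; first exact: Q.
have hd r : 0 < r -> isd f r (q r).
  by move=> r0; have [|//] := h (r + 1) r; lra.
have eta2 : 0 < eta / 2 by lra.
have H := primitive_growth hd (Q eta eta0) eta2.
apply: ev_imp H => r r0 /le_trans; apply.
rewrite ler_pM2r ?exprn_gt0 // natrM invfM.
have : eta * k.+2%:R^-1 <= eta * 2^-1.
  by rewrite ler_wpM2l ?(ltW eta0) // lef_pV2 ?posrE // ler_nat.
by set x : R := k.+2%:R^-1; set y : R := (k + n)%:R^-1; lra.
Qed.

(** The coefficients of [r ^ (2 j)] in the iterated inverse Laplacians of [1]. *)
Fixpoint coef (j : nat) : R :=
  if j is i.+1 then coef i / ((2 * i).+2 * (2 * i + n))%:R else 1.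

Lemma coef_gt0 j : 0 < coef j.
Proof.
elim: j => //= j IH; rewrite divr_gt0 // ltr0n muln_gt0 /= addn_gt0.
by rewrite n1 orbT.
Qed.

Lemma chain_growth k w q al (A : R) : (forall b, chain n k b w q al) ->
  ev (fun r => w k r <= A) -> forall eta : R, 0 < eta ->
  ev (fun r => w 0%N r <= (A * coef k + eta) * r ^+ (2 * k)).
Proof.
move=> h hA eta eta0; have H : forall i, (i <= k)%N ->
    ev (fun r => w i r <= (A * coef (k - i) + eta) * r ^+ (2 * (k - i))).
  apply: down_ind.
    by rewrite subnn; apply: ev_imp hA => r r0; rewrite /= muln0 expr0 !mulr1; lra.
  move=> i ik hi.
  have [|_] := lap_growth (fun b => let: And3 l _ _ := h b i ik in l) hi (eta := eta / 2).
    by lra.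
  apply: ev_imp => r r0; rewrite -(subnSK ik) /= mulnS !add2n => /le_trans; apply.
  rewrite ler_pM2r ?exprn_gt0 // -/coef.
  set D := (_ * _)%N; have D2 : (2 <= D)%N.
    by rewrite -[2%N]muln1 leq_mul // addn_gt0 n1 orbT.
  have : eta * (D%:R : R)^-1 <= eta * 2^-1.
    rewrite ler_wpM2l ?(ltW eta0) // lef_pV2 ?posrE ?ltr0n ?ler_nat //.
    exact: leq_trans D2.
  by set x : R := D%:R^-1; set y := coef _; lra.
by have := H 0%N isT; rewrite subn0.
Qed.

Lemma lap_ev f q g (c M : R) : 0 < c -> (forall b, lap n 0 b f q g) ->
  ev (fun r => g r <= - c) -> ev (fun r => q r <= 0 /\ f r <= - M).
Proof.
move=> c0 h hg; have n0 : 0 < n%:R :> R by rewrite ltr0n.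
have hg' : ev (fun r => g r <= - c * r ^+ 0).
  by apply: ev_imp hg => r _; rewrite expr0 mulr1.
have [|Q F] := lap_growth h hg' (eta := c / (2 * n%:R) / 2).
  by rewrite !divr_gt0 // mulr_gt0.
pose d := c / (2 * n%:R); have d0 : 0 < d by rewrite divr_gt0 // mulr_gt0.
have dn : c / n%:R = 2 * d by rewrite /d; field; rewrite gt_eqF.
have dn2 : c / (2 * n)%:R = d by rewrite natrM.
rewrite -/d in Q F.
apply: ev_imp (evI (evI Q F) (evI (ev_ge 1) (ev_ge (2 * M / d)))) => r r0 [[]].
rewrite !add0n !mulNr dn dn2 => hq hf [r1 rM]; split.
  by apply: le_trans hq _; rewrite expr1 -(opprK (d / 2)) -opprD mulNr oppr_le0 mulr_ge0 ?(ltW r0) //; lra.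
rewrite ler_pdivrMr // in rM.
have rd : 0 < r * d by rewrite mulr_gt0.
have rrd : r * d <= r * (r * d) by rewrite ler_peMl // ltW.
by apply: le_trans hf _; rewrite expr2; lra.
Qed.

Lemma chain_ev k w q al (c M : R) : 0 < c -> (forall b, chain n k b w q al) ->
  ev (fun r => w k r <= - c) ->
  forall i, (i < k)%N -> ev (fun r => q i r <= 0 /\ w i r <= - M).
Proof.
move=> c0 h hk.
have lw i (ik : (i < k)%N) b : lap n 0 b (w i) (q i) (w i.+1).
  by have [] := h b i ik.
have H : forall i, (i <= k)%N -> ev (fun r => w i r <= - c).
  apply: down_ind => // i ik hi; have := lap_ev c c0 (lw i ik) hi.
  by apply: ev_imp => r _ [].
by move=> i ik; apply: lap_ev c0 (lw i ik) (H _ ik).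
Qed.

(** Since [(r - rho) / r <= 1], the Laplacian of [(r - rho)^(2j+2)] is at most
    [(2j+2) (2j+n) (r - rho)^(2j)]; hence the coefficients of the expansion at the
    origin also give lower barriers centred at a radius [rho > 0]. *)
Lemma barrier m b w q (rho E : R) : 0 <= E ->
  (forall k, (k < m)%N -> lap n 0 b (w k) (q k) (w k.+1)) ->
  0 < rho -> rho < b ->
  (forall k, (k < m)%N -> 0 <= w k rho /\ 0 <= q k rho) ->
  (forall r, rho < r < b -> E <= w m r) -> (0 < m)%N ->
  forall r, rho < r < b -> w 0%N rho + E * coef m * (r - rho) ^+ (2 * m) <= w 0%N r.
Proof.
move=> E0 lw rho0 rb hrho hm m0.
have step k : (k < m)%N ->
    (forall r, rho < r < b -> E * coef (m - k.+1) * (r - rho) ^+ (2 * (m - k.+1)) <= w k.+1 r) ->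
    forall r, rho < r < b -> w k rho + E * coef (m - k) * (r - rho) ^+ (2 * (m - k)) <= w k r.
  move=> km hk r rr; rewrite -(subnSK km) mulnS add2n; move: hk.
  set j := (m - k.+1)%N => hk.
  have rhob : 0 < rho < b by rewrite rho0.
  have [d1 d2] := lw k km rho rhob.
  have ds (i : nat) (t : R) : isd (fun t : R => (t - rho) ^+ i) t (i%:R * (t - rho) ^+ i.-1).
    by apply: isd_eq (isdX i (isdB (isd_id t) (isd_cst t rho))) _; rewrite subr0 mulr1.
  pose c := E * coef j.+1.
  have c0 : 0 <= c by rewrite mulr_ge0 // ltW // coef_gt0.
  have L : lap n rho b (fun t => w k rho + c * (t - rho) ^+ (2 * j).+2)
     (fun t => c * ((2 * j).+2%:R * (t - rho) ^+ (2 * j).+1))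
     (fun t => c * ((2 * j).+2%:R * ((2 * j).+1%:R * (t - rho) ^+ (2 * j)))
        + (n%:R - 1) / t * (c * ((2 * j).+2%:R * (t - rho) ^+ (2 * j).+1))).
    move=> t tt; split.
      by apply: isd_eq (isdD (isd_cst _ _) (isdZ c (ds (2 * j).+2 t))) _; rewrite add0r.
    by apply: isd_eq (isdZ c (isdZ _ (ds (2 * j).+1 t))) _; rewrite addrK.
  have C1 := isd_cont (isdD (isd_cst rho (w k rho)) (isdZ c (ds (2 * j).+2 rho))).
  have C2 := isd_cont (isdZ c (isdZ (2 * j).+2%:R (ds (2 * j).+1 rho))).
  have rho0' : 0 <= rho by lra.
  have lk : lap n rho b (w k) (q k) (w k.+1) by apply: lap_sub (lw k km); lra.
  have [|||_] := lap_le n1 rho0' L lk (cont_rlim C1) (cont_rlim C2)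
    (cont_rlim (isd_cont d1)) (cont_rlim (isd_cont d2)) _ _ _ rr.
  - by rewrite subrr expr0n mulr0 addr0.
  - by rewrite subrr expr0n !mulr0; case: (hrho k km).
  - move=> t tt; apply: le_trans (hk t tt).
    set x := t - rho; have x0 : 0 < x by rewrite /x; lra.
    have t0 : 0 < t by lra.
    have xt : x / t <= 1 by rewrite ler_pdivrMr // mul1r /x; lra.
    have p0 : 0 <= x ^+ (2 * j) by rewrite exprn_ge0 // ltW.
    have -> : E * coef j = c * ((2 * j).+2 * (2 * j + n))%:R.
      by rewrite /c /= -!mulrA mulVf ?mulr1 // pnatr_eq0 -lt0n muln_gt0 /= addn_gt0 n1 orbT.
    rewrite natrM natrD exprS -[(2 * j).+1%:R]natr1.
    set z := x ^+ _ in p0 *; set J : R := (2 * j)%:R; set J2 := (2 * j).+2%:R.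
    have -> : (n%:R - 1) / t * (c * (J2 * (x * z))) = (c * J2 * z) * ((n%:R - 1) * (x / t)) by ring.
    have -> : c * (J2 * ((J + 1) * z)) = (c * J2 * z) * (J + 1) by ring.
    rewrite -mulrDr.
    have -> : c * (J2 * (J + n%:R)) * z = (c * J2 * z) * (J + n%:R) by ring.
    apply: ler_wpM2l; first by apply: mulr_ge0 => //; apply: mulr_ge0 => //; exact: ler0n.
    have : 1 <= n%:R :> R by rewrite ler1n.
    by nra.
  - by rewrite /c.
have H : forall k, (k <= m)%N -> forall r, rho < r < b ->
    E * coef (m - k) * (r - rho) ^+ (2 * (m - k)) <= w k r.
  apply: down_ind => [r rr|k km hk r rr]; first by rewrite subnn /= mulr1 mulr1; exact: hm.
  apply: le_trans (step k km hk r rr); rewrite lerDr; exact: (hrho k km).1.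
by move=> r rr; have := step 0%N m0 (H 1%N m0) r rr; rewrite subn0.
Qed.

(** Blow-up in finite time: if [w 0] has grown to [M0 + a j] then it grows by
    a further [a] over a length [2^-j], because the gain
    [exp (M0 + a j) * coef m * 4^(-j m)] stays above [a]. *)
Lemma blowup m w q al (c : R) : (2 <= m)%N -> 0 < c ->
  (forall b, chain n m b w q al) -> (forall r, 0 < r -> w m r = expR (w 0%N r)) ->
  ev (fun r => c <= w m.-1 r) -> False.
Proof.
move=> m2 c0 h hm hc.
have m0 : (0 < m)%N by apply: leq_trans m2.
have m1 : (0 < m.-1)%N by rewrite -ltnS prednK.
(* [a = 4^m] so that [exp a >= 4^m], and [M0] so that [exp M0 * coef m >= a] *)
pose a : R := 4 ^+ m.
have a1 : 1 <= a by rewrite exprn_ege1 // ler1n.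
have cm := coef_gt0 m.
pose M0 := a / coef m.
have M00 : 0 < M0 by rewrite divr_gt0 //; lra.
have hN b : chain n m.-1 b _ _ _ := chain_sub (leq_pred m) (lexx b) (chainN (h b)).
have hcN : ev (fun r => - w m.-1 r <= - c) by apply: ev_imp hc => r _; rewrite lerN2.
have H1 := chain_ev M0 c0 hN hcN.
have H2 : ev (fun r => forall k, (k < m)%N -> 0 <= w k r /\ 0 <= q k r).
  apply: ev_all => k km.
  have [km1|] := ltnP k m.-1.
    by apply: ev_imp (H1 k km1) => r r0; rewrite !oppr_le0 lerN2 => -[-> ?]; split => //; lra.
  move=> mk; have -> : k = m.-1 by apply/eqP; rewrite eqn_leq mk -ltnS prednK ?km.
  apply: ev_imp hc => r r0 cw; split; first lra.
  have [|h1 h2 h3] := h (r + 1) m.-1; first by rewrite prednK.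
  rewrite prednK // in h1.
  have [||] := lap_ge0 n1 (lexx 0) h1 h2 h3 (lexx 0) _ (r := r) => //; last lra.
  by move=> s s0; rewrite hm ?expR_ge0 //; lra.
have [rho' rho0' Hr'] := evI H2 (H1 0%N m1).
pose rho := rho' + 1; have rho0 : 0 < rho by rewrite /rho; lra.
have Hr r : rho <= r -> (forall k, (k < m)%N -> 0 <= w k r /\ 0 <= q k r) /\ M0 <= w 0%N r.
  by move=> rr; have [|? [_ ?]] := Hr' r; [rewrite /rho in rr; lra|split=> //; lra].
have isdw k r : (k < m)%N -> 0 < r -> isd (w k) r (q k r).
  by move=> km r0; apply: (chain_isd (h (r + 1)) km); lra.
have mono r s : rho <= r -> r <= s -> w 0%N r <= w 0%N s.
  move=> rr rs; apply: (@incr_oo _ (w 0%N) (q 0%N) rho' (s + 1)); rewrite /rho in rr; try lra.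
  move=> x xr; split; first by apply: isdw => //; lra.
  by have [|+ _] := Hr' x; [lra|move=> /(_ 0%N m0)[]].
(* consecutive radii [rr j] differ by [2^-j] and stay below [rho + 2] *)
pose rr j := rho + 2 - 2 / 2 ^+ j.
have p2 j : 0 < (2 : R) / 2 ^+ j <= 2.
  by rewrite divr_gt0 ?exprn_gt0 //= ler_pdivrMr ?exprn_gt0 // ler_peMr // exprn_ege1 // ler1n.
have rr_ge j : rho <= rr j by rewrite /rr; have := p2 j; lra.
have rr_S j : rr j.+1 - rr j = 2^-1 ^+ j.
  by rewrite /rr exprS invfM exprVn; field; rewrite expf_neq0.
have grow j : M0 + a * j%:R <= w 0%N (rr j).
  elim: j => [|j IH].
    by rewrite mulr0 addr0; exact: (Hr _ (rr_ge 0%N)).2.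
  have E0 : 0 <= expR (M0 + a * j%:R) by exact: expR_ge0.
  have rj0 : 0 < rr j by apply: lt_le_trans (rr_ge j).
  pose b := rr j.+1 + 1.
  have rS : rr j < rr j.+1 by rewrite -subr_gt0 rr_S exprn_gt0.
  have := @barrier m b w q (rr j) (expR (M0 + a * j%:R)) E0 _ rj0 _ _ _ m0 (rr j.+1).
  rewrite rr_S => B.
  have {}B : w 0%N (rr j) + expR (M0 + a * j%:R) * coef m * (2^-1 ^+ j) ^+ (2 * m) <= w 0%N (rr j.+1).
    apply: B.
    - by move=> k km; have [] := h b k km.
    - by rewrite /b; lra.
    - by move=> k km; apply: (Hr _ (rr_ge j)).1.
    - move=> r rjb; rewrite hm; last by lra.
      by rewrite ler_expR; apply: le_trans IH _; apply: mono; [exact: rr_ge|lra].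
    - by rewrite rS /b; lra.
  apply: le_trans B; rewrite -natr1 mulrDr mulr1 addrA; apply: lerD => //.
  have -> : (2^-1 ^+ j) ^+ (2 * m) = (a^-1) ^+ j :> R.
    have -> : a = 2 ^+ (2 * m) by rewrite exprM expr2 -natrM.
    by rewrite !exprVn -!exprM mulnC.
  rewrite expRD mulrC expRM_natr.
  have ea : a ^+ j <= expR a ^+ j.
    by rewrite lerXn2r ?nnegrE ?expR_ge0 //; [lra|have := expR_ge1Dx a; lra].
  have eM : a <= expR M0 * coef m.
    have : M0 * coef m <= expR M0 * coef m.
      by rewrite ler_pM2r //; have := expR_ge1Dx M0; lra.
    by rewrite /M0 divfK // gt_eqF.
  have aj : 0 < a^-1 ^+ j by rewrite exprn_gt0 // invr_gt0; lra.
  have ajj : a^-1 ^+ j * a ^+ j = 1 by rewrite -exprMn mulVf ?expr1n // gt_eqF; lra.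
  set X := expR M0 in eM *; set Y := expR a ^+ j in ea *; set Z := a^-1 ^+ j in aj ajj *.
  have X0 : 0 <= X * coef m by lra.
  have ZY : 1 <= Z * Y by rewrite -ajj ler_pM2l.
  have -> : Z * (X * Y * coef m) = (X * coef m) * (Z * Y) by ring.
  by apply: le_trans eM _; rewrite ler_peMr.
have bound j : M0 + a * j%:R <= w 0%N (rho + 2).
  by apply: le_trans (grow j) _; apply: mono; [exact: rr_ge|rewrite /rr; have := p2 j; lra].
pose W := w 0%N (rho + 2); have h1 : W < (Num.truncn W).+1%:R := truncnS_gt W.
have h2 := bound (Num.truncn W).+1; rewrite -/W in h2.
have : (Num.truncn W).+1%:R <= a * (Num.truncn W).+1%:R by rewrite ler_peMl // ler0n.
lra.
Qed.

(** * Signs of the iterated Laplacians *)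

Definition altern (w : nat -> R -> R) (k : nat) (r : R) : R := (-1) ^+ k * w k r.

Section Signs.
Variables (m : nat) (w q : nat -> R -> R) (al : nat -> R).
Hypothesis m0 : (0 < m)%N.
Hypothesis hw : forall b, chain n m b w q al.
Hypothesis hm : forall r, 0 < r -> w m r = (-1) ^+ m * expR (w 0%N r).

Local Notation s := (altern w).

Lemma lap_sgn k b : (k < m)%N ->
  lap n 0 b (fun r => - s k r) (fun r => - ((-1) ^+ k * q k r)) (fun r => s k.+1 r).
Proof.
move=> km; have [h1 _ _] := hw b km.
apply: lap_eq (lapN (lapZ ((-1) ^+ k) h1)) => r rb.
by rewrite /altern exprS; ring.
Qed.

Lemma sgn_decr k : (k < m)%N -> (forall r, 0 < r -> 0 < s k.+1 r) ->
  forall r, 0 < r -> (-1) ^+ k * q k r < 0 /\ s k r < (-1) ^+ k * al k.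
Proof.
move=> km h r r0; have [_ h2 h3] := hw (r + 1) km.
have l1 : - s k r @[r --> 0^'+] --> - ((-1) ^+ k * al k).
  exact: rlimN (rlimM (@rlim_cst R 0 _) h2).
have l2 : - ((-1) ^+ k * q k r) @[r --> 0^'+] --> - ((-1) ^+ k * 0 : R).
  exact: rlimN (rlimM (@rlim_cst R 0 _) h3).
have rr : 0 < r < r + 1 by lra.
have [||] := lap_gt0 n1 (lexx 0) (@lap_sgn k (r + 1) km) l1 l2 _ _ rr.
- by rewrite mulr0 oppr0.
- by move=> x xr; apply: h; lra.
by rewrite oppr_gt0 ltrN2.
Qed.

Lemma sgn_mono k : (k < m)%N -> (forall r, 0 < r -> 0 < s k.+1 r) ->
  forall r t, 0 < r -> r < t -> s k t < s k r.
Proof.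
move=> km h r t r0 rt; rewrite -ltrN2.
apply: (@sincr_oo _ (fun r => - s k r) (fun r => - ((-1) ^+ k * q k r)) 0 (t + 1)); try lra.
move=> x xt; have [h1 _] := @lap_sgn k (t + 1) km x xt; split => //.
by rewrite oppr_gt0; case: (sgn_decr km h (r := x)); lra.
Qed.

Lemma sgn_top r : 0 < r -> 0 < s m r.
Proof.
move=> r0; rewrite /altern hm // mulrA -exprMn mulrNN mulr1 expr1n mul1r.
exact: expR_gt0.
Qed.

Lemma sgn_le0_ev k r0 : (k < m)%N -> (forall r, 0 < r -> 0 < s k.+1 r) ->
  0 < r0 -> s k r0 <= 0 -> exists2 c : R, 0 < c & ev (fun r => s k r <= - c).
Proof.
move=> km h r00 sr0; exists (- s k (r0 + 1)).
  by rewrite oppr_gt0; apply: lt_le_trans sr0; apply: sgn_mono => //; lra.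
exists (r0 + 1); first by lra.
move=> r; rewrite opprK le_eqVlt => /predU1P[<- //|rr].
by apply/ltW/sgn_mono => //; lra.
Qed.

(** Otherwise [w (m - 1)] is eventually above a positive constant, and the solution
    blows up. *)
Lemma even_sgn : (2 <= m)%N -> ~~ odd m -> forall r, 0 < r -> 0 < s m.-1 r.
Proof.
move=> m2 em r r0; rewrite ltNge; apply/negP => sr.
have e : m.-1.+1 = m by rewrite prednK.
have [| |c c0 hc] := @sgn_le0_ev m.-1 r _ _ r0 sr; first by rewrite e.
  by move=> t; rewrite e; exact: sgn_top.
apply: (@blowup m w q al c m2 c0 hw).
  by move=> t t0; rewrite hm // -signr_odd (negbTE em) expr0 mul1r.
apply: ev_imp hc => t t0; rewrite /altern -signr_odd.
have -> : odd m.-1 by move: em; rewrite -e /= negbK.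
by rewrite expr1; lra.
Qed.

(** Either all the [(-1)^k w k] with [1 <= k] stay positive, or the last one
    which does not has even index and drives [w 0] to minus infinity: with odd
    index it would drive [w 0] to plus infinity, and the exponential would then
    destroy the positivity of [(-1)^(m-1) w (m-1)]. *)
Lemma dichotomy : (forall k r, (0 < k)%N -> (k <= m)%N -> 0 < r -> 0 < s k r) \/
  exists k (c : R), [/\ (2 <= k)%N, ~~ odd k, 0 < c &
    ev (fun r => w 0%N r <= - c * r ^+ (2 * k))].
Proof.
set B := (X in _ \/ X).
have [b|nB] := pselect B; [by right|left].
have H : forall k, (k <= m)%N -> (0 < k)%N -> forall i, (k <= i)%N -> (i <= m)%N ->
    forall r, 0 < r -> 0 < s i r.
  apply: down_ind.
    move=> _ i mi im; have -> : i = m by apply/eqP; rewrite eqn_leq im.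
    exact: sgn_top.
  move=> k km IH k0 i; rewrite leq_eqVlt => /predU1P[<- _|ki im]; last first.
    exact: IH.
  have hk1 r : 0 < r -> 0 < s k.+1 r by apply: IH.
  move=> r r0; rewrite ltNge; apply/negP => sr.
  have [c c0 hc] := sgn_le0_ev km hk1 r0 sr.
  have hk b : chain n k b w q al := chain_sub (ltnW km) (lexx b) (hw b).
  have [ok|ek] := boolP (odd k); last first.
    apply: nB; exists k, (c * coef k / 2); split => //.
    - by case: k k0 ek {km IH hk1 sr hc hk} => [|[|]].
    - by rewrite divr_gt0 // mulr_gt0 // coef_gt0.
    have hc' : ev (fun t => w k t <= - c).
      apply: ev_imp hc => t t0; rewrite /altern -signr_odd (negbTE ek) expr0 mul1r; exact.
    have := chain_growth hk hc' (eta := c * coef k / 2).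
    rewrite divr_gt0 // ?mulr_gt0 ?coef_gt0 // => /(_ isT).
    apply: ev_imp => t t0 /le_trans; apply; rewrite ler_pM2r ?exprn_gt0 //; lra.
  have hkN b : chain n k b _ _ _ := chainN (hk b).
  have hcN : ev (fun t => - w k t <= - c).
    by apply: ev_imp hc => t t0; rewrite /altern -signr_odd ok expr1 mulN1r.
  have H0 := chain_ev 0 c0 hkN hcN k0.
  have e1 : m.-1.+1 = m by rewrite prednK.
  have top : ev (fun t => - s m t <= - 1).
    apply: ev_imp H0 => t t0 [_]; rewrite oppr0 oppr_le0 => w0.
    rewrite /altern hm // mulrA -exprMn mulrNN mulr1 expr1n mul1r lerN2.
    by rewrite -expR0 ler_expR.
  have lm b : lap n 0 b (s m.-1) (fun r => (-1) ^+ m.-1 * q m.-1 r) (fun r => - s m r).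
    move=> t tb; have := lapN (@lap_sgn m.-1 b _) tb; rewrite e1 leqnn => /(_ isT)[d1 d2].
    by split; [apply: isd_eq (isd_local tb _ d1) _|apply: isd_eq (isd_local tb _ d2) _]; rewrite ?opprK // => y _; rewrite opprK.
  apply: (ev_false (lap_ev 1 ltr01 lm top)) => t t0 [_].
  have sm1 : 0 < s m.-1 t; last lra.
  have [km1|] := ltnP k m.-1; first by apply: IH => //; exact: leq_pred.
  move=> mk; have kE : k = m.-1 by apply/eqP; rewrite eqn_leq mk -ltnS e1 km.
  have om : ~~ odd m by rewrite -e1 /= -kE ok.
  by apply: even_sgn => //; rewrite -e1 ltnS -kE.
by move=> k r k0 km r0; exact: (H k km k0 k (leqnn _) km).
Qed.

End Signs.

End Growth.


(** * Odd order: decay at infinity *)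

Section Odd.
Variable R : realType.
Variable n : nat.
Hypothesis n1 : (1 <= n)%N.
Implicit Types (f g u : R -> R) (a b r : R).

Lemma global_chain m alpha (beta : 'rV[R]_m.-1) u :
  radial_solution n m alpha beta +oo%E u ->
  (forall b, chain n m b (fun k => iter k (rlap n) u)
     (fun k => ((iter k (rlap n) u)^`())%classic) (data alpha beta)) /\
  forall r, 0 < r -> iter m (rlap n) u r = (-1) ^+ m * expR (u r).
Proof.
move=> s; split=> [b|r r0].
  have [|h _] := radial_chain n1 s (b := Num.max b 1) _ (leey _).
    by rewrite lt_max ltr01 orbT.
  by apply: chain_sub h => //; rewrite le_max lexx.
by have [|_ h] := radial_chain n1 s (b := r + 1) _ (leey _); [lra|apply: h; lra].
Qed.

Lemma ev_upper u (c : R) K : 0 < c -> ev (fun r => u r <= - c * r ^+ K) ->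
  exists C rbar : R, [/\ 0 < C, 0 < rbar &
    forall r : R, rbar < r -> u r < - C * r ^+ K].
Proof.
move=> c0 [r0 r00 h]; exists (c / 2), r0; split => //; first lra.
move=> r r0r; apply: le_lt_trans (h r (ltW r0r)) _.
by rewrite ltr_pM2r ?exprn_gt0 //; lra.
Qed.

Lemma odd_maximal m alpha (beta : 'rV[R]_m.-1) T u : odd m ->
  maximal_solution n m alpha beta T u ->
  T = +oo%E /\ radial_solution n m alpha beta +oo%E u.
Proof.
move=> om mu; have m0 : (0 < m)%N by case: m om {beta mu}.
have [v hv] := odd_global n1 alpha beta om.
have TE := maximal_global n1 m0 mu hv; split => //.
by rewrite -TE; case: mu.
Qed.

(** A datum of the wrong sign makes some [(-1)^k w k] negative at once, as it
    decreases from its value at the origin. *)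
Lemma odd_wrong_sign m alpha (beta : 'rV[R]_m.-1) T u : (3 <= m)%N -> odd m ->
  maximal_solution n m alpha beta T u ->
  (exists k : 'I_m.-1, Num.sg (beta 0 k) <> (-1) ^+ k.+1) ->
  T = +oo%E /\
  exists C rbar : R, [/\ 0 < C, 0 < rbar &
    forall r : R, rbar < r -> u r < - C * r ^+ 4].
Proof.
move=> m3 om mu [k hk]; have [TE su] := odd_maximal om mu; split => //.
have m0 : (0 < m)%N by apply: leq_trans m3.
have [hw hm] := global_chain su.
have km : (k.+1 < m)%N by have := ltn_ord k; rewrite -ltnS prednK.
have [pos|[k' [c [k2 ek c0 H]]]] := dichotomy n1 m0 hw hm.
  exfalso; apply: hk.
  have [|_ h] := sgn_decr n1 hw km (r := 1) _ ltr01.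
    by move=> r r0; apply: pos.
  have := lt_trans (pos k.+1 1 isT (ltnW km) ltr01) h; rewrite data_ord.
  rewrite -signr_odd; case: (odd _); rewrite ?expr1 ?expr0 ?mulN1r ?mul1r.
    by rewrite oppr_gt0 => /ltr0_sg.
  by move/gtr0_sg.
apply: (ev_upper c0); apply: ev_imp (evI (ev_ge 1) H) => r r0 [r1].
move/le_trans; apply; rewrite !mulNr lerN2 ler_wpM2l ?(ltW c0) //.
by rewrite ler_weXn2l // (leq_mul (leqnn 2) k2).
Qed.

(** Write [s k] for [altern w k], with [k = m - j]. The flux of [s (m - 1)] is
    negative and decreasing. If the flux of [s k] is at most [- c r^(2j-2)] with
    [2 j >= n], then [s k' <= - c / r] and [s k] cannot stay positive. If
    [2 j < n], comparing [s k] at [r] and [2 r] bounds it below by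
    [c' r^(2j-n)], and integrating once more bounds the flux of [s (k - 1)]. *)
Lemma low_dim m (w q : nat -> R -> R) (al : nat -> R) : (2 <= m)%N ->
  (forall b, chain n m b w q al) ->
  (forall k r, (0 < k)%N -> (k <= m)%N -> 0 < r -> 0 < altern w k r) ->
  forall j, (0 < j)%N -> (j <= m)%N -> ((j.-1 * 2 < n)%N \/ j = 1%N) /\
    exists2 c : R, 0 < c &
    ev (fun r => r ^+ n.-1 * ((-1) ^+ (m - j) * q (m - j)%N r) <= - c * r ^+ (2 * j.-1)).
Proof.
move=> m2 hw pos.
have dflux k : (k < m)%N -> forall r, 0 < r ->
    isd (fun r => r ^+ n.-1 * ((-1) ^+ k * q k r)) r (- (r ^+ n.-1 * altern w k.+1 r)).
  move=> km r r0; have h := lapN (lap_sgn hw km (b := r + 1)).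
  have rr : 0 < r < r + 1 by lra.
  have := lap_flux n1 (lexx 0) h rr.
  rewrite mulrN; apply: isd_local rr _ => y _.
  by rewrite opprK.
elim=> // -[_ _ jm|j IH _ jm].
  split; first by right.
  set k := (m - 1)%N.
  have k1 : k.+1 = m by rewrite /k subn1 prednK //; apply: leq_trans m2.
  have km : (k < m)%N by rewrite -k1.
  pose P r := r ^+ n.-1 * ((-1) ^+ k * q k r).
  have P1 : P 1 < 0.
    rewrite /P expr1n mul1r; have [|h _] := sgn_decr n1 hw km (r := 1) _ ltr01 => //.
    by move=> r r0; apply: pos.
  exists (- P 1); first by rewrite oppr_gt0.
  exists 1 => // r r1; rewrite opprK muln0 expr0 mulr1 -lerN2.
  pose Q x : R := x ^+ n.-1 * altern w k.+1 x.
  rewrite -/(P r).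
  have G x : 0 < x < r + 1 -> isd (fun y => - P y) x (Q x) /\ 0 <= Q x.
    move=> xr; have x0 : 0 < x by lra.
    split; first by apply: isd_eq (isdN (dflux k km x x0)) _; rewrite opprK.
    by rewrite mulr_ge0 ?exprn_ge0 ?ltW // pos.
  by apply: (incr_oo G); lra.
have [_ [c c0 H]] := IH isT (ltnW jm).
set k := (m - j.+1)%N in H.
have k0 : (0 < k)%N by rewrite subn_gt0.
have km : (k < m)%N by rewrite ltn_subrL /=; apply: leq_trans m2.
have ds r : 0 < r -> isd (altern w k) r ((-1) ^+ k * q k r).
  by move=> r0; apply: isdZ; apply: (chain_isd (hw (r + 1)) km); lra.
have [r0 r00 {}H] := evI (ev_ge 1) H.
(* otherwise [altern w k] lies below a decreasing logarithm *)
have jn : (j.+1 * 2 < n)%N.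
  rewrite ltnNge; apply/negP => nj.
  pose F r := - (altern w k r + c * ln r).
  have mono r : 2 * r0 <= r -> F (2 * r0) <= F r.
    move=> rr.
    have G x : r0 < x < r + 1 ->
        isd F x (- ((-1) ^+ k * q k x + c * x^-1)) /\
        0 <= - ((-1) ^+ k * q k x + c * x^-1).
      move=> xr; have x0 : 0 < x by lra.
      split; first by apply: isdN; apply: isdD; [exact: ds|apply: isdZ; exact: is_derive1_ln].
      have [|x1 hx] := H x; first by lra.
      rewrite oppr_ge0 -lerBrDr sub0r.
      rewrite -(ler_pM2l (exprn_gt0 n.-1 x0)); apply: le_trans hx _.
      rewrite mulrN mulNr lerN2 mulrCA ler_pM2l // ler_pdivrMr // -exprSr.
      rewrite ler_weXn2l // -ltnS prednK //.
      by move: nj; rewrite mulnC mulnS /= => nj; apply: leq_trans nj _.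
    by apply: (incr_oo G); lra.
  have F0 r : 2 * r0 <= r -> c * ln r <= - F (2 * r0).
    move=> rr; have := mono r rr; have := pos k r k0 (ltnW km) ltac:(lra).
    by rewrite {2}/F; lra.
  pose x := Num.max (2 * r0) (expR ((- F (2 * r0) + 1) / c)).
  have := F0 x; rewrite le_max lexx => /(_ isT).
  have : (- F (2 * r0) + 1) / c <= ln x.
    rewrite -[leLHS]expRK ler_ln ?posrE ?expR_gt0 //; first by rewrite le_max lexx orbT.
    by rewrite lt_max expR_gt0 orbT.
  rewrite ler_pdivrMr // (mulrC (ln x)) => h1 h2; clear H ds IH; lra.
split; first by left.
have kE : k = (m - j.+2).+1 by rewrite /k subnSK.
have km' : (m - j.+2 < m)%N by rewrite ltn_subrL /=; apply: leq_trans m2.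
pose e := (n.-1 - 2 * j)%N.
have ne : n.-1 = (2 * j + e)%N.
  by rewrite /e subnKC // -ltnS prednK // mulnC; apply: leq_trans jn; rewrite mulSn ltnW.
pose c' := c / 2 ^+ e; have c'0 : 0 < c' by rewrite divr_gt0 // exprn_gt0.
have low r : r0 <= r -> c' * r ^+ (2 * j).+1 <= r ^+ n.-1 * altern w k r.
  move=> rr; have r_gt0 : 0 < r by lra.
  have [|x xr|xi /andP[x1 x2] hxi] := @MVT_isd _ (altern w k) (fun r => (-1) ^+ k * q k r) r (2 * r).
  - lra.
  - by apply: ds; lra.
  have xi0 : 0 < xi by lra.
  have [|_ hq] := H xi; first by lra.
  rewrite ne exprD -mulrA (mulrC (- c)) /= ler_pM2l ?exprn_gt0 // in hq.
  have pk := pos k (2 * r) k0 (ltnW km) ltac:(lra).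
  set s1 := (-1) ^+ k * q k xi in hxi hq.
  have hs : - s1 * r <= altern w k r by lra.
  have c'le : c' <= r ^+ e * - s1.
    rewrite /c' ler_pdivrMr ?exprn_gt0 // mulrAC -exprMn.
    have : xi ^+ e * - s1 <= (r * 2) ^+ e * - s1.
      rewrite ler_wpM2r //; last by apply: lerXn2r; rewrite ?nnegrE; lra.
      have : xi ^+ e * s1 < 0 by lra.
      by rewrite pmulr_rlt0 ?exprn_gt0 // => /ltW; rewrite oppr_ge0.
    lra.
  rewrite ne exprD exprS; set z := r ^+ (2 * j).
  have -> : c' * (r * z) = z * (c' * r) by ring.
  rewrite -mulrA ler_pM2l ?exprn_gt0 //.
  apply: le_trans (ler_wpM2l (ltW (exprn_gt0 e r_gt0)) hs).
  by rewrite mulrA ler_wpM2r // ltW.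
have G := @primitive_growth R (fun r => r ^+ n.-1 * ((-1) ^+ (m - j.+2) * q (m - j.+2)%N r))
  (fun r => - (r ^+ n.-1 * altern w k r)) (- c') (2 * j).+1.
exists (c' / (2 * (2 * j).+2%:R)); first by rewrite divr_gt0 // mulr_gt0.
have J0 : (2 * j).+2%:R != 0 :> R by rewrite pnatr_eq0.
have [|||r1 r10 h1] := G _ _ (c' / (2 * (2 * j).+2%:R)).
- by move=> r; rewrite kE; exact: dflux.
- by exists r0 => // r rr; rewrite mulNr lerN2; exact: low.
- by rewrite divr_gt0 // mulr_gt0.
exists r1 => // r rr; apply: le_trans (h1 r rr) _.
have -> : (2 * j.+2.-1 = (2 * j).+2)%N by rewrite /= mulnS.
rewrite ler_pM2r ?exprn_gt0 //; last lra.
by rewrite le_eqVlt; apply/orP; left; apply/eqP; field.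
Qed.

Lemma odd_low_dim m alpha (beta : 'rV[R]_m.-1) T u : (3 <= m)%N -> odd m ->
  (n <= 2 * m - 1)%N ->
  maximal_solution n m alpha beta T u ->
  T = +oo%E /\
  exists (C rbar : R) (K : nat), [/\ 0 < C, 0 < rbar, (0 < K)%N &
    forall r : R, rbar < r -> u r < - C * r ^+ K].
Proof.
move=> m3 om nm mu; have [TE su] := odd_maximal om mu; split => //.
have m0 : (0 < m)%N by apply: leq_trans m3.
have [hw hm] := global_chain su.
suff [c [K [c0 K0 H]]] : exists (c : R) (K : nat), [/\ 0 < c, (0 < K)%N &
    ev (fun r => u r <= - c * r ^+ K)].
  have [C [rb [h1 h2 h3]]] := ev_upper c0 H.
  by exists C, rb, K.
have [pos|[k' [c [k2 ek c0 H]]]] := dichotomy n1 m0 hw hm; last first.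
  exists c, (2 * k')%N; split => //.
  by rewrite muln_gt0 /=; apply: leq_trans k2.
have m2 : (2 <= m)%N by apply: leq_trans m3.
have [[jn|m1] [c c0 H]] := low_dim m2 hw pos m0 (leqnn m); last first.
  by move: m3; rewrite m1.
rewrite subnn in H.
have nE : n.-1 = (2 * m.-1)%N.
  by clear -nm jn n1 m2; lia.
have Hq : ev (fun r => ((iter 0 (rlap n) u)^`())%classic r <= - c * r ^+ 0).
  apply: ev_imp H => r r0; rewrite expr0 mul1r expr0 mulr1 nE mulrC.
  by rewrite ler_pM2r // exprn_gt0.
have hd r : 0 < r -> isd u r (((iter 0 (rlap n) u)^`())%classic r).
  by move=> r0; apply: (chain_isd (hw (r + 1)) m0); lra.
exists (c / 2), 1%N; split => //; first lra.
have c2 : 0 < c / 2 by lra.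
apply: ev_imp (primitive_growth hd Hq c2) => r r0.
by rewrite expr1 => /le_trans; apply; rewrite divr1 ler_pM2r //; lra.
Qed.

End Odd.


(** * Dimension one *)

Section Line.
Variable R : realType.
Implicit Types (f g u : R -> R) (a b r x : R).

Lemma class_C_iter k f : class_C (V := R^o) k setT f ->
  forall i, (i < k)%N -> forall x,
    isd (iter i (fun h : R -> R => (h^`())%classic) f) x
        (iter i.+1 (fun h : R -> R => (h^`())%classic) f x).
Proof.
elim: k f => // k IH f [_ /(_ (1 : R))[df cf]] i.
have E : 'D_(1 : R^o) f = (f^`())%classic by apply/funext => x; rewrite derive1E.
rewrite E in cf.
case: i => [_ x|i ik x]; last by rewrite 2!iterSr; exact: IH.
by rewrite /= derive1E; apply: derivableP; exact: df.
Qed.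

Lemma iter_second m u (d : nat -> R -> R) : d 0%N = u ->
  (forall i, (i < 2 * m)%N -> forall x, isd (d i) x (d i.+1 x)) ->
  forall k, (k <= m)%N -> forall x,
    iter k (fun f s => - ((f^`())^`())%classic s) u x = (-1) ^+ k * d (2 * k)%N x.
Proof.
move=> d0 hd; elim=> [|k IH] km x; first by rewrite expr0 mul1r d0.
have -> : iter k.+1 (fun f s => - ((f^`())^`())%classic s) u x =
    - (((fun x => (-1) ^+ k * d (2 * k)%N x)^`())^`())%classic x.
  by rewrite /=; congr (- (_^`()^`())%classic x); apply/funext => y; exact: IH (ltnW km) y.
have E : ((fun x => (-1) ^+ k * d (2 * k)%N x)^`())%classic =
    fun x => (-1) ^+ k * d (2 * k).+1 x.
  by apply/funext => y; apply: (isd_derive1 (isdZ _ (hd _ _ y))); lia.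
rewrite E (isd_derive1 (isdZ _ (hd _ _ x))); last by lia.
by rewrite mulnS add2n exprS mulN1r mulNr.
Qed.

Lemma poly_decay k (d : nat -> R -> R) (c : R) : 0 < c ->
  (forall i, (i < k)%N -> forall x, isd (d i) x (d i.+1 x)) ->
  ev (fun r => d k r <= - c) ->
  exists2 c' : R, 0 < c' & ev (fun r => d 0%N r <= - c' * r ^+ k).
Proof.
move=> c0 hd hk.
have H : forall i, (i <= k)%N ->
    exists2 c' : R, 0 < c' & ev (fun r => d i r <= - c' * r ^+ (k - i)).
  apply: down_ind.
    exists c => //; apply: ev_imp hk => r _; by rewrite subnn expr0 mulr1.
  move=> i ik [c' c'0 hi].
  have p0 : 0 < c' / (k - i.+1).+1%:R / 2 by rewrite !divr_gt0.
  exists (c' / (k - i.+1).+1%:R / 2) => //.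
  apply: ev_imp (primitive_growth (fun r _ => hd i ik r) hi p0) => r r0.
  move/le_trans; apply; rewrite subnSK // mulNr.
  by rewrite ler_pM2r ?exprn_gt0 //; lra.
by have := H 0%N isT; rewrite subn0.
Qed.

(** Going down from [d (2 m) < 0], the derivatives alternate in sign, until some [d k]
    with [k] odd is eventually below a negative constant, which is the conclusion.
    The wrong sign of an even one, or [d 1 > 0] in the end, bounds [d 0] below near
    infinity; then [d (2 m)] is bounded away from [0] and [d (2 m - 1)] becomes
    negative. *)
Lemma half_line m (d : nat -> R -> R) : (1 <= m)%N ->
  (forall i, (i < 2 * m)%N -> forall x, isd (d i) x (d i.+1 x)) ->
  (forall x, d (2 * m)%N x = - expR (d 0%N x)) ->
  exists2 c : R, 0 < c & ev (fun r => d 0%N r <= - c * r).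
Proof.
move=> m1 hd top; apply: contrapT => nB.
have e1 : (2 * m).-1.+1 = (2 * m)%N by lia.
have no_lower (a : R) : (forall x, 0 < d (2 * m).-1 x) ->
    ev (fun r => a <= d 0%N r) -> False.
  move=> pos ha.
  have hA : ev (fun r => d (2 * m)%N r <= - expR a * r ^+ 0).
    by apply: ev_imp ha => r _; rewrite expr0 mulr1 top lerN2 ler_expR.
  have hd' r : 0 < r -> isd (d (2 * m).-1) r (d (2 * m)%N r).
    by move=> _; rewrite -[X in d X r]e1; apply: hd; lia.
  have p0 : 0 < expR a / 2 by rewrite divr_gt0 // expR_gt0.
  apply: (ev_false (primitive_growth hd' hA p0)) => r r0.
  have := pos r; rewrite divr1 expr1 => h1 h2.
  have : 0 < expR a / 2 * r by rewrite mulr_gt0.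
  lra.
have H : forall k, (k <= 2 * m)%N -> (0 < k)%N -> forall i, (k <= i)%N ->
    (i <= 2 * m)%N -> forall x, 0 < (-1) ^+ i.+1 * d i x.
  apply: down_ind.
    move=> _ i mi im x; have -> : i = (2 * m)%N by lia.
    by rewrite -signr_odd /= oddM /= expr1 top mulrNN mul1r expR_gt0.
  move=> k km IH k0 i; rewrite leq_eqVlt => /predU1P[<- _|ki im]; last first.
    exact: IH.
  move=> x; rewrite ltNge; apply/negP => dx.
  have decr y z : y < z -> (-1) ^+ k.+1 * d k z < (-1) ^+ k.+1 * d k y.
    move=> yz; rewrite -ltrN2.
    have G t : y - 1 < t < z + 1 -> isd (fun t => - ((-1) ^+ k.+1 * d k t)) t
        ((-1) ^+ k.+2 * d k.+1 t) /\ 0 < (-1) ^+ k.+2 * d k.+1 t.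
      move=> _; split; last exact: IH.
      apply: isd_eq (isdN (isdZ ((-1) ^+ k.+1) (hd k km t))) _.
      by rewrite [in RHS]exprS mulN1r mulNr.
    by apply: (sincr_oo G); lra.
  pose c := - ((-1) ^+ k.+1 * d k (x + 1)).
  have c0 : 0 < c.
    by rewrite oppr_gt0; apply: lt_le_trans dx; apply: decr; lra.
  have hc : ev (fun r => (-1) ^+ k.+1 * d k r <= - c).
    apply: ev_imp (ev_ge (x + 1)) => r _; rewrite opprK le_eqVlt => /predU1P[<- //|xr].
    exact/ltW/decr.
  have hdk i' : (i' < k)%N -> forall y : R, isd (d i') y (d i'.+1 y).
    by move=> ik; apply: hd; exact: ltn_trans km.
  have [ok|ek] := boolP (odd k).
    have hc' : ev (fun r => d k r <= - c).
      by apply: ev_imp hc => r _; rewrite -signr_odd /= ok expr0 mul1r.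
    have [c' c'0 hB] := poly_decay c0 hdk hc'.
    apply: nB; exists c' => //; apply: ev_imp (evI (ev_ge 1) hB) => r r0 [r1].
    by move/le_trans; apply; rewrite !mulNr lerN2 ler_pM2l // ler_eXnr.
  have hc' : ev (fun r => - d k r <= - c).
    by apply: ev_imp hc => r _; rewrite -signr_odd /= ek expr1 mulN1r.
  have [c' c'0 hB] := @poly_decay k (fun i r => - d i r) c c0
    (fun i ik y => isdN (hdk i ik y)) hc'.
  apply: (@no_lower 0).
    have km1 : (k < (2 * m).-1)%N by move: ek km; lia.
    move=> y; have := IH isT (2 * m).-1 km1 (leq_pred _) y.
    by rewrite e1 -signr_odd oddM expr0 mul1r.
  apply: ev_imp hB => r r0; rewrite -oppr_le0 mulNr => /le_trans; apply.
  by rewrite oppr_le0 mulr_ge0 ?exprn_ge0 // ltW.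
have pos1 x : 0 < d 1%N x.
  by have := H 1%N ltac:(lia) isT 1%N isT ltac:(lia) x; rewrite -signr_odd expr0 mul1r.
apply: (@no_lower (d 0%N 1)).
  move=> x; have := H (2 * m).-1 ltac:(lia) ltac:(lia) _ (leqnn _) ltac:(lia) x.
  by rewrite e1 -signr_odd oddM expr0 mul1r.
exists 1 => // r r1.
have G t : 0 < t < r + 1 -> isd (d 0%N) t (d 1%N t) /\ 0 <= d 1%N t.
  by move=> _; split; [apply: hd; lia|exact: ltW].
by apply: (incr_oo G); lra.
Qed.

(** The reflected function [u (- x)] solves the same equation; the exponent [1] serves
    both ends. *)
Lemma line_decay m u : (1 <= m)%N -> odd m ->
  class_C (V := R^o) (2 * m) setT u ->
  (forall x : R, iter m (fun f s => - (f^`()^`())%classic s) u x = expR (u x)) ->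
  exists (C rbar : R) (K : nat), [/\ 0 < C, 0 < rbar, (0 < K)%N &
    forall x : R, rbar < `|x| -> u x < - C * `|x| ^+ K].
Proof.
move=> m1 om cu hu.
pose d i := iter i (fun h : R -> R => (h^`())%classic) u.
have hd i : (i < 2 * m)%N -> forall x, isd (d i) x (d i.+1 x) by exact: class_C_iter.
have top x : d (2 * m)%N x = - expR (u x).
  have := hu x; rewrite (iter_second (d := d) erefl hd (leqnn m)).
  by rewrite -signr_odd om expr1 mulN1r => <-; rewrite opprK.
have [c c0 hc] := half_line m1 hd top.
pose d' i x := (-1) ^+ i * d i (- x).
have hd' i : (i < 2 * m)%N -> forall x, isd (d' i) x (d' i.+1 x).
  move=> im x; apply: isd_eq (isdZ _ (isd_comp (hd i im (- x)) (isdN (isd_id x)))) _.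
  by rewrite /d' exprS; ring.
have top' x : d' (2 * m)%N x = - expR (d' 0%N x).
  by rewrite /d' -signr_odd oddM /= !expr0 !mul1r top.
have [c' c'0 hc'] := half_line m1 hd' top'.
have [r0 r00 H] := evI hc hc'.
exists (Num.min c c' / 2), r0, 1%N.
have mc : 0 < Num.min c c' by rewrite lt_min c0.
split => //; first lra.
move=> x xr; rewrite expr1; have x0 : 0 < `|x| by lra.
have m1c : Num.min c c' <= c by rewrite ge_min lexx.
have m2c : Num.min c c' <= c' by rewrite ge_min lexx orbT.
have [h1 h2] := H `|x| (ltW xr).
have : u x <= - Num.min c c' * `|x|.
  have [xp|xn] := leP 0 x.
    move: h1; rewrite [in d _ _]ger0_norm // => /le_trans; apply.
    by rewrite ler_pM2r //; lra.
  move: h2; rewrite /d' expr0 mul1r [in d _ _]ltr0_norm // opprK => /le_trans; apply.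
  by rewrite ler_pM2r //; lra.
have : 0 < Num.min c c' * `|x| by rewrite mulr_gt0.
lra.
Qed.

End Line.


(** * Even order: comparison and interior data *)

Section Even.
Variable R : realType.
Variable n : nat.
Hypothesis n1 : (1 <= n)%N.
Implicit Types (f g u : R -> R) (a b r : R).

(** A multiple of a chain of supersolutions dominates a chain as soon as it does so at the
    origin and at the top. *)
Lemma weight_sup m b w q al (psi psiq psig : nat -> R -> R) (p : nat -> R) (B : R) :
  0 <= B -> chain n m b w q al ->
  (forall k, (k < m)%N -> [/\ lap n 0 b (psi k) (psiq k) (psig k),
     psi k r @[r --> 0^'+] --> p k & psiq k r @[r --> 0^'+] --> (0 : R)]) ->
  (forall k r, (k.+1 < m)%N -> 0 < r < b -> psi k.+1 r <= psig k r) ->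
  (forall k, (k < m)%N -> al k <= B * p k) ->
  (forall r, 0 < r < b -> w m r <= B * psig m.-1 r) ->
  forall k r, (k < m)%N -> 0 < r < b -> w k r <= B * psi k r.
Proof.
move=> B0 hw hpsi hsup hal hm.
have step k : (k < m)%N -> (forall r, 0 < r < b -> w k.+1 r <= B * psig k r) ->
    forall r, 0 < r < b -> w k r <= B * psi k r.
  move=> km hk r rb; have [l1 l2 l3] := hw k km; have [p1 p2 p3] := hpsi k km.
  have r2 := rlimM (@rlim_cst R 0 B) p2; have r3 := rlimM (@rlim_cst R 0 B) p3.
  have [||| _ //] := lap_le n1 (lexx 0) l1 (lapZ B p1) l2 l3 r2 r3 _ _ _ rb.
  - exact: hal.
  - by rewrite mulr0.
  - exact: hk.
have H : forall k, (k <= m)%N -> (k < m)%N -> forall r, 0 < r < b -> w k r <= B * psi k r.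
  apply: down_ind; first by rewrite ltnn.
  move=> k km IH _; apply: step => // r rb.
  have [km1|] := ltnP k.+1 m.
    by apply: le_trans (IH km1 r rb) _; rewrite ler_wpM2l // hsup.
  move=> mk; have e : k.+1 = m by apply/eqP; rewrite eqn_leq km.
  by rewrite e -[k]/(k.+1.-1) e; exact: hm.
by move=> k r km; apply: H => //; exact: ltnW.
Qed.

(** A one-sided Gronwall inequality: only upper bounds for [w m] in terms of upper
    bounds for [w 0] are available, and the weights are adapted to the problem. *)
Lemma sup_gronwall m b c w q al (psi psiq psig : nat -> R -> R) (p : nat -> R)
    (eps p0 : R) : (0 < m)%N -> c < b -> 0 <= eps -> 0 < p0 ->
  chain n m b w q al ->
  (forall k, (k < m)%N -> [/\ lap n 0 c (psi k) (psiq k) (psig k),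
     psi k r @[r --> 0^'+] --> p k & psiq k r @[r --> 0^'+] --> (0 : R)]) ->
  (forall k r, (k.+1 < m)%N -> 0 < r < c -> psi k.+1 r <= psig k r) ->
  (forall k, (k < m)%N -> 0 <= p k /\ al k <= eps * p k) ->
  (forall r, 0 < r < c -> p0 <= psi 0%N r /\ 0 <= psig m.-1 r) ->
  (forall N, 0 <= N -> (forall r, 0 < r < c -> w 0%N r <= N * psi 0%N r) ->
     forall r, 0 < r < c -> w m r <= N / 2 * psig m.-1 r) ->
  forall r, 0 < r < c -> w 0%N r <= 2 * eps * psi 0%N r.
Proof.
move=> m0 cb e0 p00 h hpsi hsup hal hpos hm r0 r0c.
have [h1 h2 h3] := h 0%N m0.
have hc : chain n m c w q al by apply: chain_sub h => //; lra.
have [|N0 N00 hN0] := bounded_rlim h2 (b := c).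
  move=> r rc; apply: isd_cont (chain_isd h m0 _); lra.
have N1 : 0 <= N0 / p0 by rewrite divr_ge0 // ltW.
pose P N := forall r, 0 < r < c -> w 0%N r <= N * psi 0%N r.
have [psi0 _] := hpos r0 r0c.
suff H d : 0 < d -> w 0%N r0 <= (2 * eps + d) * psi 0%N r0.
  rewrite leNgt; apply/negP => lt.
  set x := w _ _ in lt H; set g := psi 0%N r0 in lt H psi0.
  have g0 : 0 < g by lra.
  have := H ((x / g - 2 * eps) / 2); rewrite divr_gt0 //; last first.
    by rewrite subr_gt0 ltr_pdivlMr.
  move=> /(_ isT) h'.
  have e1 : x / g * g = x by rewrite divfK // gt_eqF.
  nra.
move=> d_gt0.
apply: (@contract_bound R P eps (N0 / p0) e0 N1 _ _ _ d d_gt0 r0 r0c).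
- move=> r rc; have := hN0 r; have [|h0 _] := hpos r; first by [].
  move=> /(_ ltac:(lra)) hr; apply: le_trans (le_trans (ler_norm _) hr) _.
  by rewrite mulrAC ler_pdivlMr // ler_wpM2l.
- move=> x y xy Px r rc; apply: le_trans (Px r rc) _.
  by rewrite ler_wpM2r //; have [] := hpos r rc; lra.
- move=> N N_ge0 PN r rc.
  have hB : 0 <= N / 2 + eps by rewrite addr_ge0 // divr_ge0.
  apply: (weight_sup hB hc hpsi hsup) => //.
  + move=> k km; have [pk ak] := hal k km; apply: le_trans ak _.
    by rewrite ler_wpM2r // lerDr divr_ge0.
  + move=> s sc; apply: le_trans (hm N N_ge0 PN s sc) _.
    by rewrite ler_wpM2r ?lerDl //; have [] := hpos s sc.
Qed.

(** For even [m] the right-hand side increases with [u], so [w m - w' m] is at most a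
    constant times the positive part of [w 0 - w' 0]. *)
Lemma even_compare m b (w q : nat -> R -> R) al w' q' al' : (0 < m)%N ->
  chain n m b w q al -> chain n m b w' q' al' ->
  (forall k, (k < m)%N -> al k <= al' k) ->
  (forall r, 0 < r < b -> w m r = expR (w 0%N r) /\ w' m r = expR (w' 0%N r)) ->
  forall r, 0 < r < b -> w 0%N r <= w' 0%N r.
Proof.
move=> m0 h h' hal hm r rb.
pose c := (r + b) / 2.
have bd w0 q0 al0 : chain n m b w0 q0 al0 -> exists2 N : R, 0 <= N &
    forall s, 0 < s <= c -> `|w0 0%N s| <= N.
  move=> h0; have [_ h2 _] := h0 0%N m0; apply: bounded_rlim h2 _ => s sc.
  by apply: isd_cont (chain_isd h0 m0 _); rewrite /c in sc; lra.
have [N1 N10 hN1] := bd _ _ _ h; have [N2 N20 hN2] := bd _ _ _ h'.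
pose K := expR (N1 + N2); have K0 : 0 < K by exact: expR_gt0.
pose lam := 1 + K.
have g0 s : 0 < gauss lam s by exact: gauss_gt0.
have nlam : 2 * lam <= 2 * n%:R * lam.
  have : (1 : R) <= n%:R by rewrite ler1n.
  by rewrite /lam; nra.
pose gg s := (2 * n%:R * lam + 4 * lam ^+ 2 * s ^+ 2) * gauss lam s.
have gge s : 2 * lam * gauss lam s <= gg s.
  rewrite /gg ler_pM2r //; have : 0 <= 4 * (lam * s) ^+ 2 by rewrite mulr_ge0 // sqr_ge0.
  by rewrite exprMn; lra.
have := @sup_gronwall m b c _ _ _ (fun=> gauss lam)
   (fun _ s => 2 * lam * s * gauss lam s) (fun=> gg) (fun=> 1) 0 1 m0 _ (lexx _) ltr01
   (chainB h h').
move=> /(_ _ _ _ _ _ _ r)H.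
rewrite -subr_le0; have -> : 0 = 2 * 0 * gauss lam r by rewrite mulr0 mul0r.
apply: H.
- by rewrite /c; lra.
- move=> k km; split; [exact: gauss_lap|exact: gauss_rlim|exact: gauss_q_rlim].
- move=> k s _ sc; apply: le_trans (gge s); rewrite ler_peMl ?(ltW (g0 s)) //.
  by rewrite /lam; lra.
- by move=> k km; split=> //; rewrite mul0r subr_le0; exact: hal.
- move=> s sc; split; last by apply: le_trans (gge s); rewrite !mulr_ge0 ?(ltW (g0 s)) // /lam; lra.
  by rewrite -expR0 ler_expR mulr_ge0 ?sqr_ge0 // /lam; lra.
- move=> N N0 hN s sc; have [|-> ->] := hm s; first by rewrite /c in sc; lra.
  have := hN s sc; set x := w 0%N s; set y := w' 0%N s => xy.
  have xN := le_trans (ler_norm _) (hN1 s ltac:(lra)).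
  have yN := le_trans (ler_norm _) (hN2 s ltac:(lra)).
  have N2g : 0 <= N / 2 by rewrite divr_ge0.
  apply: le_trans (_ : K * (N * gauss lam s) <= _); last first.
    have -> : K * (N * gauss lam s) = N / 2 * (2 * K * gauss lam s) by field.
    rewrite ler_wpM2l //; apply: le_trans (gge s); rewrite ler_pM2r // /lam; lra.
  have [lxy|lyx] := leP x y.
    apply: le_trans (_ : 0 <= _); first by rewrite subr_le0 ler_expR.
    by rewrite !mulr_ge0 // ltW.
  apply: le_trans (ler_norm _) (le_trans (@expR_lip R (N1 + N2) _ _ _ _) _); try (rewrite -/x -/y in xN yN; lra).
  by rewrite ler_pM2l // ger0_norm //; lra.
- by rewrite /c; lra.
Qed.

Lemma chain_asymp k (w q : nat -> R -> R) al (l : R) : (forall b, chain n k b w q al) ->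
  (forall eta : R, 0 < eta -> ev (fun r => `|w k r - l| <= eta)) ->
  forall eta : R, 0 < eta ->
    ev (fun r => `|w 0%N r - l * coef R n k * r ^+ (2 * k)| <= eta * r ^+ (2 * k)).
Proof.
move=> h hl eta eta0.
have ck : 0 < coef R n k by exact: coef_gt0.
have eta2 : 0 < eta / 2 by lra.
have e0 : 0 < eta / 2 / coef R n k by rewrite divr_gt0.
have h1 := hl _ e0.
have up : ev (fun r => w k r <= l + eta / 2 / coef R n k).
  by apply: ev_imp h1 => r _; rewrite ler_norml; lra.
have lo : ev (fun r => - w k r <= - l + eta / 2 / coef R n k).
  by apply: ev_imp h1 => r _; rewrite ler_norml; lra.
have hN b : chain n k b _ _ _ := chainN (h b).
apply: ev_imp (evI (chain_growth n1 h up eta2) (chain_growth n1 hN lo eta2)) => r r0.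
rewrite !mulrDl !divfK ?gt_eqF //.
set X := r ^+ _; set c := coef _ _ _; move=> [a1 a2].
by rewrite ler_norml; lra.
Qed.

Lemma ev_pinfty (P : R -> Prop) : ev P -> \forall r \near +oo, P r.
Proof.
move=> [r0 r00 h]; exists r0; split; first exact: num_real.
by move=> r rr; apply: h; exact: ltW.
Qed.

Lemma ball_rV m (x y : 'rV[R]_m) (e : R) : 0 < e ->
  ball x e y <-> forall i, `|x 0 i - y 0 i| < e.
Proof.
move=> e0; split=> [[_ h] i|h]; first exact: h ord0 i.
by split=> // i j; rewrite (ord1 i); exact: h.
Qed.

Section EvenSolution.
Variables (m : nat) (alpha : R).
Hypothesis m2 : (2 <= m)%N.
Hypothesis em : ~~ odd m.

Let m0 : (0 < m)%N. Proof. exact: leq_trans m2. Qed.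

Lemma even_chain (beta : 'rV[R]_m.-1) u : radial_solution n m alpha beta +oo%E u ->
  exists w q : nat -> R -> R, [/\ w 0%N = u,
    forall b, chain n m b w q (data alpha beta),
    forall r, 0 < r -> w m r = expR (w 0%N r) &
    forall r, 0 < r -> w m.-1 r < 0].
Proof.
move=> su; have [hw hm] := global_chain n1 su.
exists (fun k => iter k (rlap n) u), (fun k => ((iter k (rlap n) u)^`())%classic).
split => //.
  by move=> r r0; rewrite hm // -signr_odd (negbTE em) expr0 mul1r.
move=> r r0; have := even_sgn n1 m0 hw hm m2 em r0.
rewrite /altern -signr_odd (_ : odd m.-1) ?expr1 ?mulN1r ?oppr_gt0 //.
by move: em; rewrite -{1}(prednK m0) /= negbK.
Qed.

Lemma top_incr (w q : nat -> R -> R) al : (forall b, chain n m b w q al) ->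
  (forall r, 0 < r -> w m r = expR (w 0%N r)) ->
  forall r s, 0 < r -> r <= s -> w m.-1 r <= w m.-1 s.
Proof.
move=> hw hm r s r0 rs.
have [|h1 h2 h3] := hw (s + 1) m.-1; first by rewrite prednK.
rewrite prednK // in h1.
have G x : 0 < x < s + 1 -> isd (w m.-1) x (q m.-1 x) /\ 0 <= q m.-1 x.
  move=> xs; split; first by have [] := h1 x xs.
  have [|//] := lap_ge0 n1 (lexx 0) h1 h2 h3 (lexx 0) _ xs.
  by move=> y ys; rewrite hm ?expR_ge0 //; lra.
by apply: (incr_oo G); lra.
Qed.

Lemma data_ge (beta beta' : 'rV[R]_m.-1) :
  (forall i, beta 0 i <= beta' 0 i) ->
  forall k, data alpha beta k <= data alpha beta' k.
Proof.
by move=> h [|k] //=; case: insubP => // i _ _; exact: h.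
Qed.

(** Raising all data by [d / 2] keeps them global. The raised solution has a negative last
    Laplacian, which exceeds that of [u] by at least [d / 2]; so the increasing
    function [w (m - 1)] has a negative limit. *)
Lemma even_interior (beta : 'rV[R]_m.-1) T u :
  interior (global_data n m alpha) beta ->
  maximal_solution n m alpha beta T u ->
  T = +oo%E /\
  exists C : R, 0 < C /\
    u r / (- C * r ^+ (2 * m - 2)) @[r --> +oo] --> (1 : R).
Proof.
move=> hint mu.
have [v [sv _]] : global_data n m alpha beta by exact: interior_subset hint.
have TE := maximal_global n1 m0 mu sv; split => //.
have su : radial_solution n m alpha beta +oo%E u by rewrite -TE; case: mu.
have [w [q [w0 hw hm neg]]] := even_chain su.
have [d d0 hd] : exists2 d : R, 0 < d & forall b' : 'rV[R]_m.-1, ball beta d b' -> global_data n m alpha b'.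
  by case/nbhs_ballP: hint => d d0 hd; exists d.
pose beta' : 'rV[R]_m.-1 := \row_i (beta 0 i + d / 2).
have [u' [su' _]] : global_data n m alpha beta'.
  apply: hd; apply/ball_rV => // i; rewrite !mxE opprD addrA subrr sub0r normrN.
  by rewrite gtr0_norm; lra.
have [w' [q' [w0' hw' hm' neg']]] := even_chain su'.
have hal k : data alpha beta k <= data alpha beta' k.
  by apply: data_ge => i; rewrite mxE; lra.
have cmp r : 0 < r -> w m.-1 r <= - (d / 2).
  move=> r0; have rr : 0 < r < r + 1 by lra.
  have [|||_] := chain_ge0 n1 (chainB (hw' (r + 1)) (hw (r + 1))) _ _ (k := m.-1) _ rr.
  - by move=> k _; rewrite subr_ge0.
  - move=> s s1; rewrite subr_ge0 hm ?hm' ?ler_expR; try lra.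
    apply: (even_compare m0 (hw (r + 1)) (hw' (r + 1))) => // t t1.
    by rewrite hm ?hm' //; lra.
  - by rewrite prednK.
  have -> : data alpha beta' m.-1 - data alpha beta m.-1 = d / 2.
    have h : (m.-2 < m.-1)%N by case: (m) m2 => [|[]].
    have e : m.-1 = (Ordinal h).+1 by rewrite /= prednK // -ltnS prednK.
    by rewrite e !data_ord mxE addrAC subrr add0r.
  by have := neg' r r0; lra.
pose S := [set y | exists2 r : R, 0 < r & y = w m.-1 r].
pose l := sup S.
have Sub : has_ubound S by exists (- (d / 2)) => _ [r r0 ->]; exact: cmp.
have S1 : S (w m.-1 1) by exists 1.
have l0 : l <= - (d / 2) by apply: ge_sup; [exists (w m.-1 1)|move=> _ [r r0 ->]; exact: cmp].
have hl (eta : R) : 0 < eta -> ev (fun r => `|w m.-1 r - l| <= eta).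
  move=> eta0; have [_ [r r0 ->] lr] : exists2 y, S y & l - eta < y.
    by apply: sup_adherent => //; split => //; exists (w m.-1 1).
  exists r => // s rs; have s0 : 0 < s by lra.
  have := top_incr hw hm r0 rs; have : w m.-1 s <= l by apply: ub_le_sup => //; exists s.
  by rewrite ler_norml; lra.
have hk b : chain n m.-1 b w q _ := chain_sub (leq_pred m) (lexx b) (hw b).
have A := chain_asymp hk hl.
have ck : 0 < coef R n m.-1 by exact: coef_gt0.
pose C := - l * coef R n m.-1; have C0 : 0 < C by rewrite mulr_gt0 //; lra.
exists C; split => //; apply/cvgrPdist_lt => e e0.
have eC : 0 < e * C / 2 by rewrite divr_gt0 // mulr_gt0.
apply: ev_pinfty; apply: ev_imp (evI (ev_ge 1) (A _ eC)) => r _ [].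
have -> : (2 * m - 2 = 2 * m.-1)%N by lia.
move=> r1; set X := r ^+ _; have X0 : 0 < X by rewrite exprn_gt0 //; lra.
rewrite w0 => h.
have -> : 1 - u r / (- C * X) = (u r - - C * X) / (C * X).
  by field; rewrite !gt_eqF.
rewrite normrM normfV (gtr0_norm (mulr_gt0 C0 X0)) ltr_pdivrMr ?(mulr_gt0 C0 X0) //.
apply: le_lt_trans (_ : e * C / 2 * X < _); last first.
  have := mulr_gt0 (mulr_gt0 e0 C0) X0.
  lra.
have -> : u r - - C * X = u r - l * coef R n m.-1 * X by rewrite /C; ring.
exact: h.
Qed.

End EvenSolution.

End Even.


(** * Even order: the logarithmic bound *)

Section LogDecay.
Variable R : realType.
Variable n : nat.
Hypothesis n1 : (1 <= n)%N.

(** As [w 0] decreases, [altern w m] is at least [exp (w 0 r)] up to radius [r]. Each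
    inversion of the Laplacian halves the radius and gains a factor [c r^2]: the
    positivity of [altern w k] turns its drop between two radii into a lower bound. *)
Lemma positive_drop m (w q : nat -> R -> R) al : (0 < m)%N ->
  (forall b, chain n m b w q al) -> (forall r, 0 < r -> w m r = (-1) ^+ m * expR (w 0%N r)) ->
  (forall k r, (0 < k)%N -> (k <= m)%N -> 0 < r -> 0 < altern w k r) ->
  (forall r s, 0 < r -> r <= s -> w 0%N s <= w 0%N r) /\
  exists2 c : R, 0 < c & forall r, 0 < r ->
    c * (expR (w 0%N r) * r ^+ (2 * m)) <= w 0%N (r / 2 ^+ m) - w 0%N r.
Proof.
move=> m0 hw hm pos.
have decr k r s : (k < m)%N -> 0 < r -> r <= s -> altern w k s <= altern w k r.
  move=> km r0; rewrite le_eqVlt => /predU1P[->//|rs].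
  by apply/ltW/(sgn_mono n1 hw km) => // t t0; apply: pos.
have decr0 r s : 0 < r -> r <= s -> w 0%N s <= w 0%N r.
  by move=> r0 rs; have := decr 0%N r s m0 r0 rs; rewrite /altern expr0 !mul1r.
split => //.
have n0 : 0 < n%:R :> R by rewrite ltr0n.
pose gam : R := 5 / (32 * n%:R).
have gam0 : 0 < gam by rewrite divr_gt0 // mulr_gt0.
(* one inversion on [(0, rho)], comparing the radii [rho / 2] and [3 rho / 4]; the
   constant is [((3/4)^2 - (1/2)^2) / (2 n)] *)
have step k rho (B : R) : (k < m)%N -> 0 < rho -> 0 <= B ->
    (forall x, 0 < x < rho -> B <= altern w k.+1 x) ->
    gam * (B * rho ^+ 2) <= altern w k (rho / 2) - altern w k (rho * 3 / 4).
  move=> km rho0 B0 hB; have [_ h2 h3] := hw rho k km.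
  pose F x := - altern w k x - B / (2 * n%:R) * x ^+ 2.
  have L : lap n 0 rho (fun x => B / (2 * n%:R) * x ^+ 2)
      (fun x => B / (2 * n%:R) * (2 * x)) (fun=> B).
    move=> x xr; split.
      by apply: isd_eq (isdZ _ (isd_pow x 2)) _; rewrite expr1.
    apply: isd_eq (isdZ (B / (2 * n%:R)) (isdZ 2 (isd_id x))) _.
    by field; rewrite !gt_eqF //; lra.
  have l1 : - altern w k r @[r --> 0^'+] --> - ((-1) ^+ k * al k).
    exact: rlimN (rlimM (@rlim_cst R 0 _) h2).
  have l2 : - ((-1) ^+ k * q k r) @[r --> 0^'+] --> - ((-1) ^+ k * 0 : R).
    exact: rlimN (rlimM (@rlim_cst R 0 _) h3).
  have p1 := cont_rlim (isd_cont (isdZ (B / (2 * n%:R)) (isd_pow (0 : R) 2))).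
  have p2 := cont_rlim (isd_cont (isdZ (B / (2 * n%:R)) (isdZ 2 (isd_id (0 : R))))).
  have G x : 0 < x < rho ->
      isd F x (- ((-1) ^+ k * q k x) - B / (2 * n%:R) * (2 * x)) /\
      0 <= - ((-1) ^+ k * q k x) - B / (2 * n%:R) * (2 * x).
    move=> xr; have D := lapB (lap_sgn hw km (b := rho)) L.
    split; first by have [] := D x xr.
    have [||//] := lap_ge0 n1 (lexx 0) D (rlimB l1 p1) (rlimB l2 p2) _ _ xr.
      by rewrite !mulr0 oppr0 addr0.
    by move=> y yr; rewrite subr_ge0; exact: hB.
  have := incr_oo G (r := rho / 2) (s := rho * 3 / 4).
  move=> /(_ ltac:(lra) ltac:(lra) ltac:(lra)); rewrite /F => H.
  have : gam * (B * rho ^+ 2) = B / (2 * n%:R) * (rho * 3 / 4) ^+ 2 - B / (2 * n%:R) * (rho / 2) ^+ 2.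
    by rewrite /gam; field; rewrite gt_eqF.
  lra.
have H : forall k, (k <= m)%N -> (0 < k)%N -> exists2 c : R, 0 < c &
    forall r x, 0 < r -> 0 < x -> x <= r / 2 ^+ (m - k) ->
      c * (expR (w 0%N r) * r ^+ (2 * (m - k))) <= altern w k x.
  apply: down_ind.
    move=> _; exists 1 => // r x r0 x0; rewrite subnn expr0 divr1 expr0 mulr1 mul1r => xr.
    rewrite /altern hm // mulrA -exprMn mulrNN mulr1 expr1n mul1r ler_expR.
    exact: decr0.
  move=> k km IH k0; have [c c0 hc] := IH isT.
  have e : (m - k)%N = (m - k.+1).+1 by rewrite subnSK.
  set j := (m - k.+1)%N in e hc.
  have pj : 0 < (2 : R) ^+ j by rewrite exprn_gt0.
  exists (gam * c / (2 ^+ j) ^+ 2); first by rewrite divr_gt0 ?exprn_gt0 // mulr_gt0.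
  move=> r x r0 x0; rewrite e => xr.
  pose rho := r / 2 ^+ j; have rho0 : 0 < rho by rewrite divr_gt0.
  have B0 : 0 <= c * (expR (w 0%N r) * r ^+ (2 * j)).
    by rewrite !mulr_ge0 ?expR_ge0 ?exprn_ge0 // ltW.
  have S := step k rho _ km rho0 B0 (fun y yr => hc r y r0 ltac:(lra) ltac:(rewrite -/rho; lra)).
  have := decr k x (rho / 2) km x0; move: xr; rewrite exprS invfM mulrCA mulrC -/rho => xr /(_ xr).
  have := pos k (rho * 3 / 4) k0 (ltnW km) ltac:(lra).
  have -> : gam * c / (2 ^+ j) ^+ 2 * (expR (w 0%N r) * r ^+ (2 * j.+1)) =
      gam * (c * (expR (w 0%N r) * r ^+ (2 * j)) * rho ^+ 2).
    by rewrite mulnS exprD /rho; field; rewrite gt_eqF.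
  lra.
have [c c0 hc] := H 1%N m0 isT.
set j := (m - 1)%N in hc; have mj : m = j.+1 by rewrite /j subn1 prednK.
have pj : 0 < (2 : R) ^+ j by rewrite exprn_gt0.
exists (gam * c / (2 ^+ j) ^+ 2); first by rewrite divr_gt0 ?exprn_gt0 // mulr_gt0.
move=> r r0; pose rho := r / 2 ^+ j; have rho0 : 0 < rho by rewrite divr_gt0.
have B0 : 0 <= c * (expR (w 0%N r) * r ^+ (2 * j)).
  by rewrite !mulr_ge0 ?expR_ge0 ?exprn_ge0 // ltW.
have := step 0%N rho _ m0 rho0 B0 (fun y yr => hc r y r0 ltac:(lra) ltac:(rewrite -/rho; lra)).
rewrite /altern expr0 !mul1r.
have -> : gam * c / (2 ^+ j) ^+ 2 * (expR (w 0%N r) * r ^+ (2 * m)) =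
    gam * (c * (expR (w 0%N r) * r ^+ (2 * j)) * rho ^+ 2).
  by rewrite mj mulnS exprD /rho; field; rewrite gt_eqF.
have -> : r / 2 ^+ m = rho / 2 by rewrite mj exprS invfM /rho mulrA mulrAC.
have rr : rho <= r.
  by rewrite /rho ler_pdivrMr // ler_peMr ?(ltW r0) // exprn_ege1 // ler1n.
have := decr0 (rho * 3 / 4) r ltac:(lra) ltac:(lra).
lra.
Qed.

(** Put [theta r = u r + 2 m ln r] and [A = 2^m]. If [theta <= B0] at [r / A] but
    [theta r > B0], then [u] drops by less than [2 m ln A] from [r / A] to [r], while
    it must drop by at least [c exp (theta r) > c exp B0]. So a large [B0] is
    preserved from one scale to the next. *)
Lemma log_bound m (u : R -> R) (c : R) : (0 < m)%N -> 0 < c ->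
  (forall r s, 0 < r -> r <= s -> u s <= u r) ->
  (forall r, 0 < r -> c * (expR (u r) * r ^+ (2 * m)) <= u (r / 2 ^+ m) - u r) ->
  exists B0 : R, forall r, 1 <= r -> u r + (2 * m)%:R * ln r <= B0.
Proof.
move=> m0 c0 decr drop; pose A : R := 2 ^+ m.
have A2 : 2 <= A by rewrite /A -[leLHS]expr1 ler_weXn2l // ler1n.
have lA : 0 <= ln A by rewrite ln_ge0 //; lra.
set M : R := (2 * m)%:R; have M0 : 0 <= M by exact: ler0n.
have MA : 0 <= M * ln A by rewrite mulr_ge0.
have MAc : 0 <= M * ln A / c by rewrite divr_ge0 // ltW.
pose B0 := `|u 1| + M * ln A + M * ln A / c.
exists B0.
suff H j r : 1 <= r -> r <= A ^+ j -> u r + M * ln r <= B0.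
  move=> r r1; have := truncnS_gt r; set N := _.+1 => rN.
  apply: (H N) => //; apply: le_trans (ltW rN) _.
  apply: le_trans (_ : 2 ^+ N <= _); first by rewrite -natrX ler_nat ltnW // ltn_expl.
  by rewrite lerXn2r // nnegrE; lra.
elim: j r => [|j IH] r r1.
  rewrite expr0 => r1'; have -> : r = 1 by lra.
  rewrite ln1 mulr0 addr0 /B0; have := ler_norm (u 1); lra.
move=> rA; have [rA1|rA1] := leP r A.
  have := decr 1 r ltr01 r1; have := ler_norm (u 1).
  have : M * ln r <= M * ln A by rewrite ler_wpM2l // ler_ln ?posrE //; lra.
  by rewrite /B0; lra.
rewrite leNgt; apply/negP => lt.
have A0 : 0 < A by lra.
have r0 : 0 < r by lra.
have := IH (r / A).
rewrite ler_pdivlMr // mul1r (ltW rA1) ler_pdivrMr // -exprSr => /(_ isT rA).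
rewrite ln_div ?posrE // => h1.
have := drop r r0; rewrite -/A.
have -> : expR (u r) * r ^+ (2 * m) = expR (u r + M * ln r).
  by rewrite expRD (mulrC M) expRM_natr lnK.
have e1 := expR_ge1Dx (u r + M * ln r).
move=> h2.
have h3 : c * (1 + (u r + M * ln r)) <= M * ln A.
  have : c * (1 + (u r + M * ln r)) <= c * expR (u r + M * ln r) by rewrite ler_pM2l.
  lra.
have : M * ln A < c * (1 + (u r + M * ln r)).
  have e : M * ln A = c * (M * ln A / c) by field; rewrite gt_eqF.
  rewrite e ltr_pM2l //; have := normr_ge0 (u 1); rewrite /B0 in lt; lra.
lra.
Qed.

End LogDecay.

Section EvenBoundary.
Variable R : realType.
Variable n : nat.
Hypothesis n1 : (1 <= n)%N.
Variables (m : nat) (alpha : R).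
Hypothesis m2 : (2 <= m)%N.
Hypothesis em : ~~ odd m.

Let m0 : (0 < m)%N. Proof. exact: leq_trans m2. Qed.

(** Outside the positive alternative [u] is even below [- c r^(2 k)]. *)
Lemma even_log_decay (beta : 'rV[R]_m.-1) u :
  radial_solution n m alpha beta +oo%E u ->
  exists C rbar : R, [/\ 0 < C, 0 < rbar &
    forall r : R, rbar < r -> u r < - (2 * m)%:R * ln r + C].
Proof.
move=> su; have [hw hm] := global_chain n1 su.
set M : R := (2 * m)%:R; have M0 : 0 <= M by exact: ler0n.
have [pos|[k [c [k2 ek c0 [r0 r00 H]]]]] := dichotomy n1 m0 hw hm.
  have [decr [c c0 drop]] := positive_drop n1 m0 hw hm pos.
  have [B0 hB] := log_bound m0 c0 decr drop.
  exists (`|B0| + 1), 1; split => [|//|r r1]; first by rewrite ltr_wpDl.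
  have := hB r (ltW r1); have := ler_norm B0.
  by rewrite -/M /= mulNr; lra.
exists (M ^+ 2 / c + 1), (Num.max r0 1); split.
- by rewrite ltr_wpDl // divr_ge0 ?sqr_ge0 // ltW.
- by rewrite lt_max r00.
move=> r; rewrite gt_max => /andP[rr r1].
apply: le_lt_trans (H r (ltW rr)) _.
have r_gt0 : 0 < r by lra.
have l1 : M * ln r <= M * r by rewrite ler_wpM2l // ltW // ln_sublinear.
have l2 : c * r ^+ 2 <= c * r ^+ (2 * k).
  by rewrite ler_pM2l // ler_weXn2l ?(ltW r1) // leq_pmulr // (leq_trans _ k2).
have l3 : M * r <= c * r ^+ 2 + M ^+ 2 / c.
  rewrite -(ler_pM2l c0) mulrDr (mulrC c (_ / c)) divfK ?gt_eqF //.
  have := sqr_ge0 (c * r - M); have := sqr_ge0 (c * r); have := sqr_ge0 M.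
  rewrite !expr2; nra.
rewrite !mulNr; lra.
Qed.

Lemma trunc_radial (beta : 'rV[R]_m.-1) (M : R -> R) (w : nat -> R -> R) :
  (forall b, chain n m b w (fun k r => r * avg n (w k.+1) r) (data alpha beta)) ->
  (forall k, cont0 (w k)) -> w 0%N 0 = alpha ->
  (forall r, 0 <= r -> w m r = 1 * expR (Num.min (w 0%N r) (M r))) ->
  (forall r, 0 <= r -> w 0%N r <= M r) ->
  radial_solution n m alpha beta +oo%E (w 0%N).
Proof.
move=> hw cw w0 hm hM; apply: chain_radial => // r r0.
rewrite hm // -signr_odd (negbTE em) expr0; congr (_ * expR _).
by apply/min_idPl; exact: hM.
Qed.

(** Global solutions with nearby data lie below a common polynomial, because
    the last iterated Laplacian is negative; truncating there, the limit
    data also gives a global solution. *)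
Lemma even_closed (beta : 'rV[R]_m.-1) : closure (global_data n m alpha) beta ->
  exists v, radial_solution n m alpha beta +oo%E v.
Proof.
move=> hcl.
pose aM k := `|data alpha beta k| + 1.
pose M := chaininv n m.-1 aM (fun=> 0).
have m1 : (0 < m.-1)%N by rewrite -ltnS prednK.
have cz : cont0 (fun _ : R => 0 : R) by exact: cont0_cst.
have cM k : cont0 (M k) by exact: chaininv_cont0.
have hM b : chain n m.-1 b M (fun k r => r * avg n (M k.+1) r) aM by exact: chaininv_chain.
have [w [hw cw w0 hm]] := @trunc_exists R n n1 m (data alpha beta) 1 (M 0%N) m0 (cM 0%N).
exists (w 0%N); apply: (trunc_radial hw cw w0 hm) => r r0.
have M00 : M 0%N 0 = aM 0%N by rewrite /M chaininvE // lapinv0.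
have /predU1P[<-|{}r0] : (0 == r) || (0 < r) by rewrite -le_eqVlt.
  by rewrite w0 M00 /aM /=; have := ler_norm alpha; lra.
have [N N0 hN] := @cont0_bounded R (M 0%N) (r + 1) (cM 0%N).
pose g := gauss (1 + expR N) r; have g0 : 0 < g by exact: gauss_gt0.
suff H d : 0 < d -> d <= 1 -> w 0%N r <= M 0%N r + 2 * d * g.
  rewrite leNgt; apply/negP => lt.
  pose x := w 0%N r - M 0%N r; have x0 : 0 < x by rewrite /x; lra.
  pose d := Num.min 1 (x / (4 * g)).
  have d0 : 0 < d by rewrite /d lt_min ltr01 divr_gt0 // mulr_gt0.
  have d1 : d <= 1 by rewrite ge_min lexx.
  have d2 : d <= x / (4 * g) by rewrite ge_min lexx orbT.
  have := H d d0 d1; move: d2; rewrite ler_pdivlMr ?mulr_gt0 // /x => d2; lra.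
move=> d0 d1.
have [b' [[u' [su' _]] hb']] : exists b' : 'rV[R]_m.-1, global_data n m alpha b' /\ ball beta d b'.
  by apply: hcl; exact: nbhsx_ballx.
have [w' [q' [w0' hw' hm' neg']]] := even_chain n1 m2 em su'.
have hal k : `|data alpha beta k - data alpha b' k| <= d.
  case: k => [|k] /=; first by rewrite subrr normr0 ltW.
  case: insubP => [i _ _|_]; last by rewrite subrr normr0 ltW.
  by apply/ltW; exact: (ball_rV _ _ d0).1 hb' i.
have below s : 0 < s -> w' 0%N s <= M 0%N s.
  move=> s0; have rs : 0 < s < s + 1 by lra.
  apply: (chain_le n1 (chain_sub (leq_pred m) (lexx (s + 1)) (hw' (s + 1))) (hM (s + 1))) => //.
    move=> k _; have := hal k; rewrite /aM ler_norml; have := ler_norm (data alpha beta k).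
    lra.
  by move=> t t0; rewrite /M chaininv_top ltW // neg' //; lra.
have := @chain_gronwall R n n1 m (r + 2) (r + 1) _ _ _ (expR N) d m0 _ (expR_ge0 _) (ltW d0)
  (chainB (hw (r + 2)) (hw' (r + 2))) (fun k _ => hal k) _ r.
rewrite -/g => G; have := below r r0.
suff : `|w 0%N r - w' 0%N r| <= 2 * d * g by rewrite ler_norml; lra.
apply: G; [lra| |lra] => s sr.
rewrite hm ?hm'; try lra.
rewrite mul1r -[in X in `|_ - X|](min_idPl (below s _)); last by lra.
apply: le_trans (expR_lip_min _ _ _) _; rewrite ler_wpM2r // ler_expR.
by have := hN s ltac:(lra); rewrite ler_norml; lra.
Qed.

End EvenBoundary.


(** * Even order: boundary data *)

Section Stability.
Variable R : realType.
Variable n : nat.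
Hypothesis n1 : (1 <= n)%N.
Implicit Types (f g : R -> R) (a b r : R).

Lemma lap_expM a b f q g z zq zg : lap n a b f q g -> lap n a b z zq zg ->
  lap n a b (fun r => expR (z r) * f r) (fun r => expR (z r) * (zq r * f r + q r))
    (fun r => expR (z r) * ((zq r ^+ 2 + zg r) * f r + 2 * zq r * q r + g r)).
Proof.
move=> hf hz r rb; have [f1 f2] := hf r rb; have [z1 z2] := hz r rb.
have e1 := isd_exp z1; split.
  by apply: isd_eq (isdM e1 f1) _; ring.
by apply: isd_eq (isdM e1 (isdD (isdM z2 f1) f2)) _; ring.
Qed.

(** A bounded function whose Laplacian, in dimension at least 3, is bounded below by
    [3 / (1 + r)^4]; the exponent of a bounded weight. *)
Definition bump r : R := 2^-1 * (r * (1 + r)^-1) ^+ 2.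
(** The first derivative and the Laplacian of [bump]. *)
Definition bumpq r : R := r * (1 + r)^-1 ^+ 3.
Definition bumpg r : R :=
  (1 - 2 * r) * (1 + r)^-1 ^+ 4 + (n%:R - 1) * (1 + r)^-1 ^+ 3.

Lemma bump_isd r : 0 <= r -> isd bump r (bumpq r) /\
  isd bumpq r ((1 - 2 * r) * (1 + r)^-1 ^+ 4).
Proof.
move=> r0; have r1 : 1 + r != 0 by apply/eqP; lra.
have i1 : isd (fun r : R => (1 + r)^-1) r (- (1 + r)^-1 ^+ 2).
  apply: isd_eq (@isdV _ (fun r : R => 1 + r) r _ r1 (isdD (isd_cst r 1) (isd_id r))) _.
  by rewrite exprVn add0r mulN1r.
split.
  apply: isd_eq (isdZ 2^-1 (isdX 2 (isdM (isd_id r) i1))) _.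
  by rewrite /bumpq; field.
apply: isd_eq (isdM (isd_id r) (isdX 3 i1)) _ => /=.
by field.
Qed.

Lemma bump_lap b : lap n 0 b bump bumpq bumpg.
Proof.
move=> r /andP[r0 rb]; have [h1 h2] := bump_isd (ltW r0).
split => //; apply: isd_eq h2 _.
by rewrite /bumpg /bumpq; field; apply/andP; split; apply/eqP; lra.
Qed.

Lemma bumpg_ge r : (3 <= n)%N -> 0 < r -> 3 * (1 + r)^-1 ^+ 4 <= bumpg r.
Proof.
move=> n3 r0; rewrite /bumpg; set y := (1 + r)^-1.
have y0 : 0 < y by rewrite invr_gt0; lra.
have e : y ^+ 3 = (1 + r) * y ^+ 4.
  have yy : (1 + r) * y = 1 by rewrite mulfV //; apply/eqP; lra.
  by rewrite (exprS y 3) mulrA yy mul1r.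
rewrite e; have y4 : 0 < y ^+ 4 by rewrite exprn_gt0.
have : 3 <= n%:R :> R by rewrite ler_nat.
set N : R := n%:R => N3; rewrite [X in _ + X]mulrA -mulrDl ler_pM2r //; nra.
Qed.

Lemma bump_ge0 r : 0 <= bump r.
Proof. by rewrite /bump mulr_ge0 // sqr_ge0. Qed.

Lemma bump_le r : 0 < r -> bump r <= 1.
Proof.
move=> r0; have h : r * (1 + r)^-1 <= 1 by rewrite ler_pdivrMr; lra.
have h0 : 0 <= r * (1 + r)^-1 by rewrite divr_ge0; lra.
have : (r * (1 + r)^-1) ^+ 2 <= 1 by rewrite exprn_ile1.
by rewrite /bump; lra.
Qed.

(** With [x = r^(2k)] one has [(1 + r)^4 <= 16 x^2] for [r >= 1], and
    [x^3 exp (- c x) <= 6 / c^3]. *)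
Lemma exp_decay_bound k (M Y : R -> R) (c CY : R) : (0 < k)%N -> 0 < c -> 0 < CY ->
  cont0 M -> cont0 Y -> (forall r, 0 < r -> 0 <= Y r) ->
  ev (fun r => M r <= - c * r ^+ (2 * k)) -> ev (fun r => Y r <= CY * r ^+ (2 * k)) ->
  exists2 C : R, 0 < C & forall r, 0 < r -> expR (M r) * Y r <= C * (1 + r)^-1 ^+ 4.
Proof.
move=> k0 c0 CY0 cM cY Y0 hM hY.
have [r0 r00 H] := evI (ev_ge 1) (evI hM hY).
have cP : cont0 (fun r => expR (M r) * Y r * (1 + r) ^+ 4).
  apply: cont0M; first by apply: cont0M => //; exact: cont0_comp (@continuous_expR R) cM.
  by apply: cont0X; apply: cont0D; [exact: cont0_cst|exact: cont0_id].
have [N N0 hN] := cont0_bounded r0 cP.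
have D0 : 0 < 96 * CY / c ^+ 3 by rewrite divr_gt0 ?exprn_gt0 // mulr_gt0.
exists (N + 96 * CY / c ^+ 3); first by rewrite ltr_wpDl.
move=> r r_gt0; have r1 : 0 < 1 + r by lra.
rewrite exprVn ler_pdivlMr ?exprn_gt0 //.
have [rr|rr] := leP r r0.
  by apply: le_trans (ler_norm _) _; apply: le_trans (hN r _) _; lra.
have [ge1 [hM' hY']] := H r (ltW rr).
set x := r ^+ (2 * k) in hM' hY'.
have x0 : 0 < x by rewrite exprn_gt0.
have xr : r ^+ 2 <= x by rewrite ler_weXn2l // leq_pmulr.
have h4 : (1 + r) ^+ 4 <= 16 * x ^+ 2.
  apply: le_trans (_ : (2 * r) ^+ 4 <= _).
    by apply: lerXn2r; rewrite ?nnegrE; lra.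
  rewrite exprMn -natrX ler_pM2l // (exprM r 2 2).
  by apply: lerXn2r; rewrite ?nnegrE ?sqr_ge0 ?(ltW x0).
have hE : expR (M r) <= expR (- (c * x)) by rewrite ler_expR -mulNr.
apply: le_trans (_ : expR (- (c * x)) * (CY * x) * (16 * x ^+ 2) <= _).
  have Yr := Y0 r r_gt0.
  have p1 : 0 <= expR (M r) * Y r by rewrite mulr_ge0 // expR_ge0.
  have p2 : 0 <= (1 + r) ^+ 4 by rewrite exprn_ge0 // ltW.
  exact: ler_pM p1 p2 (ler_pM (expR_ge0 _) Yr hE hY') h4.
have cx0 : 0 <= c * x by rewrite mulr_ge0 // ltW.
have e3 := expR_ge1Dxn 2 cx0; rewrite (_ : 3`! = 6)%N // in e3.
have E0 := expR_gt0 (c * x).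
rewrite expRN; set E := expR (c * x) in e3 E0 *.
have -> : E^-1 * (CY * x) * (16 * x ^+ 2) = (16 * CY / c ^+ 3) * ((c * x) ^+ 3 / E).
  by field; rewrite !gt_eqF.
have : (c * x) ^+ 3 / E <= 6 by rewrite ler_pdivrMr //; lra.
have P0 : 0 < 16 * CY / c ^+ 3 by rewrite divr_gt0 ?exprn_gt0 // mulr_gt0.
rewrite -(ler_pM2l P0); lra.
Qed.

Variables (m : nat) (alpha : R).
Hypothesis m2 : (2 <= m)%N.
Hypothesis em : ~~ odd m.

Let m0 : (0 < m)%N. Proof. exact: leq_trans m2. Qed.
Let m1 : (0 < m.-1)%N. Proof. by rewrite -ltnS prednK. Qed.

(** In dimensions 1 and 2 a radial function with positive Laplacian grows at least like
    [ln r], so it does not stay negative. *)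
Lemma dim_ge3 (w q : nat -> R -> R) al : (forall b, chain n m b w q al) ->
  (forall r, 0 < r -> w m r = expR (w 0%N r)) ->
  (forall r, 0 < r -> w m.-1 r < 0) -> (3 <= n)%N.
Proof.
move=> hw hm neg; rewrite ltnNge; apply/negP => n2.
have hl b : lap n 0 b (w m.-1) (q m.-1) (w m).
  have [|h _ _] := hw b m.-1; first by rewrite prednK.
  by rewrite prednK // in h.
have qpos r : 0 < r -> 0 < q m.-1 r.
  move=> r0; have rr : 0 < r < r + 1 by lra.
  have [|_ h2 h3] := hw (r + 1) m.-1; first by rewrite prednK.
  have [|//] := lap_gt0 n1 (lexx 0) (hl (r + 1)) h2 h3 (lexx 0) _ rr.
  by move=> s s1; rewrite hm ?expR_gt0 //; lra.
pose P r := r ^+ n.-1 * q m.-1 r.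
pose c := P 1; have c0 : 0 < c by rewrite /c /P expr1n mul1r qpos.
have hP r : 1 <= r -> c <= P r.
  move=> r1; have G x : 0 < x < r + 1 -> isd P x (x ^+ n.-1 * w m x) /\ 0 <= x ^+ n.-1 * w m x.
    move=> xr; split; first exact: (lap_flux n1 (lexx 0) (hl (r + 1))) xr.
    by rewrite mulr_ge0 ?exprn_ge0 ?hm ?expR_ge0 //; lra.
  by apply: (incr_oo G); lra.
have mono r : 2 <= r -> w m.-1 2 - c * ln 2 <= w m.-1 r - c * ln r.
  move=> r2; have G x : 1 < x < r + 1 ->
      isd (fun r => w m.-1 r - c * ln r) x (q m.-1 x - c * x^-1) /\ 0 <= q m.-1 x - c * x^-1.
    move=> xr; have x0 : 0 < x by lra.
    split.
      apply: isdB; first by have [] := hl (r + 1) x; [lra|].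
      by apply: isdZ; exact: is_derive1_ln.
    rewrite subr_ge0 ler_pdivrMr //; apply: le_trans (hP x _) _; first lra.
    rewrite /P mulrC ler_pM2l ?qpos // -[leRHS]expr1 ler_weXn2l //; first lra.
    by move: n2; lia.
  by apply: (incr_oo G); lra.
pose x := expR (ln 2 - w m.-1 2 / c).
have w2 := neg 2 ltac:(lra).
have lx : ln x = ln 2 - w m.-1 2 / c by rewrite expRK.
have x2 : 2 <= x.
  rewrite -[leLHS]lnK ?posrE // ler_expR lerDl oppr_ge0 mulr_le0_ge0 ?invr_ge0; lra.
have := mono x x2; have := neg x (expR_gt0 _); rewrite lx mulrBr.
have -> : c * (w m.-1 2 / c) = w m.-1 2 by field; rewrite gt_eqF.
lra.
Qed.

(** If the last iterated Laplacian stays away from [0] then [u <= - c1 r^(2m-2)] for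
    large [r]. Truncate the exponential at [M = u + eps * Y 0], where [Y 0] grows like
    [r^(2m-2)] and [eps] is so small that [exp M] still decays. A weighted Gronwall
    inequality shows that data within [d] of [beta] raise the solution by at most
    [O(d) * Y 0], so for small [d] the truncation is inactive. *)
Lemma strict_interior (beta : 'rV[R]_m.-1) (w q : nat -> R -> R) (eta : R) :
  w 0%N 0 = alpha -> (forall b, chain n m b w q (data alpha beta)) ->
  (forall r, 0 < r -> w m r = expR (w 0%N r)) ->
  (forall r, 0 < r -> w m.-1 r < 0) ->
  0 < eta -> (forall r, 0 < r -> w m.-1 r <= - eta) ->
  interior (global_data n m alpha) beta.
Proof.
move=> w00 hw hm neg eta0 hneg.
have n3 := dim_ge3 hw hm neg.
have cz : cont0 (fun _ : R => 1 : R) by exact: cont0_cst.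
pose Y : nat -> R -> R := chaininv n m.-1 (fun=> 1) (fun=> 1).
have Ytop : Y m.-1 = fun=> 1 by exact: chaininv_top.
have cY k : cont0 (Y k) by exact: chaininv_cont0.
have hY b : chain n m.-1 b Y (fun k r => r * avg n (Y k.+1) r) (fun=> 1).
  exact: chaininv_chain.
have Yge k r : (k < m.-1)%N -> 0 < r -> 1 <= Y k r.
  move=> km r0; have rr : 0 < r < r + 1 by lra.
  by have [||_] := chain_ge0 n1 (hY (r + 1)) _ _ km rr => // *; rewrite Ytop.
have Yge' k r : (k < m)%N -> 0 < r -> 1 <= Y k r.
  move=> km r0; have [|mk] := ltnP k m.-1; first by move=> ?; exact: Yge.
  by have -> : k = m.-1 by [lia]; rewrite Ytop.
pose Yq k r : R := if k == m.-1 then 0 else r * avg n (Y k.+1) r.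
pose Yg k r : R := if k == m.-1 then 0 else Y k.+1 r.
have hYk b k : (k < m)%N -> [/\ lap n 0 b (Y k) (Yq k) (Yg k),
    Y k r @[r --> 0^'+] --> (1 : R) & Yq k r @[r --> 0^'+] --> (0 : R)].
  move=> km; rewrite /Yq /Yg; case: eqP => [->|/eqP ne].
    rewrite Ytop; split; [|exact: rlim_cst|exact: rlim_cst].
    move=> r rb; split; first exact: isd_cst.
    by apply: isd_eq (isd_cst r 0) _; rewrite mulr0 subrr.
  by apply: hY; move: km ne; lia.
have Yg0 k r : (k < m)%N -> 0 < r -> 0 <= Yg k r.
  move=> km r0; rewrite /Yg; case: eqP => // /eqP ne; apply: le_trans ler01 _.
  by apply: Yge' => //; move: km ne; lia.
have Yq0 k r : (k < m)%N -> 0 < r -> 0 <= Yq k r.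
  move=> km r0; have rr : 0 < r < r + 1 by lra.
  have [l1 l2 l3] := hYk (r + 1) k km.
  have [|//] := lap_ge0 n1 (lexx 0) l1 l2 l3 (lexx 0) _ rr.
  by move=> s s1; apply: Yg0 => //; lra.
have cw : cont0 (w 0%N).
  apply: (@cont0_isd _ _ (q 0%N)).
    by rewrite w00; have [] := hw 1 0%N m0.
  by move=> r r0; apply: (chain_isd (hw (r + 1)) m0); lra.
have ck : 0 < coef R n m.-1 by exact: coef_gt0.
set ck0 := coef R n m.-1 in ck.
pose c1 := eta * ck0 / 2; have c10 : 0 < c1 by rewrite divr_gt0 // mulr_gt0.
have hu : ev (fun r => w 0%N r <= - c1 * r ^+ (2 * m.-1)).
  have hk b : chain n m.-1 b w q _ := chain_sub (leq_pred m) (lexx b) (hw b).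
  have ht : ev (fun r => w m.-1 r <= - eta) by exists 1 => // r r1; apply: hneg; lra.
  have := chain_growth n1 hk ht c10; rewrite -/ck0.
  have -> : - eta * ck0 + c1 = - c1 by rewrite /c1; field.
  exact.
pose CY := ck0 + 1; have CY0 : 0 < CY by rewrite /CY; lra.
have hYg : ev (fun r => Y 0%N r <= CY * r ^+ (2 * m.-1)).
  have ht : ev (fun r => Y m.-1 r <= 1) by exists 1 => // r r1; rewrite Ytop.
  by have := chain_growth n1 hY ht ltr01; rewrite -/ck0 mul1r.
pose eps := c1 / (2 * CY); have eps0 : 0 < eps by rewrite divr_gt0 // mulr_gt0.
pose M r := w 0%N r + eps * Y 0%N r.
have cM : cont0 M by apply: cont0D => //; apply: cont0M => //; exact: cont0_cst.
have hM : ev (fun r => M r <= - (c1 / 2) * r ^+ (2 * m.-1)).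
  apply: ev_imp (evI hu hYg) => r r0 []; rewrite /M; set X := r ^+ _ => h1 h2.
  have : eps * Y 0%N r <= eps * (CY * X) by rewrite ler_pM2l.
  have -> : eps * (CY * X) = c1 / 2 * X by rewrite /eps; field; rewrite gt_eqF.
  lra.
have c12 : 0 < c1 / 2 by lra.
have Ypos r : 0 < r -> 0 <= Y 0%N r.
  by move=> r0; apply: le_trans ler01 _; exact: Yge.
have [C C0 hC] := exp_decay_bound m1 c12 CY0 cM (cY 0%N) Ypos hM hYg.
(* [psi k] is the polyharmonic polynomial [Y k] times [exp (C * bump)]: the factor lies
   between [1] and [exp C], and its Laplacian absorbs the term [exp M * Y 0], which
   is at most [C (1 + r)^-4] *)
pose lam := C; have lam0 : 0 <= lam by exact: ltW.
pose z r := lam * bump r.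
pose psi k r := expR (z r) * Y k r.
pose psiq k r := expR (z r) * (lam * bumpq r * Y k r + Yq k r).
pose psig k r := expR (z r) * (((lam * bumpq r) ^+ 2 + lam * bumpg r) * Y k r +
   2 * (lam * bumpq r) * Yq k r + Yg k r).
have bq r : 0 < r -> 0 <= bumpq r.
  by move=> r0; rewrite /bumpq mulr_ge0 ?exprn_ge0 ?invr_ge0; lra.
have zr : expR (z r) @[r --> 0^'+] --> (1 : R).
  have [b1 _] := bump_isd (lexx 0).
  have := cont_rlim (isd_cont (isd_exp (isdZ lam b1))).
  by rewrite /bump mul0r expr0n !mulr0 expR0.
have zq : bumpq r @[r --> 0^'+] --> (0 : R).
  have [_ b2] := bump_isd (lexx 0).
  by have := cont_rlim (isd_cont b2); rewrite {2}/bumpq mul0r.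
have hpsi b k : (k < m)%N -> [/\ lap n 0 b (psi k) (psiq k) (psig k),
    psi k r @[r --> 0^'+] --> (1 : R) & psiq k r @[r --> 0^'+] --> (0 : R)].
  move=> km; have [l1 l2 l3] := hYk b k km; split.
  - exact: lap_expM l1 (lapZ lam (@bump_lap b)).
  - by have := rlimM zr l2; rewrite mulr1.
  have := rlimM zr (rlimD (rlimM (rlimM (@rlim_cst R 0 lam) zq) l2) l3).
  by rewrite mulr0 mul0r addr0 mulr0.
have psig_ge k r : (k < m)%N -> 0 < r ->
    expR (z r) * (lam * (3 * (1 + r)^-1 ^+ 4) + Yg k r) <= psig k r.
  move=> km r0; rewrite /psig ler_pM2l ?expR_gt0 // lerD2r.
  have h1 : 0 <= 2 * (lam * bumpq r) * Yq k r.
    have p1 := mulr_ge0 lam0 (bq r r0).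
    by apply: mulr_ge0; [apply: mulr_ge0|exact: Yq0].
  have h2 : 0 <= (lam * bumpq r) ^+ 2 * Y k r.
    apply: mulr_ge0; first exact: sqr_ge0.
    by apply: le_trans ler01 _; exact: Yge'.
  have bge := bumpg_ge n3 r0.
  have y4 : 0 < (1 + r)^-1 ^+ 4 by rewrite exprn_gt0 // invr_gt0; lra.
  have h3 : lam * (3 * (1 + r)^-1 ^+ 4) <= lam * bumpg r by rewrite ler_wpM2l.
  have h4 : lam * bumpg r <= lam * bumpg r * Y k r.
    rewrite ler_peMr //; last exact: Yge'.
    by apply: mulr_ge0 => //; lra.
  rewrite mulrDl; lra.
have top0 s : 0 < s -> 0 <= lam * (3 * (1 + s)^-1 ^+ 4).
  move=> s0; apply: mulr_ge0 => //; apply: mulr_ge0 => //.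
  by rewrite exprn_ge0 // invr_ge0; lra.
pose d := eps / (2 * expR lam).
have el : 0 < expR lam by exact: expR_gt0.
have d0 : 0 < d by rewrite divr_gt0 // mulr_gt0.
apply/nbhs_ballP; exists d => // b' hb'.
have hal k : data alpha b' k - data alpha beta k <= d.
  case: k => [|k] /=; first by rewrite subrr ltW.
  case: insubP => [i _ _|_]; last by rewrite subrr ltW.
  have := (ball_rV _ _ d0).1 hb' i; rewrite ltr_norml; lra.
have [v [hv cv v00 hvm]] := @trunc_exists R n n1 m (data alpha b') 1 M m0 cM.
apply: (@global_dataP R n m alpha b' (v 0%N)).
have M0 : alpha <= M 0.
  rewrite /M w00 lerDl mulr_ge0 ?(ltW eps0) // /Y chaininvE // lapinv0.
  exact: ler01.
apply: (trunc_radial n1 m2 em hv cv v00 hvm) => r r0.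
have /predU1P[<-|{}r0] : (0 == r) || (0 < r) by rewrite -le_eqVlt.
  by rewrite v00.
pose c := r + 1.
have D : v 0%N r - w 0%N r <= 2 * d * psi 0%N r.
  apply: (@sup_gronwall R n n1 m (r + 2) c _ _ _ psi psiq psig (fun=> 1) d 1 m0
     _ (ltW d0) ltr01 (chainB (hv (r + 2)) (hw (r + 2)))).
  - by rewrite /c; lra.
  - by move=> k km; exact: hpsi.
  - move=> k s km sc; have s0 : 0 < s by lra.
    apply: le_trans (psig_ge k s (ltnW km) s0); rewrite /psi ler_pM2l ?expR_gt0 //.
    have -> : Yg k s = Y k.+1 s by rewrite /Yg; case: eqP => // e; move: km; rewrite e prednK ?ltnn.
    by rewrite lerDr; exact: top0.
  - by move=> k km; split => //; rewrite mulr1; exact: hal.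
  - move=> s sc; have s0 : 0 < s by lra.
    have km : (m.-1 < m)%N by rewrite prednK.
    split.
      rewrite /psi -[leLHS]mulr1; apply: ler_pM => //; last exact: Yge.
      by rewrite -expR0 ler_expR mulr_ge0 // bump_ge0.
    apply: le_trans (psig_ge _ _ km s0).
    apply: mulr_ge0; first exact: expR_ge0.
    by apply: addr_ge0; [exact: top0|exact: Yg0].
  - move=> N N0 hN s sc; have s0 : 0 < s by lra.
    have km : (m.-1 < m)%N by rewrite prednK.
    have N2 : 0 <= N / 2 by rewrite divr_ge0.
    apply: le_trans (ler_wpM2l N2 (psig_ge _ _ km s0)).
    rewrite {1}/Yg eqxx addr0 hvm ?hm //; last exact: ltW.
    have y4 : 0 < (1 + s)^-1 ^+ 4 by rewrite exprn_gt0 // invr_gt0; lra.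
    have := hN s sc; set x := v 0%N s; set y := w 0%N s => hxy.
    have yM : y <= M s by rewrite /M lerDl mulr_ge0 ?(ltW eps0) // (le_trans ler01) // Yge.
    have [lxy|lyx] := leP x y.
      apply: le_trans (_ : 0 <= _).
        by rewrite mul1r subr_le0 ler_expR; apply: le_trans lxy; rewrite ge_min lexx.
      by apply: mulr_ge0 => //; apply: mulr_ge0; [exact: expR_ge0|exact: top0].
    have hl := expR_lip_min (M s) x y; rewrite (min_idPl yM) in hl.
    rewrite mul1r; apply: le_trans (le_trans (ler_norm _) hl) _.
    rewrite gtr0_norm ?subr_gt0 //.
    have e1 := hC s s0; set y5 := _ ^+ 4 in e1 y4 *.
    apply: le_trans (ler_wpM2l (expR_ge0 _) hxy) _.
    rewrite /psi; set Z := expR (z s); set E := expR (M s) in e1 *.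
    have Z0 : 0 < Z by exact: expR_gt0.
    have -> : E * (N * (Z * Y 0%N s)) = (N * Z) * (E * Y 0%N s) by ring.
    have -> : N / 2 * (Z * (lam * (3 * y5))) = (N * Z) * (3 / 2 * (C * y5)).
      by rewrite /lam; field.
    have NZ : 0 <= N * Z by rewrite mulr_ge0 // ltW.
    rewrite ler_wpM2l //; apply: le_trans e1 _.
    have : 0 < C * y5 by rewrite mulr_gt0.
    lra.
  - by rewrite /c; lra.
have pe : psi 0%N r <= expR lam * Y 0%N r.
  rewrite /psi ler_wpM2r //; first by apply: le_trans ler01 _; exact: Yge.
  by rewrite ler_expR /z -[leRHS]mulr1 ler_wpM2l // bump_le.
have : 2 * d * psi 0%N r <= 2 * d * (expR lam * Y 0%N r).
  by rewrite ler_wpM2l // mulr_ge0 // ltW.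
have -> : 2 * d * (expR lam * Y 0%N r) = eps * Y 0%N r by rewrite /d; field; rewrite gt_eqF.
by rewrite /M; lra.
Qed.

(** The last Laplacian is negative and increasing. Its limit is [0], since a negative
    limit would make [beta] interior. *)
Lemma even_boundary (beta : 'rV[R]_m.-1) T u :
  boundary (global_data n m alpha) beta ->
  maximal_solution n m alpha beta T u ->
  [/\ T = +oo%E,
      u r / r ^+ (2 * m - 2) @[r --> +oo] --> (0 : R) &
      exists C rbar : R, [/\ 0 < C, 0 < rbar &
        forall r : R, rbar < r -> u r < - (2 * m)%:R * ln r + C]].
Proof.
move=> [hcl hint] mu.
have [v sv] := even_closed n1 m2 em hcl.
have TE := maximal_global n1 m0 mu sv.
have su : radial_solution n m alpha beta +oo%E u by rewrite -TE; case: mu.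
split => //; last exact: even_log_decay su.
have [w [q [w0 hw hm neg]]] := even_chain n1 m2 em su.
have w00 : w 0%N 0 = alpha by rewrite w0; case: su => _ _ _ [].
have hl (eta : R) : 0 < eta -> ev (fun r => `|w m.-1 r - 0| <= eta).
  move=> eta0; have [[r [r0 hr]]|nex] := pselect (exists r : R, 0 < r /\ - eta < w m.-1 r).
    exists r => // s rs; have s0 : 0 < s by lra.
    have := top_incr n1 m2 hw hm r0 rs; have := neg s s0.
    by rewrite subr0 ler_norml; lra.
  case: hint; apply: (strict_interior w00 hw hm neg eta0) => r r0.
  by rewrite leNgt; apply/negP => h; apply: nex; exists r.
have hk b : chain n m.-1 b w q _ := chain_sub (leq_pred m) (lexx b) (hw b).
apply/cvgrPdist_lt => e e0; have e2 : 0 < e / 2 by lra.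
apply: ev_pinfty; apply: ev_imp (evI (ev_ge 1) (chain_asymp n1 hk hl e2)) => r r0 [r1].
have -> : (2 * m - 2 = 2 * m.-1)%N by lia.
set X := r ^+ _; have X0 : 0 < X by rewrite exprn_gt0.
rewrite w0 !mul0r subr0 sub0r normrN normrM normfV (gtr0_norm X0) => h.
rewrite ltr_pdivrMr //; apply: le_lt_trans h _.
have : 0 < e * X by rewrite mulr_gt0.
lra.
Qed.

End Stability.

Theorem theorem2p5 (R : realType) (n : nat) (hn : (1 <= n)%N) :
  (* (i) *)
  (forall (m : nat) (alpha : R) (beta : 'rV[R]_m.-1) (T : \bar R) (u : R -> R),
     (3 <= m)%N -> odd m ->
     maximal_solution n m alpha beta T u ->
     (exists k : 'I_m.-1, Num.sg (beta 0 k) <> (-1) ^+ k.+1) ->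
     T = +oo%E /\
     exists C rbar : R, [/\ 0 < C, 0 < rbar &
       forall r : R, rbar < r -> u r < - C * r ^+ 4]) /\
  (* (ii) *)
  (forall (m : nat) (alpha : R) (beta : 'rV[R]_m.-1) (T : \bar R) (u : R -> R),
     (3 <= m)%N -> odd m -> (n <= 2 * m - 1)%N ->
     maximal_solution n m alpha beta T u ->
     T = +oo%E /\
     exists (C rbar : R) (K : nat), [/\ 0 < C, 0 < rbar, (0 < K)%N &
       forall r : R, rbar < r -> u r < - C * r ^+ K]) /\
  (* (iii) *)
  (n = 1%N ->
   forall (m : nat) (u : R -> R),
     (1 <= m)%N -> odd m ->
     class_C (V := R^o) (2 * m) setT u ->
     (forall x : R, iter m (fun f s => - (f^`()^`())%classic s) u x = expR (u x)) ->
     exists (C rbar : R) (K : nat), [/\ 0 < C, 0 < rbar, (0 < K)%N &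
       forall x : R, rbar < `|x| -> u x < - C * `|x| ^+ K]) /\
  (* (iv) *)
  (forall (m : nat) (alpha : R) (beta : 'rV[R]_m.-1) (T : \bar R) (u : R -> R),
     (2 <= m)%N -> ~~ odd m ->
     interior (global_data n m alpha) beta ->
     maximal_solution n m alpha beta T u ->
     T = +oo%E /\
     exists C : R, 0 < C /\
       u r / (- C * r ^+ (2 * m - 2)) @[r --> +oo] --> (1 : R)) /\
  (* (v) *)
  (forall (m : nat) (alpha : R) (beta : 'rV[R]_m.-1) (T : \bar R) (u : R -> R),
     (2 <= m)%N -> ~~ odd m ->
     boundary (global_data n m alpha) beta ->
     maximal_solution n m alpha beta T u ->
     [/\ T = +oo%E,
         u r / r ^+ (2 * m - 2) @[r --> +oo] --> (0 : R) &
         exists C rbar : R, [/\ 0 < C, 0 < rbar &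
           forall r : R, rbar < r -> u r < - (2 * m)%:R * ln r + C]]).

Proof.
split; [|split; [|split; [|split]]].
- by move=> m alpha beta T u m3 om; exact: odd_wrong_sign.
- by move=> m alpha beta T u m3 om nm; exact: odd_low_dim.
- by move=> _ m u m1 om cu hu; exact: (line_decay m1 om cu hu).
- by move=> m alpha beta T u m2 em; exact: even_interior.
- by move=> m alpha beta T u m2 em; exact: even_boundary.
Qed.
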